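(* In the multiclass queue described in the context, assume $\rho(\mathbf{M})<1$. Let $F$ be a distribution on $[0,\infty)$ that is subexponential with finite mean and regularly varying, i.e. $\overline F(x)=1-F(x)=L(x)/x^{\alpha}$ with $L$ slowly varying, and suppose that for constants $c_1,\dots,c_K\ge 0$, with $c_k>0$ for some $k$, $$\overline F_i\bigl(x/(1+\beta_i)\bigr)\sim c_i\overline F(x),\qquad x\to\infty,\quad i=1,\dots,K.$$ Then for each $i=1,\dots,K$, $$\mathbb{P}(B_i>x)\sim d_i\,\overline F(x),\quad x\to\infty,\qquad\text{where } d_i=\sum_{j=1}^K\bigl((\mathbf{I}-\mathbf{M})^{-1}\bigr)_{ij}c_j.$$
   Context: Queue. A single server serves jobs of $K$ classes, one at a time, under a non-idling policy. Class $i$ service times are i.i.d., distributed as $S_i\ge 0$ with distribution $F_i$, tail $\overline F_i=1-F_i$ and mean $\mathbb{E}S_i=1/\mu_i\in(0,\infty)$. While a class $i$ job is in service, class $j$ jobs arrive according to a Poisson process of rate $\lambda_{ij}\ge 0$, all these processes being independent of each other and of the service times. $\mathbf{M}$ is the $K\times K$ matrix with entries $M_{ij}=\lambda_{ij}/\mu_i$, assumed irreducible, with spectral radius $\rho(\mathbf{M})$; $\mathbf{I}$ is the identity. $B_i$ is the busy period (time until the system becomes empty) when the system starts with a single class $i$ customer beginning service. Its distribution does not depend on the policy: $B_i$ is the sum of the lifetimes of all individuals in a $K$-type branching process started from one type $i$ individual, where a type $k$ individual has lifetime distributed as $S_k$ and, given its lifetime $s$, independently has Poisson$(\lambda_{kj}s)$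 children of type $j$. Put $\beta_i=\sum_{j=1}^K\lambda_{ij}\mathbb{E}B_j$ (finite when $\rho(\mathbf{M})<1$). The relation $a(x)\sim c\,b(x)$ means $a(x)/b(x)\to c$ (allowing $c=0$). A distribution $F$ on $[0,\infty)$ is subexponential if $\overline{F^{*2}}(x)/\overline F(x)\to2$. *)

(* Defs.v *)
From HB Require Import structures.
From mathcomp Require Import all_boot all_order all_algebra finmap.
From mathcomp Require Import complex.
From mathcomp Require Import all_classical all_reals all_analysis.

Set Implicit Arguments.
Unset Strict Implicit.
Unset Printing Implicit Defensive.

Import Order.TTheory GRing.Theory Num.Theory.
Import numFieldNormedType.Exports.

Local Open Scope classical_set_scope.
Local Open Scope ring_scope.

Section tails.
Context {R : realType}.
Implicit Types (F : probability R R) (a b L : R -> R).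

Definition supported_ge0 F : Prop := F `[0%R, +oo[%classic = 1%E.

Definition tail F (x : R) : R := fine (F `]x, +oo[%classic).

(* [sim_at_infty a c b] reads a(x) ~ c b(x) as x -> oo; c = 0 is allowed.     *)
Definition sim_at_infty a (c : R) b : Prop := a x / b x @[x --> +oo] --> c.

Definition convolution_tail F (x : R) : R :=
  fine ((F \x F)%E [set y | x < y.1 + y.2]).

(* Since x / 0 = 0, the limit 2 forces the tail of F to be positive           *)
(* everywhere.                                                                *)
Definition subexponential F : Prop :=
  supported_ge0 F /\ sim_at_infty (convolution_tail F) 2 (tail F).

Definition slowly_varying L : Prop :=
  [/\ measurable_fun [set x : R | 0 < x] L,
      \forall x \near +oo, 0 < L x &
      forall t, 0 < t -> L (t * x) / L x @[x --> +oo] --> (1 : R)].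

(* The sign of the index alpha need not be constrained: a tail is bounded.    *)
Definition regularly_varying_tail F : Prop :=
  exists (alpha : R) (L : R -> R),
    slowly_varying L /\ forall x, 0 < x -> tail F x = L x / x `^ alpha.

End tails.

Section matrices.
Context {R : realType} {K : nat}.
Implicit Types M : 'M[R]_K.

Definition spectral_radius M : R :=
  sup [set ComplexField.Normc.normc z | z in [set z : R[i] |
    eigenvalue (map_mx (real_complex R) M) z]].

(* For matrices with nonnegative entries. *)
Definition irreducible_mx M : Prop :=
  forall i j, exists2 n, (0 < n)%N & 0 < (M ^+ n) i j.

End matrices.

Section independence.
Context {d : measure_display} {T : measurableType d} {R : realType}.

Definition mutually_independent (P : probability T R) (I : choiceType)
    (G : I -> set_system T) : Prop :=
  forall (J : {fset I}) (E : I -> set T),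
    (forall u, u \in J -> G u (E u)) ->
    P (\bigcap_(u in [set` J]) E u) = (\prod_(u <- J) P (E u))%E.

End independence.

(* Probability of the value n under the Poisson law of mean r >= 0. Unlike    *)
(* the library's [poisson_pmf], this is also the right value (that of the     *)
(* Dirac mass at 0) when r = 0.                                               *)
Definition poisson_mass {R : realType} (r : R) (n : nat) : R :=
  expR (- r) * r ^+ n / n`!%:R.

Section branching.
Context {K : nat}.

(* Ulam-Harris labels, youngest generation first: [::] is the ancestor and    *)
(* (j, n) :: u is the (n+1)-st child of type j of the individual u.           *)
Definition label := seq ('I_K * nat).

Definition label_type (i : 'I_K) (u : label) : 'I_K :=
  if u is (j, _) :: _ then j else i.

Context {d : measure_display} {T : measurableType d} {R : realType}.

(* The K-type branching process started from one individual of type i.        *)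
(* Lifetimes and offspring numbers are attached to all potential individuals; *)
(* [born] selects those that actually occur.                                  *)
Record branching_process (P : probability T R) (F : 'I_K -> probability R R)
    (lambda : 'I_K -> 'I_K -> R) (i : 'I_K) := BranchingProcess {
  lifetime : label -> {RV P >-> R} ;
  children : label -> 'I_K -> {RV P >-> nat} ;
  lifetime_ge0 : forall u w, 0 <= lifetime u w ;
  lifetime_law : forall u (A : set R), measurable A ->
    distribution P (lifetime u) A = F (label_type i u) A ;
  (* given the lifetime s, the numbers of children of the various types are   *)
  (* independent Poisson variables of means lambda_{kj} s                     *)
  children_law : forall u (A : set R) (n : 'I_K -> nat),
    measurable A ->
    P (lifetime u @^-1` A `&` [set w | forall j, children u j w = n j]) =
    (\int[F (label_type i u)]_(s in A)
       (\prod_j poisson_mass (lambda (label_type i u) j * s) (n j))%R%:E)%E ;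
  individuals_independent : mutually_independent P (fun u : label =>
    <<s g_sigma_algebra_preimage (lifetime u) `|`
        \bigcup_j g_sigma_algebra_preimage (children u j) >>)
}.

Section total_progeny.
Context {P : probability T R} {F : 'I_K -> probability R R}.
Context {lambda : 'I_K -> 'I_K -> R} {i : 'I_K}.
Variable X : branching_process P F lambda i.

Fixpoint born (u : label) (w : T) : bool :=
  if u is (j, n) :: v then born v w && (n < children X v j w)%N else true.

(* The busy period of a queue starting with a single class i customer: the    *)
(* jobs are the individuals and the children of a job are the arrivals during *)
(* its service. A single non-idling server is busy for the sum of all service *)
(* times.                                                                     *)
Definition busy_period (w : T) : \bar R :=
  \esum_(u in [set: label]) (if born u w then (lifetime X u w)%:E else 0%E).

Definition busy_tail (x : R) : R :=
  fine (P [set w | (x%:E < busy_period w)%E]).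

End total_progeny.
End branching.

Section queue_constants.
Context {K : nat} {d : measure_display} {T : measurableType d} {R : realType}.
Context {P : probability T R} {F : 'I_K -> probability R R}.
Context {lambda : 'I_K -> 'I_K -> R}.

Definition mean_busy_input (B : forall j, branching_process P F lambda j)
    (i : 'I_K) : R :=
  \sum_j lambda i j * fine (\int[P]_w busy_period (B j) w)%E.

End queue_constants.

Definition mean_offspring {R : realType} {K : nat}
    (lambda : 'I_K -> 'I_K -> R) (mu : 'I_K -> R) : 'M[R]_K :=
  \matrix_(i, j) (lambda i j / mu i).

(* Main.v *)
(* Since the busy period is the total lifetime of the branching process, the  *)
(* Ulam-Harris labels may be explored in the order of their codes, whatever   *)
(* the family tree. For weights b, let a walk start from b_i and move by      *)
(* S_u + sum_j b_j N_uj - b_k whenever the label u, of type k, is born, where *)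
(* S_u and N_u are its lifetime and offspring numbers. It dominates the work  *)
(* done so far, and the sigma-algebra of the explored labels is independent   *)
(* of (S_u, N_u). With b_k = E B_k the walk is a martingale, and a lifetime s *)
(* of type k moves it by about (1 + beta_k) s, whence the probability         *)
(* c_k P(F > x) of a jump beyond x and, the expected number of individuals of *)
(* type j being ((I - M)^-1)_ij, the constant d_i.                            *)
(*                                                                            *)
(* Upper bound: slightly larger weights give the walk a drift - delta. Let    *)
(* phi(y) = C * (integral of the tail of F from x - y to (1 - eta) x), cut to *)
(* [0, 1]. For C large, the drift compensates the risk of jumps smaller than  *)
(* x, and E phi increases at each individual of type k by at most             *)
(* (c_k + eta) P(F > x) while the walk is below eta x / 2, and by             *)
(* O(P(F > x)) afterwards; the individuals met afterwards are few.            *)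
(*                                                                            *)
(* Lower bound: slightly smaller weights make exp(- theta walk) a             *)
(* supermartingale for some theta > 0. After the first lifetime larger than   *)
(* y_k = (1 + eps) x / (1 + beta_k) it is at most exp(- theta (1 + eps') x)   *)
(* in mean, so that the total work is unlikely to be less than x.             *)

Require Import Defs.
From HB Require Import structures.
From mathcomp Require Import all_boot all_order all_algebra finmap.
From mathcomp Require Import complex polyrcf ring lra.
From mathcomp Require Import all_classical all_reals all_analysis.
From mathcomp Require Import measurable_realfun.

Set Implicit Arguments.
Unset Strict Implicit.
Unset Printing Implicit Defensive.

Import Order.TTheory GRing.Theory Num.Theory.
Import numFieldNormedType.Exports.

Local Open Scope classical_set_scope.
Local Open Scope ring_scope.

(** * Nonnegative matrices of spectral radius less than 1 *)

(** A busy period exceeds a large x essentially because of a single long service. A type k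
    individual of lifetime s brings in about beta_k s of further work through its offspring, so it
    carries the total beyond x when s > x / (1 + beta_k), which has probability about c_k times the
    tail of F at x. Every individual of the tree offers such a chance, and the expected number of
    those of type j is ((I - M)^-1)_ij by [births_cvg]; this gives d_i.

    The tree is explored label by label. Parents precede children ([pickle_parent]), so whether a
    label is born is decided by labels of smaller code ([born_past]), while its lifetime and
    offspring numbers are independent of them ([past_data_independent], [integral_step]). The
    process [walk] adds to the work done a weight for the individuals still waiting, hence dominates
    the work ([walk_ge]). With the weights b_k = E B_k, which solve b = m + M b where m_k = 1/mu_k
    ([mean_busy_period], [solveE]), its increments are centred; adding or subtracting delta (I -
    M)^-1 1 gives a drift of - delta or + delta.

    Upper bound ([busy_tail_upper]): a jump is large only through its lifetime, up to an
    exponentially small error ([jump_exceed]). The barrier, a truncated integrated tail of F, is a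
    potential equal to 1 once the walk reaches x. One step from a low position raises its mean by at
    most about c_k times the tail of F at x ([drift]). Summing over the individuals
    ([potential_bound]) yields d_i, since few of them are met after the walk has risen
    ([late_small]).

    Lower bound ([busy_tail_lower]): for a small theta the exponential of minus theta times the walk
    is a supermartingale ([discount_weights], [discounted_supermartingale]). Right after the first
    long lifetime its mean is tiny ([discounted_first_large]) and stays so. The part of the walk
    that is not work has a mean tending to 0 ([mean_stack]), so a large walk means a large amount of
    work ([busy_tail_ge]). *)

Lemma poly_root_le (R : rcfType) (p : {poly R}) (a : R) :
  0 <= a -> 0 <= p.[0] -> p.[a] <= 0 -> exists2 s, 0 <= s <= a & root p s.
Proof.
move=> a0 p0 pa; have [|s sa] := @poly_ivt _ (- p) _ _ a0.
  by rewrite !hornerN oppr_ge0 oppr_le0 p0 pa.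
by rewrite rootN; exists s.
Qed.

Section nonnegative_matrices.
Context {R : realType} {K : nat}.
Variable M : 'M[R]_K.
Hypothesis M_ge0 : forall i j, 0 <= M i j.
Hypothesis M_rho : spectral_radius M < 1.

(** The spectral radius is a [sup], which bounds its elements once the set is known to be bounded
    above; the sum of the moduli of all roots of the characteristic polynomial is such a bound. *)
Lemma real_eigenvalue_lt1 (a : R) : eigenvalue M a -> `|a| < 1.
Proof.
move=> ea; apply: le_lt_trans M_rho.
pose Mc := map_mx (real_complex R) M.
apply: ub_le_sup; last first.
  exists (a%:C%C); first by rewrite /= eigenvalue_map.
  by rewrite /ComplexField.Normc.normc /= expr0n addr0 sqrtr_sqr.
have [r rE] := closed_field_poly_normal (char_poly Mc).
exists (\sum_(z <- r) ComplexField.Normc.normc z) => _ [z /= ez <-].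
have zr : z \in r.
  move: ez; rewrite eigenvalue_root_char -/Mc rE rootZ ?root_prod_XsubC//.
  by rewrite (monicP (char_poly_monic _)) oner_neq0.
rewrite (perm_big _ (perm_to_rem zr)) big_cons lerDl; apply: sumr_ge0 => y _.
by case: y => ? ?; exact: sqrtr_ge0.
Qed.

Lemma det_1BtM_neq0 (t : R) : 0 <= t <= 1 -> \det (1%:M - t *: M) != 0.
Proof.
move=> /andP[t0 t1]; apply/det0P => -[v v0 vE].
have {}vE : v = t *: (v *m M).
  by move/eqP: vE; rewrite mulmxBr mulmx1 -scalemxAr subr_eq0 => /eqP.
have [t00|tn0] := eqVneq t 0; first by rewrite t00 scale0r in vE; rewrite vE eqxx in v0.
have tp : 0 < t by rewrite lt_neqAle eq_sym tn0.
have : eigenvalue M t^-1.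
  apply/eigenvalueP; exists v => //.
  by rewrite [X in _ *: X]vE scalerA mulVf// scale1r.
move=> /real_eigenvalue_lt1; rewrite ger0_norm ?invr_ge0// invf_lt1//.
by rewrite ltNge t1.
Qed.

(** Q is I - X M over the polynomials, D its determinant and q_i the i-th row sum of its adjugate,
    so that q(t) / D(t) solves (I - t M) y = 1. Following q from t = 0, where it is 1, up to t = 1
    yields a positive solution of v = 1 + M v. *)
Let Q : 'M[{poly R}]_K := 1%:M - 'X *: map_mx polyC M.
Let D := \det Q.
Let q (i : 'I_K) : {poly R} := \sum_j \adj Q i j.

Let hornerQ (t : R) : map_mx (horner_eval t) Q = 1%:M - t *: M.
Proof.
by apply/matrixP => i j; rewrite !mxE /horner_eval/= !hornerE; case: eqP => _; rewrite !hornerE.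
Qed.

Let hornerD (t : R) : D.[t] = \det (1%:M - t *: M).
Proof. by rewrite -hornerQ det_map_mx. Qed.

Let hornerq (t : R) i : (q i).[t] = D.[t] + t * \sum_j M i j * (q j).[t].
Proof.
pose one : 'cV[{poly R}]_K := const_mx 1.
have E : Q *m (\adj Q *m one) = D *: one by rewrite mulmxA mul_mx_adj mul_scalar_mx.
have qE k : (\adj Q *m one) k 0 = q k.
  by rewrite !mxE; apply: eq_bigr => j _; rewrite !mxE mulr1.
have := congr1 (fun A : 'cV_K => (A i 0).[t]) E.
rewrite mulmxBl mul1mx -scalemxAl !mxE mulr1 -/D => <-.
rewrite !hornerE.
have -> : \sum_j \adj Q i j * one j 0 = q i.
  by apply: eq_bigr => j _; rewrite !mxE mulr1.
suff -> : (\sum_j map_mx polyC M i j * (\adj Q *m one) j 0).[t] = \sum_j M i j * (q j).[t].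
  by rewrite subrK.
by rewrite horner_sum; apply: eq_bigr => j _; rewrite qE !mxE !hornerE.
Qed.

Let D0 : D.[0] = 1.
Proof. by rewrite hornerD scale0r subr0 det1. Qed.

Let D_gt0 t : 0 <= t <= 1 -> 0 < D.[t].
Proof.
move=> /andP[t0 t1]; rewrite ltNge; apply/negP => Dt.
have [|s /andP[s0 st] /rootP] := @poly_root_le _ D _ t0 _ Dt; first by rewrite D0.
by apply/eqP; rewrite hornerD det_1BtM_neq0// s0 (le_trans st).
Qed.

Let q0 i : (q i).[0] = 1.
Proof. by rewrite hornerq mul0r addr0 D0. Qed.

(* At the smallest root in [0, 1] of the product of the q_i, every q_i is     *)
(* nonnegative and one of them vanishes, which [hornerq] excludes.            *)
Let q_gt0 t : 0 <= t <= 1 -> forall i, 0 < (q i).[t].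
Proof.
move=> /andP[t0 t1] i; rewrite ltNge; apply/negP => qt.
have ivt k a : 0 <= a -> (q k).[a] <= 0 -> exists2 s, 0 <= s <= a & root (q k) s.
  by move=> a0; apply: poly_root_le => //; rewrite q0.
pose p := \prod_k q k.
have pE s : root p s = [exists k, root (q k) s].
  rewrite /root horner_prod; apply/eqP/existsP => [/eqP|[k /eqP qk]].
    by move=> /prodf_eq0[k _ qk]; exists k.
  by apply/eqP/prodf_eq0; exists k; rewrite // qk eqxx.
have p0 : p != 0.
  apply/eqP => p0; have := congr1 (fun f : {poly R} => f.[0]) p0.
  rewrite horner_prod horner0; under eq_bigr do rewrite q0.
  by rewrite big1// => /eqP; rewrite oner_eq0.
have proot k s : root (q k) s -> root p s by rewrite pE => qs; apply/existsP; exists k.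
have p00 : ~~ root p 0.
  by apply/negP; rewrite pE => /existsP[k /rootP/eqP]; rewrite q0 oner_eq0.
have [s /andP[s0 st] /proot ps] := ivt i t t0 qt.
have sp : 0 < s.
  by rewrite lt_neqAle s0 andbT; apply: contraNneq p00 => ->.
case: (next_rootP p 0 2) => [pz|r _ pr|c _ _ /(_ s)].
- by rewrite pz eqxx in p0.
- rewrite in_itv/= => /andP[r0 r2] rmin.
  have rs : r <= s.
    rewrite leNgt; apply/negP => sr.
    by have := rmin s; rewrite in_itv/= sp sr ps => /(_ isT).
  have r1 : 0 <= r <= 1 by rewrite (ltW r0) (le_trans rs)// (le_trans st).
  have qr k : 0 <= (q k).[r].
    rewrite leNgt; apply/negP => qk.
    have [y /andP[y0 yr] /[dup] /rootP qy /proot py] := ivt k r (ltW r0) (ltW qk).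
    have y0' : 0 < y.
      by rewrite lt_neqAle y0 andbT; apply: contraNneq p00 => ->.
    have yr' : y < r.
      rewrite lt_neqAle yr andbT; apply: contraTneq qk => <-.
      by rewrite qy ltxx.
    by have := rmin y; rewrite in_itv/= y0' yr' py => /(_ isT).
  have : root p r by apply/rootP.
  rewrite pE => /existsP[k /rootP]; rewrite hornerq => /eqP.
  rewrite gt_eqF// ltr_wpDr ?D_gt0//.
  by rewrite mulr_ge0 ?(ltW r0)// sumr_ge0// => j _; rewrite mulr_ge0.
- rewrite in_itv/= sp ps (le_lt_trans (le_trans st t1)) ?ltr1n// => /(_ isT).
  by [].
Qed.

Lemma unitmx_1BM : 1%:M - M \in unitmx.
Proof.
by rewrite unitmxE unitfE -[M]scale1r det_1BtM_neq0// ler01 lexx.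
Qed.

Let v i := (q i).[1] / D.[1].

Let v_gt0 i : 0 < v i.
Proof. by rewrite divr_gt0 ?q_gt0 ?D_gt0 ?ler01 ?lexx. Qed.

Let vE i : v i = 1 + \sum_j M i j * v j.
Proof.
have D1 : D.[1] != 0 by rewrite gt_eqF// D_gt0// ler01 lexx.
rewrite /v hornerq mul1r mulrDl divff//; congr (_ + _).
by rewrite mulr_suml; apply: eq_bigr => j _; rewrite mulrA.
Qed.

(** Minimum principle: at an index k minimizing y_i / v_i, a negative minimum r would give y_k >= r
    (M v)_k = r (v_k - 1) > r v_k = y_k. *)
Lemma solution_ge0 (b y : 'I_K -> R) : (forall i, 0 <= b i) ->
  (forall i, b i + \sum_j M i j * y j <= y i) -> forall i, 0 <= y i.
Proof.
move=> b0 yE i0.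
pose k := [arg min_(i < i0) (y i / v i)]%O.
have kmin i : y k / v k <= y i / v i by rewrite /k; case: arg_minP => // j _; apply.
suff : 0 <= y k / v k.
  move=> yk; have := le_trans yk (kmin i0).
  by rewrite pmulr_lge0 ?invr_gt0.
rewrite leNgt; apply/negP => yk; set r := y k / v k in kmin yk *.
have ry i : r * v i <= y i by rewrite -ler_pdivlMr.
have : y k = r * v k by rewrite /r divfK// gt_eqF.
apply/eqP; rewrite gt_eqF//; apply: lt_le_trans (yE k).
rewrite vE mulrDr mulr1 mulr_sumr.
rewrite ltr_leD//; first exact: lt_le_trans yk (b0 k).
by apply: ler_sum => j _; rewrite mulrCA ler_wpM2l.
Qed.

Definition solve (b : 'I_K -> R) (i : 'I_K) : R := \sum_j invmx (1%:M - M) i j * b j.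

Lemma solveE b i : solve b i = b i + \sum_j M i j * solve b j.
Proof.
pose B : 'cV[R]_K := \col_j b j.
have sE k : (invmx (1%:M - M) *m B) k 0 = solve b k.
  by rewrite mxE; apply: eq_bigr => j _; rewrite mxE.
have /(congr1 (fun A : 'cV_K => A i 0)) := mulKVmx unitmx_1BM B.
rewrite mulmxBl mul1mx [LHS]mxE sE [in LHS]mxE [in LHS]mxE [RHS]mxE => <-.
rewrite -[LHS]addr0 -addrA; congr (_ + _).
apply/esym/eqP; rewrite addrC subr_eq0; apply/eqP.
by apply: eq_bigr => j _; rewrite sE.
Qed.

Lemma solve_ge0 b : (forall i, 0 <= b i) -> forall i, 0 <= solve b i.
Proof.
by move=> b0; apply: solution_ge0 b0 _ => i; rewrite -solveE.
Qed.

Lemma invmx_1BM_ge0 i j : 0 <= invmx (1%:M - M) i j.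
Proof.
have := @solve_ge0 (fun k => (k == j)%:R) (fun _ => ler0n _ _) i.
rewrite /solve (bigD1 j)//= eqxx mulr1 big1 ?addr0// => k /negPf ->.
by rewrite mulr0.
Qed.

(** The hypothesis is a (I - M) <= e_i, and multiplying on the right by (I - M)^-1 preserves it
    because the entries of the inverse are nonnegative. *)
Lemma row_le_invmx (a : 'I_K -> R) i :
  (forall j, a j <= (i == j)%:R + \sum_k a k * M k j) ->
  forall j, a j <= invmx (1%:M - M) i j.
Proof.
move=> aE j; pose A : 'rV[R]_K := \row_k a k.
have -> : a j = (A *m (1%:M - M) *m invmx (1%:M - M)) 0 j.
  by rewrite mulmxK ?unitmx_1BM// mxE.
have -> : invmx (1%:M - M) i j = (delta_mx 0 i *m invmx (1%:M - M)) (0 : 'I_1) j.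
  by rewrite -rowE mxE.
rewrite !mxE; apply: ler_sum => k _; apply: ler_wpM2r; first exact: invmx_1BM_ge0.
rewrite mulmxBr mulmx1 !mxE eqxx/= lerBlDr eq_sym (le_trans (aE k))// lerD2l.
by under [leRHS]eq_bigr do rewrite mxE.
Qed.

Lemma row_eq_invmx (a : 'I_K -> R) i :
  (forall j, a j = (i == j)%:R + \sum_k a k * M k j) ->
  forall j, a j = invmx (1%:M - M) i j.
Proof.
move=> aE j; pose A : 'rV[R]_K := \row_k a k.
have -> : a j = (A *m (1%:M - M) *m invmx (1%:M - M)) 0 j.
  by rewrite mulmxK ?unitmx_1BM// mxE.
have -> : A *m (1%:M - M) = delta_mx 0 i.
  apply/rowP => k; rewrite mulmxBr mulmx1 !mxE eqxx/= eq_sym aE.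
  by under [X in _ - X]eq_bigr do rewrite mxE; rewrite addrK.
by rewrite -rowE mxE.
Qed.

End nonnegative_matrices.

(** * The offspring law *)

Section independence.
Context {d : measure_display} {T : measurableType d} {R : realType}.
Variable P : probability T R.

(** For a fixed D, the finite measures P(A and D) and P(A) P(D) of A agree on the finite
    intersections of events from the G v with v in J, a pi-system that generates the sigma-algebra
    of the past. *)
Lemma past_independent (I : choiceType) (G : I -> set_system T) (J : {fset I})
    (u : I) (A D : set T) :
  mutually_independent P G -> (forall v, sigma_algebra setT (G v)) ->
  (forall v, G v `<=` measurable) -> u \notin J ->
  <<s \bigcup_(v in [set` J]) G v >> A -> G u D ->
  P (A `&` D) = (P A * P D)%E.
Proof.
move=> ind sG mG uJ sA GD.
have GT v : G v setT.
  by have [G0 GC _] := sG v; rewrite -(setD0 setT); exact: GC.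
have GI v : setI_closed (G v).
  rewrite -[G v](sigma_algebra_id (sG v)) => X Y GX GY.
  exact: (@measurableI _ (g_sigma_algebraType (G v))).
pose H := [set A | exists2 E : I -> set T,
  (forall v, v \in J -> G v (E v)) & A = \bigcap_(v in [set` J]) E v].
have mH : H `<=` measurable.
  move=> _ [E GE ->]; apply: fin_bigcap_measurable => [|v]; first exact: finite_fset.
  by move=> /GE /mG.
have mD : measurable D by exact: mG GD.
have HT : H setT by exists (fun=> setT) => //; apply/esym/seteqP; split.
pose m1 : {measure set T -> \bar R} := mrestr P mD.
pose m2 : {measure set T -> \bar R} := mscale (NngNum (fine_ge0 (measure_ge0 P D))) P.
have PDfin : (fine (P D))%:E = P D by rewrite fineK ?fin_num_measure.
have m2E X : m2 X = (P X * P D)%E.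
  by rewrite /m2/= /mscale/= PDfin muleC.
rewrite -m2E; change (m1 A = m2 A).
have sH : <<s \bigcup_(v in [set` J]) G v >> `<=` <<s H >>.
  apply: smallest_sub; first exact: smallest_sigma_algebra.
  move=> X [v /= vJ GX]; apply: sub_sigma_algebra.
  exists (fun x => if x == v then X else setT).
    by move=> x xJ; case: eqP => // ->.
  apply/seteqP; split => [w Xw x /=|w /(_ v vJ)]; last by rewrite eqxx.
  by case: eqP.
have cov : \bigcup_(k : nat) (fun=> setT : set T) k = setT by rewrite bigcup_const.
refine (@g_sigma_algebra_measure_unique _ _ _ H mH (fun=> setT) (fun=> HT) cov m1 m2
  _ _ _ A (sH _ sA)).
- move=> _ _ [E GE ->] [E' GE' ->]; exists (fun v => E v `&` E' v).
    by move=> v vJ; apply: GI; [exact: GE|exact: GE'].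
  by rewrite bigcapI.
- move=> _ [E GE ->]; rewrite m2E /m1 /mrestr/=.
  pose E1 v := if v == u then D else E v.
  have uJv v : v \in J -> v == u = false.
    by move=> vJ; apply: contraNF uJ => /eqP <-.
  have := ind (u |` J)%fset E1.
  have -> : \bigcap_(v in [set` (u |` J)%fset]) E1 v = \bigcap_(v in [set` J]) E v `&` D.
    apply/seteqP; split => [w Ew|w [Ew Dw] v /=].
      split=> [v /= vJ|].
        by have := Ew v; rewrite /= !inE vJ orbT /E1 uJv//; exact.
      by have := Ew u; rewrite /= !inE eqxx /E1 eqxx; exact.
    by rewrite !inE /E1; case: eqP => //= _ /Ew.
  move=> indE; apply: (eq_trans (indE _)).
    by move=> v; rewrite !inE /E1; case: eqP => [-> //|_ /= /GE].
  rewrite big_fsetU1//= {1}/E1 eqxx muleC; congr (_ * _)%E.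
  rewrite (ind J E)//.
  by apply: eq_big_seq => v vJ; rewrite /E1 uJv.
- by move=> _; rewrite /m1 /mrestr/= -ge0_fin_numE// fin_num_measure// setTI.
Qed.

(** The joint law of independent variables is the product of their laws, so this is Tonelli's
    theorem. *)
Lemma integral_independent {d1 d2} {T1 : measurableType d1} {T2 : measurableType d2}
    (Y : {mfun T >-> T1}) (Z : {mfun T >-> T2}) (f : (T1 * T2)%type -> \bar R) :
  (forall A B, measurable A -> measurable B ->
    P (Y @^-1` A `&` Z @^-1` B) = (P (Y @^-1` A) * P (Z @^-1` B))%E) ->
  measurable_fun setT f -> (forall z, 0 <= f z)%E ->
  (\int[P]_w f (Y w, Z w) = \int[P]_w \int[distribution P Z]_z f (Y w, z))%E.
Proof.
move=> ind mf f0.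
have mYZ : measurable_fun setT (fun w => (Y w, Z w)).
  by apply/measurable_fun_pairP; split; exact: measurable_funP.
pose YZ : {mfun T >-> (T1 * T2)%type} := HB.pack (fun w => (Y w, Z w))
  (isMeasurableFun.Build _ _ _ _ _ mYZ).
transitivity (\int[distribution P YZ]_z f z)%E.
  by rewrite ge0_integral_distribution.
transitivity (\int[distribution P Y \x distribution P Z]_z f z)%E.
  apply/esym; apply: eq_measure_integral => A mA _.
  by apply: product_measure_unique => // B C mB mC; exact: ind.
rewrite fubini_tonelli1//= ge0_integral_distribution//.
  exact: measurable_fun_fubini_tonelli_F.
by move=> y; apply: integral_ge0 => z _; exact: f0.
Qed.

End independence.

Section density.
Context {d : measure_display} {T : measurableType d} {R : realType}.
Variables (nu mu : {measure set T -> \bar R}) (g : T -> R).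
Hypotheses (mg : measurable_fun setT g) (g0 : forall x, 0 <= g x).
Hypothesis nuE : forall A, measurable A -> nu A = (\int[mu]_(x in A) (g x)%:E)%E.

Import HBNNSimple.
Local Open Scope ereal_scope.

(** Extension from indicators to simple functions, then monotone convergence. It serves with P
    restricted to an event, and with the joint law of a lifetime and an offspring vector. *)
Lemma integral_density (f : T -> \bar R) : measurable_fun setT f ->
  (forall x, 0 <= f x) -> \int[nu]_x f x = \int[mu]_x (f x * (g x)%:E).
Proof.
move=> mf f0; pose h := nnsfun_approx (@measurableT _ T) mf.
have hf x : EFin \o (h ^~ x) @ \oo --> f x by exact: cvg_nnsfun_approx.
transitivity (limn (fun n => \int[nu]_x (h n x)%:E)).
  under eq_integral => x _ do rewrite -(cvg_lim _ (hf x))//.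
  apply: monotone_convergence => //.
  - by move=> n; apply/measurable_EFinP; exact/measurable_funP.
  - by move=> n x _; rewrite lee_fin.
  - by move=> x _ a b ab; rewrite lee_fin; exact/lefP/nd_nnsfun_approx.
transitivity (limn (fun n => \int[mu]_x ((h n x)%:E * (g x)%:E))); last first.
  rewrite -monotone_convergence//.
  - apply: eq_integral => x _; apply/cvg_lim => //.
    by apply: cvgeZr => //; exact: hf.
  - by move=> n; apply: emeasurable_funM; apply/measurable_EFinP => //; exact/measurable_funP.
  - by move=> n x _ /=; rewrite mule_ge0 ?lee_fin.
  - by move=> x _ a b ab/=; rewrite lee_wpmul2r ?lee_fin//; exact/lefP/nd_nnsfun_approx.
congr (limn _); apply/funext => n.
have indich r : measurable_fun setT (fun x => (r * \1_(h n @^-1` [set r]) x)%:E).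
  by apply/measurable_EFinP; exact: measurable_funM.
transitivity (\int[nu]_x (\sum_(y \in range (h n)) (y * \1_(h n @^-1` [set y]) x)%:E)).
  by apply: eq_integral => t tE; rewrite /= fimfunE -fsumEFin.
rewrite ge0_integral_fsum//; last by move=> m y Ey; exact: nnfun_muleindic_ge0.
transitivity (\int[mu]_x (\sum_(y \in range (h n))
    (y * \1_(h n @^-1` [set y]) x)%:E * (g x)%:E)); last first.
  apply: eq_integral => x _.
  rewrite -ge0_mule_fsuml => [|y]; last exact: nnfun_muleindic_ge0.
  by rewrite fsumEFin // -(fimfunE _ x).
rewrite ge0_integral_fsum//; last 2 first.
  - by move=> y; apply: emeasurable_funM => //; exact/measurable_EFinP.
  - by move=> m y Ey; apply: mule_ge0; [exact: nnfun_muleindic_ge0|rewrite lee_fin].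
apply: eq_fsbigr => r rhn.
under [LHS]eq_integral do rewrite EFinM.
rewrite integralZl_indic_nnsfun// integral_indic// setIT nuE//.
under [RHS]eq_integral do rewrite EFinM -muleA.
have r0 : (0 <= r)%R by move: rhn; rewrite inE => -[x _ <-].
rewrite ge0_integralZl//.
- congr (_ * _); rewrite integral_mkcond; apply: eq_integral => x _.
  rewrite patchE indicE; case: ifP => _; first by rewrite mul1e.
  by rewrite mul0e.
- by apply: emeasurable_funM; apply/measurable_EFinP.
- by move=> x _; rewrite mule_ge0 ?lee_fin.
Qed.

End density.

(** * Sums over the Poisson law *)

Lemma measurable_poisson_mass (R : realType) (l : R) (n : nat) :
  measurable_fun setT (fun s => poisson_mass (l * s) n).
Proof.
apply: measurable_funM => //; apply: measurable_funM.
  by apply: measurableT_comp => //; apply: measurableT_comp => //; exact: measurable_funM.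
by apply: measurable_funX; exact: measurable_funM.
Qed.

Lemma poisson_mass_ge0 (R : realType) (r : R) (n : nat) : 0 <= r -> 0 <= poisson_mass r n.
Proof. by move=> r0; rewrite !mulr_ge0 ?expR_ge0 ?exprn_ge0. Qed.

Lemma cvgn_prod (R : realType) (I : Type) (r : seq I) (a : I -> nat -> R) (b : I -> R) :
  (forall j, a j @ \oo --> b j) ->
  (fun m => \prod_(j <- r) a j m) @ \oo --> \prod_(j <- r) b j.
Proof.
move=> ab; elim: r => [|j r IH].
  by rewrite big_nil; under eq_cvg do rewrite big_nil; exact: cvg_cst.
by rewrite big_cons; under eq_cvg do rewrite big_cons; exact: cvgM.
Qed.

Lemma series_poisson_mass (R : realType) (r b : R) :
  (fun m => \sum_(n < m) poisson_mass r n * expR (b * n%:R)) @ \oo -->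
  expR (r * (expR b - 1)).
Proof.
have -> : expR (r * (expR b - 1)) = expR (- r) * expR (r * expR b).
  by rewrite -expRD mulrBr mulr1 addrC.
rewrite (_ : (fun m => _) = (fun m => expR (- r) * series (exp_coeff (r * expR b)) m)).
  by apply: cvgMr; exact: is_cvg_series_exp_coeff.
apply/funext => m; rewrite /series/= big_mkord mulr_sumr; apply: eq_bigr => n _.
rewrite /poisson_mass /exp_coeff/= expRM_natr exprMn.
by rewrite -!mulrA; congr (_ * (_ * _)); rewrite mulrC.
Qed.

Lemma total_poisson_mass (R : realType) (r : R) :
  (fun m => \sum_(n < m) poisson_mass r n * expR (0 * n%:R)) @ \oo --> (1 : R).
Proof.
have := @series_poisson_mass _ r 0.
have -> : r * (expR 0 - 1) = 0 by rewrite expR0 subrr mulr0.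
by rewrite expR0.
Qed.

(** For the mass p_n at n, n p_n = r p_(n-1), so that a shift of the index reduces the mean to the
    total mass. *)
Lemma mean_poisson_mass (R : realType) (r : R) :
  (fun m => \sum_(n < m) poisson_mass r n * n%:R) @ \oo --> r.
Proof.
have := cvgMr (a := r) (total_poisson_mass r); rewrite mulr1 => H2.
suff E : (fun m => \sum_(n < m.+1) poisson_mass r n * n%:R) =
    (fun m => r * \sum_(n < m) poisson_mass r n * expR (0 * n%:R)).
  by rewrite -cvg_shiftS/= E; exact: H2.
apply/funext => m; rewrite big_ord_recl/= mulr0 add0r mulr_sumr.
apply: eq_bigr => n _; rewrite mul0r expR0 mulr1 /poisson_mass factS natrM invfM exprS.
have n1 : n.+1%:R != 0 :> R by rewrite pnatr_eq0.
rewrite /bump/= add1n; field.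
by rewrite nat1r n1 pnatr_eq0 -lt0n fact_gt0.
Qed.

Section offspring_law.
Context {K : nat} {d : measure_display} {T : measurableType d} {R : realType}.
Context {P : probability T R} {F : 'I_K -> probability R R}.
Context {lambda : 'I_K -> 'I_K -> R} {i : 'I_K}.
Hypothesis lambda_ge0 : forall k j, 0 <= lambda k j.
Variable X : branching_process P F lambda i.
Implicit Types (u : @label K) (n : 'I_K -> nat).

(** The conditional probability of the offspring vector n given the lifetime s. The value 0 for s <
    0, which no lifetime takes, makes it nonnegative on the whole line. *)
Definition offspring_density u n (s : R) : R :=
  if 0 <= s then \prod_j poisson_mass (lambda (label_type i u) j * s) (n j) else 0.

Lemma offspring_density_ge0 u n s : 0 <= offspring_density u n s.
Proof.
rewrite /offspring_density; case: ifPn => // s0.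
by apply: prodr_ge0 => j _; rewrite poisson_mass_ge0// mulr_ge0.
Qed.

Lemma measurable_offspring_density u n : measurable_fun setT (offspring_density u n).
Proof.
apply: measurable_fun_ifT => //; last first.
  by apply: measurable_prod => j _; exact: measurable_poisson_mass.
by apply: (measurable_fun_ler (f := cst 0) (g := id)).
Qed.

Lemma measurable_lifetime u : measurable_fun setT (lifetime X u).
Proof. exact: measurable_funP. Qed.

Lemma measurable_children u j : measurable_fun setT (children X u j).
Proof. exact: measurable_funP. Qed.

Lemma measurable_offspring_eq u n :
  measurable [set w | forall j, children X u j w = n j].
Proof.
have -> : [set w | forall j, children X u j w = n j] =
    \bigcap_(j in [set: 'I_K]) (children X u j @^-1` [set n j]).
  by apply/seteqP; split => w H j; [move=> _|]; exact: H.
apply: fin_bigcap_measurable => // j _; rewrite -[X in measurable X]setTI.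
exact: measurable_children.
Qed.

(** By [children_law] the measure of A given by P(lifetime in A, offspring = n) has density
    [offspring_density] against the lifetime law; q is integrated against it in two ways. *)
Lemma integral_offspring_eq u n (q : R -> \bar R) :
  measurable_fun setT q -> (forall x, 0 <= q x)%E ->
  (\int[P]_(w in [set w | forall j, children X u j w = n j]) q (lifetime X u w) =
   \int[P]_w (q (lifetime X u w) * (offspring_density u n (lifetime X u w))%:E))%E.
Proof.
move=> mq q0; set E := [set w | _]; have mE : measurable E by exact: measurable_offspring_eq.
pose nu0 : {measure set T -> \bar R} := mrestr P mE.
pose nu_ : {measure set R -> \bar R} := pushforward nu0 (lifetime X u).
pose nu := nu_ (measurable_lifetime u).
have nuE A : measurable A ->
    nu A = (\int[F (label_type i u)]_(s in A) (offspring_density u n s)%:E)%E.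
  move=> mA; pose A0 := A `&` `[0, +oo[%classic.
  have mA0 : measurable A0 by apply: measurableI => //; exact: measurable_itv.
  transitivity (P (lifetime X u @^-1` A0 `&` E)).
    rewrite /nu/nu_/= /pushforward /nu0/= /mrestr; congr (P _); apply/seteqP; split.
      move=> w [/= Aw Ew]; split => //; split => //=.
      by rewrite in_itv/= lifetime_ge0.
    by move=> w [[Aw _] Ew].
  rewrite (children_law X u n mA0) integral_mkcondr; apply: eq_integral => s _.
  rewrite patchE /offspring_density; have -> : (s \in `[0, +oo[%classic) = (0 <= s).
    by rewrite mem_setE in_itv/= andbT.
  by case: ifP.
transitivity (\int[nu]_s q s)%E.
  rewrite ge0_integral_pushforward//.
  rewrite preimage_setT [LHS]integral_mkcond.
  have nu0E A : measurable A -> nu0 A = (\int[P]_(x in A) (\1_E x)%:E)%E.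
    by move=> mA; rewrite integral_indic// setIC.
  have mqS : measurable_fun setT (q \o lifetime X u) by exact: measurableT_comp.
  have mI : measurable_fun setT (\1_E : T -> R) by exact: measurable_indic.
  rewrite (integral_density mI _ nu0E mqS)//; last by move=> w; exact: q0.
  apply: eq_integral => w _; rewrite patchE indicE; case: ifP => _.
    by rewrite mule1.
  by rewrite mule0.
apply: (eq_trans (integral_density (measurable_offspring_density u n)
  (offspring_density_ge0 u n) nuE mq q0)).
transitivity (\int[distribution P (lifetime X u)]_s
   (q s * (offspring_density u n s)%:E))%E.
  by apply: eq_measure_integral => A mA _; apply/esym; exact: (lifetime_law X u mA).
rewrite ge0_integral_distribution//.
  apply: emeasurable_funM => //; apply/measurable_EFinP.
  exact: measurable_offspring_density.
by move=> s; rewrite mule_ge0 ?lee_fin ?offspring_density_ge0.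
Qed.

(** With all offspring numbers below m only finitely many offspring vectors p are possible, and
    [integral_offspring_eq] applies to each. The truncation is removed later by letting m grow. *)
Lemma integral_truncated_offspring u (m : nat) (Q : R -> ('I_K -> nat) -> \bar R) :
  (forall n, measurable_fun setT (Q ^~ n)) -> (forall s n, 0 <= Q s n)%E ->
  (\int[P]_w (Q (lifetime X u w) (fun j => children X u j w) *
     (\prod_j (children X u j w < m)%:R)%:E) =
   \sum_(p : {ffun 'I_K -> 'I_m}) \int[P]_w (Q (lifetime X u w) (fun j => p j) *
     (offspring_density u (fun j => p j) (lifetime X u w))%:E))%E.
Proof.
move=> mQ Q0.
pose E (p : {ffun 'I_K -> 'I_m}) := [set w | forall j, children X u j w = p j].
have mE p : measurable (E p) by exact: measurable_offspring_eq.
have truncE w : \prod_j (children X u j w < m)%:R =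
    \sum_(p : {ffun 'I_K -> 'I_m}) \prod_j (children X u j w == p j)%:R :> R.
  rewrite -(bigA_distr_bigA (fun j (x : 'I_m) => (children X u j w == x)%:R)).
  apply: eq_bigr => j _; case: ltnP => Nm.
    rewrite (bigD1 (Ordinal Nm))//= eqxx big1 ?addr0// => x xN.
    suff /negPf -> : children X u j w != x by [].
    by apply: contraNneq xN => Nx; apply/eqP/val_inj.
  by rewrite big1// => x _; rewrite gtn_eqF// (leq_trans _ Nm).
transitivity (\int[P]_w \sum_(p : {ffun 'I_K -> 'I_m})
    (Q (lifetime X u w) (fun j => p j) * (\1_(E p) w)%:E))%E.
  apply: eq_integral => w _; rewrite truncE -sumEFin ge0_sume_distrr; last first.
    by move=> p _; rewrite lee_fin prodr_ge0.
  apply: eq_bigr => p _; rewrite indicE.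
  have [/set_mem Ew|nEw] := boolP (w \in E p).
    rewrite big1 => [|j _]; last by rewrite Ew eqxx.
    by congr (Q _ _ * _)%E; apply/funext => j; rewrite Ew.
  have [j /negPf jw] : exists j, children X u j w != p j.
    apply/existsP; rewrite -negb_forall; apply: contraNN nEw => /forallP Ew.
    by apply/mem_set => j; exact/eqP.
  by rewrite (bigD1 j)//= jw mul0r !mule0.
rewrite ge0_integral_sum//; last 2 first.
- move=> p; apply: emeasurable_funM; last exact/measurable_EFinP.
  by apply: (measurableT_comp (mQ _)); exact: measurable_lifetime.
- by move=> p w _; rewrite mule_ge0// lee_fin.
apply: eq_bigr => p _.
transitivity (\int[P]_(w in E p) Q (lifetime X u w) (fun j => p j))%E.
  rewrite [RHS]integral_mkcond; apply: eq_integral => w _.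
  by rewrite patchE indicE; case: ifP => _; rewrite ?mule1 ?mule0.
by rewrite (integral_offspring_eq u (fun j => p j) (mQ _)).
Qed.

(** Given the lifetime s, the offspring numbers of the various types are independent, so the
    conditional mean of the product is the product of the means h_j(s). For truncated numbers this
    is the expansion of a product of finite sums; both sides then converge monotonically. *)
Lemma integral_prod_offspring u (f : R -> R) (g : 'I_K -> nat -> R) (h : 'I_K -> R -> R) :
  measurable_fun setT f -> (forall s, 0 <= f s) -> (forall j (n : nat), 0 <= g j n) ->
  (forall j s, 0 <= s ->
    (fun m => \sum_(n < m) poisson_mass (lambda (label_type i u) j * s) n * g j n)
      @ \oo --> h j s) ->
  (\int[P]_w (f (lifetime X u w) * \prod_j g j (children X u j w))%:E =
   \int[P]_w (f (lifetime X u w) * \prod_j h j (lifetime X u w))%:E)%E.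
Proof.
move=> mf f0 g0 hcvg.
pose gm m w := \prod_j (g j (children X u j w) * (children X u j w < m)%:R).
pose hm m w := \prod_j \sum_(n < m)
  poisson_mass (lambda (label_type i u) j * lifetime X u w) n * g j n.
have gm0 m w : 0 <= gm m w by apply: prodr_ge0 => j _; rewrite mulr_ge0.
have pm0 j (n : nat) w : 0 <= poisson_mass (lambda (label_type i u) j * lifetime X u w) n * g j n.
  by rewrite mulr_ge0// poisson_mass_ge0// mulr_ge0// lifetime_ge0.
have hm0 m w : 0 <= hm m w.
  by apply: prodr_ge0 => j _; apply: sumr_ge0 => n _; exact: pm0.
have mfS : measurable_fun setT (fun w => f (lifetime X u w)) by exact: measurableT_comp.
have mgm m : measurable_fun setT (gm m).
  apply: measurable_prod => j _.
  rewrite (_ : (fun w => _) = (fun n : nat => g j n * (n < m)%:R) \o children X u j)//.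
  exact: measurableT_comp.
have mhm m : measurable_fun setT (hm m).
  apply: measurable_prod => j _; apply: measurable_sum => n; apply: measurable_funM => //.
  exact: (measurableT_comp (measurable_poisson_mass (lambda (label_type i u) j) n)).
have gh m : (\int[P]_w (f (lifetime X u w) * gm m w)%:E =
             \int[P]_w (f (lifetime X u w) * hm m w)%:E)%E.
  pose Q s (n : 'I_K -> nat) := (f s * \prod_j g j (n j))%:E.
  have mQ n : measurable_fun setT (Q ^~ n).
    by apply/measurable_EFinP; exact: measurable_funM.
  have Q0 s n : (0 <= Q s n)%E by rewrite lee_fin mulr_ge0// prodr_ge0.
  transitivity (\int[P]_w (Q (lifetime X u w) (fun j => children X u j w) *
      (\prod_j (children X u j w < m)%:R)%:E))%E.
    by apply: eq_integral => w _; rewrite -EFinM -mulrA -big_split.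
  rewrite (integral_truncated_offspring u m mQ Q0) /Q.
  under eq_bigr do under eq_integral do rewrite -EFinM.
  rewrite -ge0_integral_sum//; last 2 first.
  - move=> p; apply/measurable_EFinP; apply: measurable_funM; first exact: measurable_funM.
    exact: (measurableT_comp (measurable_offspring_density _ _)).
  - by move=> p w _; rewrite lee_fin !mulr_ge0 ?offspring_density_ge0// prodr_ge0.
  apply: eq_integral => w _; rewrite sumEFin; congr EFin.
  rewrite /hm bigA_distr_bigA mulr_sumr/=; apply: eq_bigr => p _.
  rewrite -mulrA /offspring_density lifetime_ge0 -big_split/=; congr (_ * _).
  by apply: eq_bigr => j _; rewrite mulrC.
have gcvg : (\int[P]_w (f (lifetime X u w) * gm m w)%:E @[m --> \oo] -->
    \int[P]_w (f (lifetime X u w) * \prod_j g j (children X u j w))%:E)%E.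
  rewrite (_ : (fun w => (f (lifetime X u w) * \prod_j g j (children X u j w))%:E) =
    (fun w => limn (fun m => (f (lifetime X u w) * gm m w)%:E))).
    apply: cvg_monotone_convergence => //.
    - by move=> m; apply/measurable_EFinP; exact: measurable_funM.
    - by move=> m w _; rewrite lee_fin mulr_ge0.
    - move=> w _ m n mn; rewrite lee_fin ler_wpM2l//; apply: ler_prod => j _.
      rewrite mulr_ge0//= ler_wpM2l// ler_nat; case: ltnP => // Nm.
      by rewrite (leq_trans Nm).
  apply/funext => w; apply/esym/cvg_lim => //; apply: cvg_near_cst.
  exists (\max_j (children X u j w)).+1 => // m /= Nm.
  congr (_ * _)%:E; apply: eq_bigr => j _.
  by rewrite (leq_trans _ Nm) ?mulr1// ltnS (leq_bigmax j).
have hcvg' : (\int[P]_w (f (lifetime X u w) * hm m w)%:E @[m --> \oo] -->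
    \int[P]_w (f (lifetime X u w) * \prod_j h j (lifetime X u w))%:E)%E.
  rewrite (_ : (fun w => (f (lifetime X u w) * \prod_j h j (lifetime X u w))%:E) =
    (fun w => limn (fun m => (f (lifetime X u w) * hm m w)%:E))).
    apply: cvg_monotone_convergence => //.
    - by move=> m; apply/measurable_EFinP; exact: measurable_funM.
    - by move=> m w _; rewrite lee_fin mulr_ge0.
    - move=> w _ m n mn; rewrite lee_fin ler_wpM2l//; apply: ler_prod => j _.
      apply/andP; split; first by apply: sumr_ge0 => a _; exact: pm0.
      rewrite (big_ord_widen n (fun a => poisson_mass (lambda (label_type i u) j *
        lifetime X u w) a * g j a) mn) [leRHS](bigID (fun a : 'I_n => (a < m)%N))/=.
      by rewrite lerDl sumr_ge0// => a _; exact: pm0.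
  apply/funext => w; apply/esym/cvg_lim => //; apply: cvg_EFin; first exact: nearW.
  apply: cvgMr; apply: cvgn_prod => j; apply: hcvg; exact: lifetime_ge0.
have ghE : (fun m => \int[P]_w (f (lifetime X u w) * gm m w)%:E)%E =
    (fun m => \int[P]_w (f (lifetime X u w) * hm m w)%:E)%E by apply/funext.
by rewrite ghE in gcvg; apply: (cvg_unique _ gcvg hcvg'); exact: ereal_hausdorff.
Qed.

Lemma laplace_offspring u (f : R -> R) (b : 'I_K -> R) :
  measurable_fun setT f -> (forall s, 0 <= f s) ->
  (\int[P]_w (f (lifetime X u w) * expR (\sum_j b j * (children X u j w)%:R))%:E =
   \int[P]_w (f (lifetime X u w) *
     expR (lifetime X u w * \sum_j lambda (label_type i u) j * (expR (b j) - 1)))%:E)%E.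
Proof.
move=> mf f0; under eq_integral do rewrite expR_sum.
under [RHS]eq_integral do rewrite mulr_sumr expR_sum.
apply: (@integral_prod_offspring u f (fun j (n : nat) => expR (b j * n%:R))
  (fun j s => expR (s * (lambda (label_type i u) j * (expR (b j) - 1))))) => //.
move=> j s s0; rewrite mulrA [s * _]mulrC; exact: series_poisson_mass.
Qed.

Lemma mean_children u j : (\int[P]_w (children X u j w)%:R%:E =
   \int[P]_w (lambda (label_type i u) j * lifetime X u w)%:E)%E.
Proof.
pose g k (n : nat) : R := if k == j then n%:R else expR (0 * n%:R).
pose h k s := if k == j then lambda (label_type i u) j * s else 1.
have prod1 (c : 'I_K -> R) : (forall k, k != j -> c k = 1) -> \prod_k c k = c j.
  by move=> ck; rewrite (bigD1 j)//= big1 ?mulr1.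
transitivity (\int[P]_w (cst 1 (lifetime X u w) * \prod_k g k (children X u k w))%:E)%E.
  apply: eq_integral => w _; rewrite mul1r prod1 /g ?eqxx// => k /negPf ->.
  by rewrite mul0r expR0.
rewrite (@integral_prod_offspring u (cst 1) g h)//.
- apply: eq_integral => w _; rewrite mul1r prod1 /h ?eqxx// => k /negPf ->//.
- by move=> k n; rewrite /g; case: ifP => // _; exact: expR_ge0.
move=> k s s0; rewrite /g /h; case: eqP => [->|_]; first exact: mean_poisson_mass.
exact: total_poisson_mass.
Qed.

End offspring_law.
Arguments offspring_density {K R} lambda i u n s.

(** * The data of one individual and its jump *)

Section data.
Context {K : nat} {d : measure_display} {T : measurableType d} {R : realType}.
Context {P : probability T R} {F : 'I_K -> probability R R}.
Context {lambda : 'I_K -> 'I_K -> R} {i : 'I_K}.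
Hypothesis lambda_ge0 : forall k j, 0 <= lambda k j.
Variable X : branching_process P F lambda i.
Implicit Types (u v : @label K).

Definition data_gen u : set_system T :=
  g_sigma_algebra_preimage (lifetime X u) `|`
  \bigcup_j g_sigma_algebra_preimage (children X u j).

Definition data u : set_system T := <<s data_gen u >>.

Lemma data_measurable u : data u `<=` measurable.
Proof.
apply: smallest_sub; first exact: sigma_algebra_measurable.
move=> A [[B mB <-]|[j _ [B mB <-]]]; first exact: measurable_lifetime.
exact: measurable_children.
Qed.

Lemma lifetime_data u :
  measurable_fun (setT : set (g_sigma_algebraType (data_gen u))) (lifetime X u).
Proof. by move=> _ B mB; apply: sub_sigma_algebra; left; exists B. Qed.

Lemma children_data u j :
  measurable_fun (setT : set (g_sigma_algebraType (data_gen u))) (children X u j).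
Proof. by move=> _ B mB; apply: sub_sigma_algebra; right; exists j => //; exists B. Qed.

Definition jump (a : R) (b : 'I_K -> R) u (w : T) : R :=
  a * lifetime X u w + \sum_j b j * (children X u j w)%:R.

Lemma jump_data a b u :
  measurable_fun (setT : set (g_sigma_algebraType (data_gen u))) (jump a b u).
Proof.
apply: measurable_funD; first by apply: measurable_funM => //; exact: lifetime_data.
apply: measurable_sum => j; apply: measurable_funM => //.
have mN : measurable_fun setT (fun n : nat => n%:R : R) by [].
exact: (measurableT_comp mN (@children_data u j)).
Qed.

Lemma measurable_jump a b u : measurable_fun setT (jump a b u).
Proof.
move=> mT B mB; rewrite setTI; apply: (data_measurable (u := u)).
by have := @jump_data a b u measurableT B mB; rewrite setTI.
Qed.

Lemma jump_ge0 a b u w : 0 <= a -> (forall j, 0 <= b j) -> 0 <= jump a b u w.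
Proof.
move=> a0 b0; rewrite addr_ge0 ?mulr_ge0 ?lifetime_ge0// sumr_ge0// => j _.
by rewrite mulr_ge0.
Qed.

Lemma integral_lifetime u (q : R -> \bar R) : measurable_fun setT q ->
  (forall x, 0 <= q x)%E ->
  (\int[P]_w q (lifetime X u w) = \int[F (label_type i u)]_s q s)%E.
Proof.
move=> mq q0; rewrite -(ge0_integral_distribution (lifetime X u))//.
by apply: eq_measure_integral => A mA _; exact: lifetime_law.
Qed.

(** The joint law of lifetime and offspring numbers depends on the label only through its type.
    One-step estimates can thus be made on the fixed label [:: (k, 0)] of each type k, with finitely
    many sets of constants. *)
Lemma integral_jump a b u v (q : R -> \bar R) :
  measurable_fun setT q -> (forall x, 0 <= q x)%E -> label_type i u = label_type i v ->
  (\int[P]_w q (jump a b u w) = \int[P]_w q (jump a b v w))%E.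
Proof.
move=> mq q0 uv.
pose I m u w : R := (\prod_j (children X u j w < m)%:R).
have I0 m u' w : 0 <= I m u' w by apply: prodr_ge0.
have mI m u' : measurable_fun setT (I m u').
  apply: measurable_prod => j _.
  have mN : measurable_fun setT (fun n : nat => (n < m)%:R : R) by [].
  exact: (measurableT_comp mN (@measurable_children _ _ _ _ _ _ _ _ X u' j)).
have mqj u' : measurable_fun setT (fun w => q (jump a b u' w)).
  by apply: measurableT_comp => //; exact: measurable_jump.
have trunc m u' : (\int[P]_w (q (jump a b u' w) * (I m u' w)%:E) =
    \sum_(p : {ffun 'I_K -> 'I_m}) \int[F (label_type i u')]_s
     (q (a * s + \sum_j b j * (p j)%:R)%R *
      (offspring_density lambda i u' (fun j => p j) s)%:E))%E.
  pose Q s (n : 'I_K -> nat) := q (a * s + \sum_j b j * (n j)%:R).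
  have mQ n : measurable_fun setT (Q ^~ n).
    by apply: measurableT_comp => //; apply: measurable_funD => //; exact: measurable_funM.
  rewrite [LHS](integral_truncated_offspring lambda_ge0 X u' m mQ (fun s n => q0 _)).
  apply: eq_bigr => p _.
  pose r s := (Q s (fun j => p j) * (offspring_density lambda i u' (fun j => p j) s)%:E)%E.
  rewrite (@integral_lifetime u' r)//.
    apply: emeasurable_funM => //; apply/measurable_EFinP.
    exact: measurable_offspring_density.
  by move=> s; rewrite mule_ge0// ?lee_fin ?offspring_density_ge0//; exact: q0.
have lim u' : (\int[P]_w (q (jump a b u' w) * (I m u' w)%:E) @[m --> \oo] -->
    \int[P]_w q (jump a b u' w))%E.
  rewrite (_ : (fun w => q (jump a b u' w)) =
      (fun w => limn (fun m => q (jump a b u' w) * (I m u' w)%:E)))%E.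
    apply: cvg_monotone_convergence => //.
    - by move=> m; apply: emeasurable_funM => //; exact/measurable_EFinP.
    - by move=> m w _; rewrite mule_ge0// lee_fin.
    - move=> w _ m n mn; rewrite lee_wpmul2l// lee_fin; apply: ler_prod => j _.
      by rewrite ler0n/= ler_nat; case: ltnP => // Nm; rewrite (leq_trans Nm).
  apply/funext => w; apply/esym/cvg_lim => //; apply: cvg_near_cst.
  exists (\max_j (children X u' j w)).+1 => // m /= Nm.
  by rewrite /I big1 ?mule1// => j _; rewrite (leq_trans _ Nm)// ltnS (leq_bigmax j).
have uvE : (fun m => \int[P]_w (q (jump a b u w) * (I m u w)%:E))%E =
    (fun m => \int[P]_w (q (jump a b v w) * (I m v w)%:E))%E.
  by apply/funext => m; rewrite !trunc /offspring_density uv.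
have := lim u; rewrite uvE => limu.
by apply: (cvg_unique _ limu (lim v)); exact: ereal_hausdorff.
Qed.

End data.

(** * Exploration of the family tree *)

Lemma sum_uniq_subset (R : numDomainType) (I : eqType) (f : I -> R) (s1 s2 : seq I) :
  (forall x, 0 <= f x) -> uniq s1 -> {subset s1 <= s2} ->
  \sum_(x <- s1) f x <= \sum_(x <- s2) f x.
Proof.
move=> f0; elim: s1 s2 => [|x s1 IH] s2 /=; first by rewrite big_nil sumr_ge0.
move=> /andP[xs1 us1] sub.
have xs2 : x \in s2 by rewrite sub// mem_head.
rewrite (perm_big _ (perm_to_rem xs2)) !big_cons lerD2l IH// => y ys1.
have : y \in s2 by rewrite sub// inE ys1 orbT.
rewrite (perm_mem (perm_to_rem xs2)) inE; case: eqP => // yx.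
by rewrite -yx ys1 in xs1.
Qed.

Section exploration.
Context {K : nat} {d : measure_display} {T : measurableType d} {R : realType}.
Context {P : probability T R} {F : 'I_K -> probability R R}.
Context {lambda : 'I_K -> 'I_K -> R} {i : 'I_K}.
Hypothesis lambda_ge0 : forall k j, 0 <= lambda k j.
Variable X : branching_process P F lambda i.
Notation lab := (seq ('I_K * nat)).
Implicit Types (u v : lab).

(** The code of a sequence with head c and rest u is 2^c (2 code(u) + 1), which exceeds code(u). *)
Lemma pickle_parent (c : 'I_K * nat) u : (choice.pickle u < choice.pickle (c :: u : lab))%N.
Proof.
change (CodeSeq.code (map choice.pickle u) < CodeSeq.code (choice.pickle c :: map choice.pickle u))%N.
rewrite /=; set m := CodeSeq.code _.
by rewrite (@leq_trans m.*2.+1)// ?ltnS -?addnn ?leq_addr// leq_pmull// expn_gt0.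
Qed.

(** Not every integer is the code of a label; [pmap] skips the others, so that a stage of the
    exploration may be void. *)
Definition explored (n : nat) : seq (lab) := pmap pickle_inv (iota 0 n).

Lemma mem_explored n u : (u \in explored n) = (choice.pickle u < n)%N.
Proof.
rewrite mem_pmap; apply/mapP/idP => [[m]|un]; last first.
  by exists (choice.pickle u); rewrite ?mem_iota// pickleK_inv.
rewrite mem_iota add0n => mn um; have := @pickle_invK lab m.
by move: um; case: (pickle_inv m) => [v|//] [->] /= ->.
Qed.

Lemma explored_uniq n : uniq (explored n).
Proof. by apply: (pmap_uniq (@pickle_invK _)); exact: iota_uniq. Qed.

Lemma exploredS n :
  explored n.+1 = explored n ++ (if pickle_inv n is Some u then [:: u] else [::]).
Proof.
by rewrite /explored -addn1 iotaD pmap_cat/= add0n; case: (pickle_inv n).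
Qed.

Lemma pickle_inv_pickle n u : pickle_inv n = Some u -> choice.pickle u = n.
Proof. by move=> nu; have := @pickle_invK lab n; rewrite nu. Qed.

Definition past_gen (n : nat) : set_system T :=
  \bigcup_(v in [set` explored n]) data X v.

Notation past n := (g_sigma_algebraType (past_gen n)).

Lemma past_measurable n : <<s past_gen n >> `<=` measurable.
Proof.
apply: smallest_sub; first exact: sigma_algebra_measurable.
by move=> A [v _]; exact: data_measurable.
Qed.

Lemma measurable_past {d'} {U : measurableType d'} n (f : T -> U) :
  measurable_fun (setT : set (past n)) f -> measurable_fun setT f.
Proof.
move=> mf _ B mB; rewrite setTI; apply: (past_measurable (n := n)).
by have := mf measurableT B mB; rewrite setTI; exact.
Qed.

Lemma measurable_data {d'} {U : measurableType d'} u (f : T -> U) :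
  measurable_fun (setT : set (g_sigma_algebraType (data_gen X u))) f ->
  measurable_fun setT f.
Proof.
move=> mf _ B mB; rewrite setTI; apply: (data_measurable (u := u)).
by have := mf measurableT B mB; rewrite setTI; exact.
Qed.

Lemma data_past {d'} {U : measurableType d'} n v (f : T -> U) : (choice.pickle v < n)%N ->
  measurable_fun (setT : set (g_sigma_algebraType (data_gen X v))) f ->
  measurable_fun (setT : set (past n)) f.
Proof.
move=> vn mf _ B mB; apply: sub_sigma_algebra; exists v; first by rewrite /= mem_explored.
exact: (mf measurableT B mB).
Qed.

Lemma past_mono {d'} {U : measurableType d'} m n (f : T -> U) : (m <= n)%N ->
  measurable_fun (setT : set (past m)) f -> measurable_fun (setT : set (past n)) f.
Proof.
move=> mn mf _ B mB; have sub : past_gen m `<=` past_gen n.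
  move=> A [v /= vm dA]; exists v => //=.
  by move: vm; rewrite !mem_explored => vm; exact: leq_trans mn.
by apply: (sub_sigma_algebra2 sub); exact: (mf measurableT B mB).
Qed.

Lemma past_data_independent n u (A D : set T) : (n <= choice.pickle u)%N ->
  <<s past_gen n >> A -> data X u D -> P (A `&` D) = (P A * P D)%E.
Proof.
move=> nu pA dD; apply: (@past_independent _ _ _ P _ (data X)
  [fset v in explored n]%fset u) => //.
- exact: (@individuals_independent _ _ _ _ _ _ _ _ X).
- by move=> v; exact: smallest_sigma_algebra.
- by move=> v; exact: data_measurable.
- by rewrite in_fset/= mem_explored -leqNgt.
- suff sub : past_gen n `<=` \bigcup_(v in [set` [fset v in explored n]%fset]) data X v.
    exact: (sub_sigma_algebra2 sub).
  by move=> B [v /= vn dB]; exists v => //=; rewrite in_fset.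
Qed.

(** Conditioning on the past: a and Y are frozen while the independent xi is averaged. In the
    application a indicates that u is born and Y is the walk before u, up to a constant. *)
Lemma integral_step n u (a Y xi : T -> R) (phi : R -> R) : (n <= choice.pickle u)%N ->
  measurable_fun (setT : set (past n)) a -> (forall w, 0 <= a w) ->
  measurable_fun (setT : set (past n)) Y ->
  measurable_fun (setT : set (g_sigma_algebraType (data_gen X u))) xi ->
  measurable_fun setT phi -> (forall y, 0 <= phi y) ->
  (\int[P]_w (a w * phi (Y w + xi w))%:E =
   \int[P]_w ((a w)%:E * \int[P]_w' (phi (Y w + xi w'))%:E))%E.
Proof.
move=> nu ma a0 mY mxi mphi phi0.
have maY := measurable_fun_pair ma mY.
have maY' := measurable_past maY.
have mxi' := measurable_data mxi.
pose aY : {mfun T >-> (R * R)%type} := HB.pack (fun w => (a w, Y w))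
  (isMeasurableFun.Build _ _ _ _ _ maY').
pose Z : {mfun T >-> R} := HB.pack xi (isMeasurableFun.Build _ _ _ _ _ mxi').
(* The absolute value makes f nonnegative everywhere; it changes nothing at the values of a. *)
pose f (z : (R * R) * R) := (`|z.1.1| * phi (z.1.2 + z.2))%:E.
have mf : measurable_fun setT f.
  apply/measurable_EFinP; apply: measurable_funM.
    by apply: measurableT_comp => //; apply: measurableT_comp.
  apply: measurableT_comp => //; apply: measurable_funD => //.
  by apply: measurableT_comp.
have f0 z : (0 <= f z)%E by rewrite lee_fin mulr_ge0.
have := @integral_independent _ _ _ P _ _ _ _ aY Z f.
move=> /(_ _ mf f0)-H.
transitivity (\int[P]_w f (aY w, Z w))%E.
  by apply: eq_integral => w _; rewrite /f/= ger0_norm.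
rewrite H.
  apply: eq_integral => w _; rewrite ge0_integral_distribution//; last first.
    by apply: (measurableT_comp mf); exact: measurable_fun_pair.
  transitivity (\int[P]_w' ((a w)%:E * (phi (Y w + xi w'))%:E))%E.
    by apply: eq_integral => w' _; rewrite /f/= ger0_norm.
  rewrite ge0_integralZl_EFin//.
    by move=> w' _; rewrite lee_fin.
  by apply/measurable_EFinP; apply: measurableT_comp => //; exact: measurable_funD.
move=> A B mA mB; apply: (past_data_independent nu).
  by have := maY measurableT A mA; rewrite setTI.
by have := mxi measurableT B mB; rewrite setTI.
Qed.

Lemma integral_past_data n u (a q : T -> R) : (n <= choice.pickle u)%N ->
  measurable_fun (setT : set (past n)) a -> (forall w, 0 <= a w) ->
  measurable_fun (setT : set (g_sigma_algebraType (data_gen X u))) q ->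
  (forall w, 0 <= q w) ->
  (\int[P]_w (a w * q w)%:E = \int[P]_w (a w)%:E * \int[P]_w (q w)%:E)%E.
Proof.
move=> nu ma a0 mq q0.
transitivity (\int[P]_w (a w * `|0 + q w|)%:E)%E.
  by apply: eq_integral => w _; rewrite add0r ger0_norm.
have m0 : measurable_fun (setT : set (past n)) (cst (0 : R)) by exact: measurable_cst.
rewrite (integral_step nu ma a0 m0 mq (@normr_measurable R setT) (fun y => normr_ge0 y)).
have -> : (\int[P]_w ((a w)%:E * \int[P]_w' `|0 + q w'|%:E) =
    \int[P]_w ((a w)%:E * \int[P]_w' (q w')%:E))%E.
  apply: eq_integral => w _; congr (_ * _)%E.
  by apply: eq_integral => w' _; rewrite add0r ger0_norm.
rewrite ge0_integralZr//.
- by apply/measurable_EFinP; exact: measurable_past ma.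
- by move=> w _; rewrite lee_fin.
- by apply: integral_ge0 => w _; rewrite lee_fin.
Qed.

(** Birth is decided by the offspring numbers of the proper ancestors, all of smaller code; the data
    of u itself are not consulted, and hence remain independent of it. *)
Lemma born_past n u : (choice.pickle u <= n)%N -> measurable_fun (setT : set (past n)) (born X u).
Proof.
elim: u => [|[j k] v IH] un /=; first exact: measurable_cst.
have vn : (choice.pickle v < n)%N := leq_trans (pickle_parent _ _) un.
apply: measurable_and; first by apply: IH; exact: ltnW.
have mk : measurable_fun setT (fun m : nat => (k < m)%N) by [].
by apply: (data_past vn); exact: (measurableT_comp mk (@children_data _ _ _ _ _ _ _ _ X v j)).
Qed.

Definition alive u (w : T) : R := (born X u w)%:R.

Lemma alive_past n u : (choice.pickle u <= n)%N -> measurable_fun (setT : set (past n)) (alive u).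
Proof.
move=> un; have mb : measurable_fun setT (fun b : bool => b%:R : R) by [].
exact: (measurableT_comp mb (born_past un)).
Qed.

Lemma measurable_alive u : measurable_fun setT (alive u).
Proof. exact: measurable_past (alive_past (leqnn _)). Qed.

(* Up to [a * work], the walk is the total weight of the born individuals that *)
(* are not yet explored: initially the ancestor, then the children of the      *)
(* explored individuals; see [walk_ge].                                        *)
Definition walk (a : R) (b : 'I_K -> R) (n : nat) (w : T) : R :=
  b i + \sum_(u <- explored n) alive u w * (jump X a b u w - b (label_type i u)).

Definition work (n : nat) (w : T) : R :=
  \sum_(u <- explored n) alive u w * lifetime X u w.

Lemma walk_past a b n : measurable_fun (setT : set (past n)) (walk a b n).
Proof.
apply: measurable_funD => //.
have : forall s, {subset s <= explored n} -> measurable_fun (setT : set (past n))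
    (fun w => \sum_(u <- s) alive u w * (jump X a b u w - b (label_type i u))).
  elim=> [|u s IH] su.
    by under eq_fun do rewrite big_nil; exact: measurable_cst.
  under eq_fun do rewrite big_cons.
  have un : (choice.pickle u < n)%N by rewrite -mem_explored su// mem_head.
  apply: measurable_funD; last by apply: IH => v vs; rewrite su// inE vs orbT.
  apply: measurable_funM; first by apply: alive_past; exact: ltnW.
  by apply: measurable_funB => //; apply: (data_past un); exact: jump_data.
exact.
Qed.

Lemma work_past n : measurable_fun (setT : set (past n)) (work n).
Proof.
have : forall s, {subset s <= explored n} -> measurable_fun (setT : set (past n))
    (fun w => \sum_(u <- s) alive u w * lifetime X u w).
  elim=> [|u s IH] su.
    by under eq_fun do rewrite big_nil; exact: measurable_cst.
  under eq_fun do rewrite big_cons.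
  have un : (choice.pickle u < n)%N by rewrite -mem_explored su// mem_head.
  apply: measurable_funD; last by apply: IH => v vs; rewrite su// inE vs orbT.
  apply: measurable_funM; first by apply: alive_past; exact: ltnW.
  by apply: (data_past un); exact: lifetime_data.
exact.
Qed.

Lemma walk0 a b w : walk a b 0 w = b i.
Proof. by rewrite /walk /explored big_nil addr0. Qed.

Lemma walkS a b n w : walk a b n.+1 w = walk a b n w +
  if pickle_inv n is Some u then alive u w * (jump X a b u w - b (label_type i u)) else 0.
Proof.
rewrite /walk exploredS big_cat/= addrA; congr (_ + _).
by case: (pickle_inv n) => [u|]; rewrite ?big_seq1 ?big_nil.
Qed.

Section stack.
Variables (a : R) (b : 'I_K -> R) (w : T).
Hypothesis b0 : forall j, 0 <= b j.

Let alives n := [seq u <- explored n | born X u w].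
Let offspring n := [seq (c :: v : lab) | v <- alives n,
  c <- [seq (j, k) | j <- index_enum 'I_K, k <- iota 0 (children X v j w)]].

Let sum_alives n (f : lab -> R) :
  \sum_(u <- explored n) alive u w * f u = \sum_(u <- alives n) f u.
Proof.
rewrite big_filter [RHS]big_mkcond/=; apply: eq_bigr => u _.
by rewrite /alive; case: (born X u w); rewrite ?mul1r ?mul0r.
Qed.

Let sum_offspring n : \sum_(u <- offspring n) b (label_type i u) =
  \sum_(v <- alives n) \sum_j b j * (children X v j w)%:R.
Proof.
rewrite big_allpairs_dep/=; apply: eq_bigr => v _.
rewrite big_allpairs_dep/=; apply: eq_bigr => j _.
by rewrite big_const_seq count_predT size_iota iter_addr_0 mulr_natr.
Qed.

Let mem_offspring n c v : (c :: v \in offspring n) =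
  [&& (choice.pickle v < n)%N, born X v w & (c.2 < children X v c.1 w)%N].
Proof.
apply/allpairsPdep/idP => [[v' [c' [v'n c'n [-> ->]]]]|/and3P[vn bv cN]].
  move: v'n; rewrite mem_filter mem_explored => /andP[-> ->] /=.
  by move: c'n => /allpairsPdep[j [k [_ + ->]]]; rewrite mem_iota.
exists v, c; split => //; first by rewrite mem_filter mem_explored vn bv.
apply/allpairsPdep; exists c.1, c.2; split; rewrite ?mem_iota//; last by case: (c).
exact: mem_index_enum.
Qed.

Let walk_stack n : walk a b n w = a * work n w +
  (b i + \sum_(u <- offspring n) b (label_type i u) -
   \sum_(u <- alives n) b (label_type i u)).
Proof.
rewrite /walk /work !sum_alives sum_offspring mulr_sumr.
rewrite (eq_bigr (fun u => a * lifetime X u w +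
  (\sum_j b j * (children X u j w)%:R - b (label_type i u)))); last first.
  by move=> u _; rewrite /jump addrA.
by rewrite big_split sumrB/=; ring.
Qed.

(** Apart from a * work, the walk is the weight of the ancestor and of all children of the explored
    individuals, minus the weight of the explored individuals. The parent of a label of code at most
    n has code below n, so the born labels up to and including code n are all counted among the
    former. *)
Lemma walk_ge n : a * work n w +
  (if pickle_inv n is Some u then alive u w * b (label_type i u) else 0) <= walk a b n w.
Proof.
rewrite walk_stack lerD2l.
suff : \sum_(u <- alives n.+1) b (label_type i u) <=
    b i + \sum_(u <- offspring n) b (label_type i u).
  rewrite -[X in X <= _]sum_alives exploredS big_cat/= sum_alives lerBrDl.
  by case: (pickle_inv n) => [u|]; rewrite ?big_seq1 ?big_nil.
pose s := [::] :: offspring n.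
have -> : b i + \sum_(u <- offspring n) b (label_type i u) =
  \sum_(u <- s) b (label_type i u) by rewrite big_cons.
apply: sum_uniq_subset => [u //||u].
  by rewrite filter_uniq// explored_uniq.
rewrite mem_filter mem_explored inE => /andP[bu un].
case: u bu un => [//|[j k] v] /= /andP[bv kN] un.
by rewrite mem_offspring bv kN !andbT (leq_trans (pickle_parent (j, k) v)).
Qed.

Let offspring_trunc k n := [seq (c :: v : lab) | v <- alives n,
  c <- [seq (j, l) | j <- index_enum 'I_K, l <- iota 0 (minn (children X v j w) k)]].

(** A converse to the counting in [walk_ge]. Offspring numbers are unbounded, so no finite stage
    need contain all children of the explored individuals; those of index below k are all explored
    before stage m. *)
Lemma alive_truncated k n m : (0 < m)%N ->
  (forall v j l, v \in explored n -> (l < k)%N -> (choice.pickle ((j, l) :: v) < m)%N) ->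
  b i + \sum_(v <- explored n) alive v w * \sum_j b j * (minn (children X v j w) k)%:R <=
  \sum_(u <- explored m) alive u w * b (label_type i u).
Proof.
move=> m0 nkm; rewrite !sum_alives.
have -> : \sum_(v <- alives n) \sum_j b j * (minn (children X v j w) k)%:R =
    \sum_(u <- offspring_trunc k n) b (label_type i u).
  rewrite big_allpairs_dep/=; apply: eq_bigr => v _.
  rewrite big_allpairs_dep/=; apply: eq_bigr => j _.
  by rewrite big_const_seq count_predT size_iota iter_addr_0 mulr_natr.
have -> : b i + \sum_(u <- offspring_trunc k n) b (label_type i u) =
  \sum_(u <- [::] :: offspring_trunc k n) b (label_type i u) by rewrite big_cons.
apply: sum_uniq_subset => [u //||u].
  rewrite /=; apply/andP; split; first by apply/negP => /allpairsPdep[v [c [_ _]]].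
  apply: allpairs_uniq_dep => [|v _|[v c] [v' c'] _ _ /= [-> ->]//].
    by rewrite filter_uniq// explored_uniq.
  apply: allpairs_uniq_dep => [|j _|[j l] [j' l'] _ _ /= [-> ->]//].
    exact: index_enum_uniq.
  exact: iota_uniq.
rewrite inE => /predU1P[->|]; first by rewrite mem_filter mem_explored.
move=> /allpairsPdep[v [c [vn cn ->]]].
move: vn; rewrite mem_filter => /andP[bv vn].
move: cn => /allpairsPdep[j [l [_ + ->]]]; rewrite mem_iota/= add0n leq_min => /andP[lN lk].
by rewrite mem_filter/= bv lN mem_explored nkm.
Qed.

End stack.

End exploration.

Lemma integral_id_abs (R : realType) (F : probability R R) : supported_ge0 F ->
  (\int[F]_s s%:E = \int[F]_s `|s|%:E)%E.
Proof.
move=> F0; apply: ae_eq_integral => //.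
  by apply/measurable_EFinP; exact: normr_measurable.
exists (~` `[0, +oo[%classic); split.
- by apply: measurableC; exact: measurable_itv.
- have := probability_setC F (measurable_itv `[0, +oo[).
  by rewrite F0 subee.
- move=> s /=; apply: contra_not; rewrite in_itv/= andbT => s0 _.
  by rewrite ger0_norm.
Qed.

(** * Expected numbers of individuals and the mean busy period *)

Section progeny.
Context {K : nat} {d : measure_display} {T : measurableType d} {R : realType}.
Context {P : probability T R} {F : 'I_K -> probability R R}.
Context {lambda : 'I_K -> 'I_K -> R} {mu : 'I_K -> R} {i : 'I_K}.
Hypothesis F_ge0 : forall k, supported_ge0 (F k).
Hypothesis lambda_ge0 : forall k j, 0 <= lambda k j.
Hypothesis mu_gt0 : forall k, 0 < mu k.
Hypothesis F_mean : forall k, (\int[F k]_s s%:E)%E = (mu k)^-1%:E.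
Notation M := (mean_offspring lambda mu).
Hypothesis M_rho : spectral_radius M < 1.
Variable X : branching_process P F lambda i.
Notation lab := (seq ('I_K * nat)).
Implicit Types (u v : lab).

Lemma mean_offspring_ge0 k j : 0 <= M k j.
Proof. by rewrite mxE mulr_ge0// invr_ge0 ltW. Qed.

Lemma mean_lifetime u :
  (\int[P]_w (lifetime X u w)%:E = (mu (label_type i u))^-1%:E)%E.
Proof.
rewrite -F_mean integral_id_abs//.
rewrite -(@integral_lifetime _ _ _ _ _ _ _ _ X u (fun s => `|s|%:E)).
- by apply: eq_integral => w _; rewrite ger0_norm// lifetime_ge0.
- by apply/measurable_EFinP; exact: normr_measurable.
- by move=> s; rewrite lee_fin.
Qed.

Lemma mean_children_offspring u j :
  (\int[P]_w (children X u j w)%:R%:E = (M (label_type i u) j)%:E)%E.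
Proof.
rewrite mean_children// mxE.
under eq_integral do rewrite EFinM.
rewrite ge0_integralZl_EFin//.
- by rewrite mean_lifetime.
- by move=> w _; rewrite lee_fin lifetime_ge0.
- by apply/measurable_EFinP; exact: measurable_lifetime.
Qed.

Lemma measurable_children_real u j :
  measurable_fun setT (fun w => (children X u j w)%:R : R).
Proof.
have mN : measurable_fun setT (fun n : nat => n%:R : R) by [].
exact: (measurableT_comp mN (@measurable_children _ _ _ _ _ _ _ _ X u j)).
Qed.

Lemma mean_jump a b u : 0 <= a -> (forall j, 0 <= b j) ->
  (\int[P]_w (jump X a b u w)%:E = (a * (mu (label_type i u))^-1 +
    \sum_j M (label_type i u) j * b j)%:E)%E.
Proof.
move=> a0 b0; under eq_integral do rewrite EFinD -sumEFin.
have mb j : measurable_fun setT (fun w => (b j * (children X u j w)%:R)%:E).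
  by apply/measurable_EFinP; apply: measurable_funM => //; exact: measurable_children_real.
have b0' j w : (0 <= (b j * (children X u j w)%:R)%:E)%E by rewrite lee_fin mulr_ge0.
rewrite ge0_integralD//; last 4 first.
- by move=> w _; rewrite lee_fin mulr_ge0// lifetime_ge0.
- by apply/measurable_EFinP; apply: measurable_funM => //; exact: measurable_lifetime.
- by move=> w _; apply: sume_ge0 => j _.
- exact: emeasurable_sum.
rewrite ge0_integral_sum// EFinD -sumEFin; congr (_ + _)%E.
  under eq_integral do rewrite EFinM.
  rewrite ge0_integralZl_EFin//; first by rewrite mean_lifetime.
    by move=> w _; rewrite lee_fin lifetime_ge0.
  by apply/measurable_EFinP; exact: measurable_lifetime.
apply: eq_bigr => j _; under eq_integral do rewrite EFinM.
rewrite ge0_integralZl_EFin//; first by rewrite mean_children_offspring -EFinM mulrC.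
by apply/measurable_EFinP; exact: measurable_children_real.
Qed.

Definition birth_prob u : R := fine (\int[P]_w (alive X u w)%:E).

Lemma integral_alive u : (\int[P]_w (alive X u w)%:E = (birth_prob u)%:E)%E.
Proof.
rewrite fineK// ge0_fin_numE; last by apply: integral_ge0 => w _; rewrite lee_fin.
apply: (@le_lt_trans _ _ (\int[P]_w 1)%E); last first.
  rewrite integral_cst//= mul1e.
  exact: le_lt_trans (probability_le1 P measurableT) (ltry _).
apply: ge0_le_integral => //.
- by move=> w _; rewrite lee_fin.
- by apply/measurable_EFinP; exact: measurable_alive.
- by move=> w _; rewrite lee_fin /alive lern1 leq_b1.
Qed.

Lemma birth_prob_ge0 u : 0 <= birth_prob u.
Proof. by apply: fine_ge0; apply: integral_ge0 => w _; rewrite lee_fin. Qed.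

Lemma integral_alive_data u (q : T -> R) : (forall w, 0 <= q w) ->
  measurable_fun (setT : set (g_sigma_algebraType (data_gen X u))) q ->
  (\int[P]_w (alive X u w * q w)%:E = (birth_prob u)%:E * \int[P]_w (q w)%:E)%E.
Proof.
move=> q0 mq; have mal := @alive_past _ _ _ _ _ _ _ _ X _ u (leqnn _).
by rewrite (integral_past_data (leqnn _) mal _ mq q0) ?integral_alive.
Qed.

Lemma integral_alive_jump a b u : 0 <= a -> (forall j, 0 <= b j) ->
  (\int[P]_w (alive X u w * jump X a b u w)%:E = (birth_prob u *
    (a * (mu (label_type i u))^-1 + \sum_j M (label_type i u) j * b j))%:E)%E.
Proof.
move=> a0 b0; rewrite integral_alive_data; last exact: jump_data.
- by rewrite mean_jump.
- by move=> w; exact: jump_ge0.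
Qed.

Lemma integral_sum_alive (s : seq lab) (q : lab -> T -> R) (c : lab -> R) :
  (forall u w, 0 <= q u w) -> (forall u, measurable_fun setT (q u)) ->
  (forall u, \int[P]_w (alive X u w * q u w)%:E = (c u)%:E)%E ->
  (\int[P]_w (\sum_(u <- s) alive X u w * q u w)%:E = (\sum_(u <- s) c u)%:E)%E.
Proof.
move=> q0 mq qc; under eq_integral do rewrite -sumEFin.
rewrite ge0_integral_sum//.
- by rewrite -sumEFin; apply: eq_bigr => u _.
- by move=> u; apply/measurable_EFinP; apply: measurable_funM => //; exact: measurable_alive.
- by move=> u w _; rewrite lee_fin mulr_ge0.
Qed.

Definition births (c : 'I_K -> R) (n : nat) : R :=
  \sum_(u <- explored n) birth_prob u * c (label_type i u).

Lemma births_nd c : (forall j, 0 <= c j) -> nondecreasing_seq (births c).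
Proof.
move=> c0; apply/nondecreasing_seqP => n; rewrite /births exploredS big_cat/= lerDl.
by apply: sumr_ge0 => u _; rewrite mulr_ge0// birth_prob_ge0.
Qed.

Lemma integral_births c n : (forall j, 0 <= c j) ->
  (\int[P]_w (\sum_(u <- explored n) alive X u w * c (label_type i u))%:E =
   (births c n)%:E)%E.
Proof.
move=> c0; apply: (@integral_sum_alive _ (fun u _ => c (label_type i u))) => // u.
under eq_integral do rewrite mulrC EFinM.
rewrite ge0_integralZl_EFin//.
- by rewrite integral_alive -EFinM mulrC.
- by move=> w _; rewrite lee_fin.
- by apply/measurable_EFinP; exact: measurable_alive.
Qed.

(** The mean of [walk_ge] with a = 0, the walk being then nonnegative: a born individual is the
    ancestor or a child of an individual explored before it. *)
Lemma births_le_offspring b n : (forall j, 0 <= b j) ->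
  births b n <= b i + births (fun k => \sum_j M k j * b j) n.
Proof.
move=> b0; rewrite -lee_fin -integral_births// EFinD.
have -> : (births (fun k => \sum_j M k j * b j) n)%:E =
    (\int[P]_w (\sum_(u <- explored n) alive X u w * jump X 0 b u w)%:E)%E.
  rewrite (integral_sum_alive _ (c := fun u => birth_prob u *
      \sum_j M (label_type i u) j * b j))//.
  - by move=> u w; exact: jump_ge0.
  - by move=> u; exact: measurable_jump.
  - by move=> u; rewrite integral_alive_jump// mul0r add0r.
have ms (q : lab -> T -> R) : (forall u, measurable_fun setT (q u)) ->
    measurable_fun setT (fun w => \sum_(u <- explored n) alive X u w * q u w).
  move=> mq; apply: measurable_sum => u; apply: measurable_funM => //.
  exact: measurable_alive.
have j0 w : 0 <= \sum_(u <- explored n) alive X u w * jump X 0 b u w.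
  by apply: sumr_ge0 => u _; rewrite mulr_ge0// jump_ge0.
have mj : measurable_fun setT (fun w =>
    (\sum_(u <- explored n) alive X u w * jump X 0 b u w)%:E).
  by apply/measurable_EFinP; apply: ms => u; exact: measurable_jump.
apply: (@le_trans _ _ (\int[P]_w ((b i)%:E +
    (\sum_(u <- explored n) alive X u w * jump X 0 b u w)%:E))%E); last first.
  rewrite ge0_integralD//.
  - rewrite integral_cst//= probability_setT mule1//.
  - by move=> w _; rewrite lee_fin.
  - by move=> w _; rewrite lee_fin.
apply: ge0_le_integral => //.
- by move=> w _; rewrite lee_fin sumr_ge0// => u _; rewrite mulr_ge0.
- by apply/measurable_EFinP; apply: ms => u; exact: measurable_cst.
- by apply: emeasurable_funD.
move=> w _; rewrite -EFinD lee_fin.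
have := walk_ge X 0 w b0 n; rewrite mul0r add0r /walk => h.
rewrite -subr_ge0 -addrA -sumrB.
under eq_bigr do rewrite -mulrBr.
by apply: le_trans h; case: (pickle_inv n) => // u; rewrite mulr_ge0.
Qed.

Let trunc b u k (w : T) : R := \sum_j b j * (minn (children X u j w) k)%:R.

Let mean_trunc b u k : R := fine (\int[P]_w (trunc b u k w)%:E)%E.

Let trunc_data b u k :
  measurable_fun (setT : set (g_sigma_algebraType (data_gen X u))) (trunc b u k).
Proof.
apply: measurable_sum => j; apply: measurable_funM => //.
have mN : measurable_fun setT (fun n : nat => (minn n k)%:R : R) by [].
exact: (measurableT_comp mN (@children_data _ _ _ _ _ _ _ _ X u j)).
Qed.

Let trunc_ge0 b u k w : (forall j, 0 <= b j) -> 0 <= trunc b u k w.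
Proof. by move=> b0; apply: sumr_ge0 => j _; rewrite mulr_ge0. Qed.

Let mean_trunc_cvg b u : (forall j, 0 <= b j) ->
  (forall k, \int[P]_w (trunc b u k w)%:E = (mean_trunc b u k)%:E)%E /\
  mean_trunc b u @ \oo --> \sum_j M (label_type i u) j * b j.
Proof.
move=> b0.
have mt k : measurable_fun setT (fun w => (trunc b u k w)%:E).
  by apply/measurable_EFinP; exact: (measurable_data (@trunc_data b u k)).
have tj k w : trunc b u k w <= jump X 0 b u w.
  rewrite /jump mul0r add0r; apply: ler_sum => j _; rewrite ler_wpM2l// ler_nat.
  exact: geq_minl.
have fin k : (\int[P]_w (trunc b u k w)%:E)%E \is a fin_num.
  rewrite ge0_fin_numE; last by apply: integral_ge0 => w _; rewrite lee_fin trunc_ge0.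
  apply: (@le_lt_trans _ _ (\int[P]_w (jump X 0 b u w)%:E)%E).
    apply: ge0_le_integral => //.
    - by move=> w _; rewrite lee_fin trunc_ge0.
    - by apply/measurable_EFinP; exact: measurable_jump.
    - by move=> w _; rewrite lee_fin tj.
  by rewrite mean_jump// ltry.
split=> [k|]; first by rewrite /mean_trunc fineK.
apply: fine_cvg; have := mean_jump u (lexx (0 : R)) b0; rewrite mul0r add0r => <-.
rewrite (_ : (fun w => (jump X 0 b u w)%:E) = (fun w => limn (fun k => (trunc b u k w)%:E))).
  apply: cvg_monotone_convergence => //.
  - by move=> k w _; rewrite lee_fin trunc_ge0.
  - move=> w _ k k' kk'; rewrite lee_fin; apply: ler_sum => j _.
    by rewrite ler_wpM2l// ler_nat leq_min geq_minl/= (leq_trans (geq_minr _ _)).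
apply/funext => w; apply/esym/cvg_lim => //; apply: cvg_near_cst.
exists (\max_j (children X u j w)) => // k /= Nk.
rewrite /jump mul0r add0r; congr EFin; apply: eq_bigr => j _.
by rewrite (minn_idPl _)// (leq_trans _ Nk)// (leq_bigmax j).
Qed.

(** By [alive_truncated] the ancestor and the truncated offspring are among the individuals born by
    some stage m; monotone convergence in the truncation k restores the full offspring means. *)
Lemma births_ge_offspring b n (l : R) : (forall j, 0 <= b j) ->
  (forall m, births b m <= l) ->
  b i + births (fun k => \sum_j M k j * b j) n <= l.
Proof.
move=> b0 bl.
have mt u k := measurable_data (@trunc_data b u k).
have trunc_le k : b i + \sum_(v <- explored n) birth_prob v * mean_trunc b v k <= l.
  pose m := (\max_(v <- explored n) \max_(j < K) \max_(x < k)
    choice.pickle ((j, x : nat) :: v)).+1.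
  have mP v (j : 'I_K) x : v \in explored n -> (x < k)%N ->
      (choice.pickle ((j, x) :: v) < m)%N.
    move=> vn xk; rewrite /m ltnS.
    apply: leq_trans (leq_bigmax_seq _ vn isT); apply: leq_trans (leq_bigmax j).
    exact: (leq_bigmax (Ordinal xk)).
  apply: le_trans (bl m); rewrite -lee_fin -integral_births// EFinD.
  have <- : (\int[P]_w (\sum_(v <- explored n) alive X v w * trunc b v k w)%:E)%E =
      (\sum_(v <- explored n) birth_prob v * mean_trunc b v k)%:E.
    apply: integral_sum_alive => // [u w|u]; first exact: trunc_ge0.
    rewrite integral_alive_data.
    - by rewrite (mean_trunc_cvg u b0).1 EFinM.
    - by move=> w; exact: trunc_ge0.
    - exact: trunc_data.
  have ms (q : lab -> T -> R) n' : (forall u, measurable_fun setT (q u)) ->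
      measurable_fun setT (fun w => (\sum_(u <- explored n') alive X u w * q u w)%:E).
    move=> mq; apply/measurable_EFinP; apply: measurable_sum => u.
    by apply: measurable_funM => //; exact: measurable_alive.
  have s0 w : 0 <= \sum_(u <- explored n) alive X u w * trunc b u k w.
    by apply: sumr_ge0 => u _; rewrite mulr_ge0// trunc_ge0.
  apply: (@le_trans _ _ (\int[P]_w ((b i)%:E +
      (\sum_(u <- explored n) alive X u w * trunc b u k w)%:E))%E).
    rewrite ge0_integralD//; last exact: ms.
    - by rewrite integral_cst//= probability_setT mule1.
    - by move=> w _; rewrite lee_fin.
    - by move=> w _; rewrite lee_fin.
  apply: ge0_le_integral => //.
  - by move=> w _; rewrite -EFinD lee_fin addr_ge0.
  - by apply: emeasurable_funD => //; exact: ms.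
  - by apply: ms => u; exact: measurable_cst.
  - by move=> w _; rewrite -EFinD lee_fin; exact: alive_truncated.
have cv : (fun k => b i + \sum_(v <- explored n) birth_prob v * mean_trunc b v k) @ \oo -->
    b i + births (fun k => \sum_j M k j * b j) n.
  apply: cvgD; first exact: cvg_cst.
  apply: cvg_big => [|v _]; first exact: add_continuous.
  by apply: cvgMr; exact: (mean_trunc_cvg v b0).2.
by rewrite -(cvg_lim _ cv)//; apply: limr_le; [exact: cvgP cv|exact: nearW].
Qed.

Lemma births_delta (c : 'I_K -> R) n :
  births c n = \sum_j births (fun k => (k == j)%:R) n * c j.
Proof.
rewrite /births; under [RHS]eq_bigr do rewrite mulr_suml.
rewrite exchange_big/=; apply: eq_bigr => u _.
rewrite (bigD1 (label_type i u))//= eqxx mulr1 big1 ?addr0// => j /negPf ju.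
by rewrite eq_sym ju mulr0 mul0r.
Qed.

Lemma births_column j n : births (fun k => \sum_x M k x * (x == j)%:R) n =
  \sum_k births (fun x => (x == k)%:R) n * M k j.
Proof.
rewrite births_delta; apply: eq_bigr => k _; congr (_ * _).
by rewrite (bigD1 j)//= eqxx mulr1 big1 ?addr0// => x /negPf ->; rewrite mulr0.
Qed.

Lemma births_delta_le j n :
  births (fun k => (k == j)%:R) n <= invmx (1%:M - M) i j.
Proof.
apply: (row_le_invmx mean_offspring_ge0 M_rho (a := fun j => births _ n)) => {}j.
apply: le_trans (births_le_offspring _ _) _ => //.
by rewrite births_column.
Qed.

(** The expected numbers of type j individuals increase and are bounded by [births_delta_le]. By the
    two offspring inequalities their limits satisfy a = e_i + a M, so that a is row i of (I -
    M)^-1. *)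
Lemma births_cvg (c : 'I_K -> R) : births c @ \oo --> solve M c i.
Proof.
pose a j := births (fun k => (k == j)%:R).
have a_nd j : nondecreasing_seq (a j) by exact: births_nd.
have a_cvg j : cvgn (a j).
  apply: nondecreasing_is_cvgn => //; exists (invmx (1%:M - M) i j) => _ [n _ <-].
  exact: births_delta_le.
have a_lim j : limn (a j) = invmx (1%:M - M) i j.
  apply: (row_eq_invmx M_rho (a := fun j => limn (a j))) => {}j.
  have MD n := births_column j n.
  have Mcvg : (fun n => (i == j)%:R + \sum_k a k n * M k j) @ \oo -->
      (i == j)%:R + \sum_k limn (a k) * M k j.
    apply: cvgD; first exact: cvg_cst.
    apply: cvg_big => [|k _]; first exact: add_continuous.
    by apply: cvgMl; exact: a_cvg.
  apply/eqP; rewrite eq_le; apply/andP; split.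
    apply: limr_le => //; apply: nearW => n.
    apply: le_trans (births_le_offspring _ _) _ => //; rewrite MD.
    rewrite -(cvg_lim _ Mcvg)//; apply: nondecreasing_cvgn_le (cvgP _ Mcvg) n.
    move=> x y xy; rewrite lerD2l; apply: ler_sum => k _.
    by rewrite ler_wpM2r ?mean_offspring_ge0// a_nd.
  rewrite -(cvg_lim _ Mcvg)//; apply: limr_le; first exact: cvgP Mcvg.
  apply: nearW => n; rewrite -MD; apply: births_ge_offspring => // m.
  exact: (nondecreasing_cvgn_le (a_nd j) (a_cvg j)).
rewrite (_ : births c = fun n => \sum_j a j n * c j); last first.
  by apply/funext => n; rewrite births_delta.
apply: cvg_big => [|j _]; first exact: add_continuous.
by apply: cvgMl; rewrite -a_lim; exact: a_cvg.
Qed.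

Lemma births_le (c : 'I_K -> R) n : (forall j, 0 <= c j) -> births c n <= solve M c i.
Proof.
move=> c0; rewrite -(cvg_lim _ (@births_cvg c))//.
by apply: nondecreasing_cvgn_le; [exact: births_nd|exact: cvgP (@births_cvg c)].
Qed.

(** The sum over all labels is a supremum over finite sets, and each finite set is contained in some
    [explored n]. *)
Lemma busy_period_cvg w : (work X n w)%:E @[n --> \oo] --> busy_period X w.
Proof.
have f0 u : (0 <= if born X u w then (lifetime X u w)%:E else 0)%E.
  by case: ifP => // _; rewrite lee_fin lifetime_ge0.
have workE n : (work X n w)%:E =
    (\sum_(u <- explored n) if born X u w then (lifetime X u w)%:E else 0)%E.
  rewrite -sumEFin; apply: eq_bigr => u _; rewrite /alive.
  by case: ifP; rewrite ?mul1r ?mul0r.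
pose f u := (if born X u w then (lifetime X u w)%:E else 0)%E.
have workF n : (work X n w)%:E = (\sum_(u \in [set` explored n]) f u)%E.
  by rewrite workE fsbig_seq//; exact: explored_uniq.
have sub_le (A B : set lab) : finite_set A -> finite_set B -> A `<=` B ->
    (\sum_(u \in A) f u <= \sum_(u \in B) f u)%E.
  by move=> fA fB AB; apply: lee_fsum_nneg_subset => // [|u _]; [exact/subsetP|exact: f0].
have -> : busy_period X w = ereal_sup (range (fun n => (work X n w)%:E)).
  apply/eqP; rewrite eq_le; apply/andP; split.
    apply: ge_ereal_sup => _ [S [finS _] <-].
    pose n := (\max_(u <- fset_set S) choice.pickle u).+1.
    apply: (@le_trans _ _ (work X n w)%:E); last by apply: ereal_sup_ubound; exists n.
    rewrite workF; apply: sub_le => // u Su.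
    rewrite /= mem_explored ltnS; apply: leq_bigmax_seq => //.
    by rewrite in_fset_set// inE.
  apply: ge_ereal_sup => _ [n _ <-]; rewrite workF.
  apply: ereal_sup_ubound; exists [set` explored n] => //.
  by split => //; exact: finite_seq.
apply: ereal_nondecreasing_cvgn => m n mn; rewrite !workF; apply: sub_le => // u /=.
by rewrite !mem_explored => um; exact: leq_trans mn.
Qed.

Lemma work_ge0 n w : 0 <= work X n w.
Proof. by apply: sumr_ge0 => u _; rewrite mulr_ge0// lifetime_ge0. Qed.

Lemma work_nd w : nondecreasing_seq (work X ^~ w).
Proof.
apply/nondecreasing_seqP => n; rewrite /work exploredS big_cat/= lerDl.
by apply: sumr_ge0 => u _; rewrite mulr_ge0// lifetime_ge0.
Qed.

Lemma measurable_work n : measurable_fun setT (work X n).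
Proof. exact: measurable_past (@work_past _ _ _ _ _ _ _ _ X n). Qed.

(** A lifetime is independent of the birth of its label, so the mean work at stage n is [births]
    with weights 1/mu_k. This makes the constants beta_k explicit. *)
Lemma mean_busy_period :
  (\int[P]_w busy_period X w = (solve M (fun k => (mu k)^-1) i)%:E)%E.
Proof.
rewrite (_ : busy_period X = fun w => limn (fun n => (work X n w)%:E)); last first.
  by apply/funext => w; apply/esym/cvg_lim => //; exact: busy_period_cvg.
rewrite monotone_convergence//.
- rewrite (_ : (fun n => _) = (fun n => (births (fun k => (mu k)^-1) n)%:E)).
    by apply/cvg_lim => //; apply: cvg_EFin; [exact: nearW|exact: births_cvg].
  apply/funext => n; apply: integral_sum_alive => u.
  + by move=> w; exact: lifetime_ge0.
  + exact: measurable_lifetime.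
  + rewrite integral_alive_data; last exact: lifetime_data.
      by rewrite mean_lifetime.
    by move=> w; exact: lifetime_ge0.
- by move=> n; apply/measurable_EFinP; exact: measurable_work.
- by move=> n w _; rewrite lee_fin work_ge0.
- by move=> w _ m n mn; rewrite lee_fin; exact: work_nd.
Qed.

End progeny.

(** * Regularly varying tails and the barrier *)

Lemma measurable_lt_indicator {d : measure_display} {T : measurableType d} {R : realType}
    (f g : T -> R) : measurable_fun setT f -> measurable_fun setT g ->
  measurable_fun setT (fun w => (f w < g w)%R%:R : R).
Proof.
move=> mf mg; have mb : measurable_fun setT (fun b : bool => b%:R : R) by [].
by apply: (measurableT_comp mb); exact: measurable_fun_ltr.
Qed.

Lemma integral_bool {d : measure_display} {T : measurableType d} {R : realType}
    (P : probability T R) (b : T -> bool) : measurable [set w | b w] ->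
  (\int[P]_w (b w)%:R%:E = P [set w | b w])%E.
Proof.
move=> mb; transitivity (\int[P]_w (\1_[set w | b w] w : R)%:E)%E.
  by apply: eq_integral => w _; rewrite indicE mem_setE.
by rewrite integral_indic ?setIT.
Qed.

Section eventually.
Context {R : realType}.

Lemma near_pinftyP (Q : R -> Prop) :
  (\forall x \near +oo, Q x) <-> exists2 A, 0 < A & forall x, A <= x -> Q x.
Proof.
split=> [[A [_ AQ]]|[A A0 AQ]].
  exists (`|A| + 1); first by rewrite ltr_wpDl.
  by move=> x Ax; apply: AQ; apply: lt_le_trans Ax; rewrite ltr_pwDr// ler_norm.
by exists A; split => [|x /ltW]; [rewrite num_real|exact: AQ].
Qed.

Lemma near_ge (A : R) : \forall x \near +oo, A <= x.
Proof. by apply: nbhs_pinfty_ge; rewrite num_real. Qed.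

Lemma near_scale (Q : R -> Prop) (t : R) : 0 < t ->
  (\forall x \near +oo, Q x) -> \forall x \near +oo, Q (t * x).
Proof.
move=> t0 /near_pinftyP[A A0 AQ]; apply/near_pinftyP; exists (A / t); first exact: divr_gt0.
by move=> x; rewrite ler_pdivrMr// mulrC; exact: AQ.
Qed.

End eventually.

Section tail_of_distribution.
Context {R : realType}.
Variable F : probability R R.

Lemma tail_measure x : (tail F x)%:E = F `]x, +oo[%classic.
Proof. by rewrite fineK// fin_num_measure//; exact: measurable_itv. Qed.

Lemma tail_ge0 x : 0 <= tail F x.
Proof. exact: fine_ge0. Qed.

Lemma tail_le1 x : tail F x <= 1.
Proof. by rewrite -lee_fin tail_measure; apply: probability_le1; exact: measurable_itv. Qed.

Lemma tail_ni x y : x <= y -> tail F y <= tail F x.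
Proof.
move=> xy; rewrite -lee_fin !tail_measure; apply: le_measure; rewrite ?inE//;
  try exact: measurable_itv.
by move=> z /=; rewrite !in_itv/= !andbT; exact: le_lt_trans.
Qed.

Lemma tail_ratio_of_rv : regularly_varying_tail F -> exists alpha : R, forall t, 0 < t ->
  tail F (t * x) / tail F x @[x --> +oo] --> t `^ (- alpha).
Proof.
move=> [alpha [L [[_ Lpos Lratio] tailE]]]; exists alpha => t t0.
have H := cvgMl (b := t `^ (- alpha)) (Lratio t t0); rewrite mul1r in H.
apply: cvg_trans (H _); apply: near_eq_cvg; near=> x.
have x0 : 0 < x by near: x; exact: nbhs_pinfty_gt.
have Lx : 0 < L x by near: x.
rewrite !tailE ?mulr_gt0// powRM ?ltW// powRN.
have xa : x `^ alpha != 0 by rewrite gt_eqF// powR_gt0.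
have ta : t `^ alpha != 0 by rewrite gt_eqF// powR_gt0.
by field; rewrite xa ta gt_eqF.
Unshelve. all: by end_near. Qed.

Hypothesis F_rv : regularly_varying_tail F.

Lemma tail_gt0 x : 0 < tail F x.
Proof.
have [alpha [L [[_ Lpos _] tailE]]] := F_rv.
have [A A0 LA] := (near_pinftyP _).1 Lpos.
pose y := Num.max x A; have y0 : 0 < y by rewrite lt_max A0 orbT.
apply: lt_le_trans (tail_ni (_ : x <= y)); last by rewrite le_max lexx.
by rewrite tailE// divr_gt0 ?powR_gt0// LA// le_max lexx orbT.
Qed.

Lemma tail_dominated t : 0 < t ->
  exists2 D, 0 < D & \forall x \near +oo, tail F (t * x) <= D * tail F x.
Proof.
move=> t0; have [alpha /(_ t t0) rat] := tail_ratio_of_rv F_rv.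
exists (t `^ (- alpha) + 1); first by rewrite ltr_wpDl ?powR_ge0.
near=> x; rewrite -ler_pdivrMr ?tail_gt0//; near: x.
by apply: (cvgr_le _ rat); rewrite ltrDl.
Unshelve. all: by end_near. Qed.

Lemma tail_near1 e : 0 < e -> exists2 t, 0 < t < 1 &
  \forall x \near +oo, tail F (t * x) <= (1 + e) * tail F x.
Proof.
move=> e0; have [alpha rat] := tail_ratio_of_rv F_rv.
have l0 : 0 < ln (1 + e / 2) by rewrite ln_gt0// ltrDl divr_gt0.
have a1 : 0 < `|alpha| + 1 by rewrite ltr_wpDl.
(* Then t^(- alpha) is at most 1 + e / 2, whatever the sign of alpha, because |alpha| / (|alpha| +
   1) < 1. *)
pose t := expR (- (ln (1 + e / 2) / (`|alpha| + 1))).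
have t0 : 0 < t by exact: expR_gt0.
have tpow : t `^ (- alpha) <= 1 + e / 2.
  rewrite /powR gt_eqF// expRK -[leRHS]lnK ?posrE ?addr_gt0 ?divr_gt0// ler_expR.
  rewrite mulrNN mulrCA -[leRHS]mulr1 ler_wpM2l// ?ltW//.
  by rewrite ltr_pdivrMr// mul1r (le_lt_trans (ler_norm _))// ltrDl.
exists t; first by rewrite t0 expR_lt1 oppr_lt0 divr_gt0.
near=> x; rewrite -ler_pdivrMr ?tail_gt0//; near: x.
apply: (cvgr_le _ (rat t t0)); apply: (le_lt_trans tpow).
by rewrite ltrD2l ltr_pdivrMr// mulr_natr mulr2n ltrDl.
Unshelve. all: by end_near. Qed.

(** A fixed shift v is eventually less than (1 - t) x, so that [tail_near1] absorbs it. *)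
Lemma tail_shift v e : 0 < e ->
  \forall x \near +oo, tail F (x - v) <= (1 + e) * tail F x.
Proof.
move=> e0; have [t /andP[t0 t1] tP] := tail_near1 e0.
near=> x; apply: le_trans (tail_ni (_ : t * x <= _)) _.
  have : v / (1 - t) <= x by near: x; exact: near_ge.
  by rewrite ler_pdivrMr ?subr_gt0// mulrBr mulr1 mulrC lerBrDr addrC -lerBrDr.
by near: x.
Unshelve. all: by end_near. Qed.

(** By [tail_shift] a unit step eventually multiplies the tail by at least exp(- k / 2), so that the
    tail decays no faster than a multiple of exp(- k x / 2); the other half of the exponent tends to
    0. *)
Lemma expR_tail k e : 0 < k -> 0 < e ->
  \forall x \near +oo, expR (- (k * x)) <= e * tail F x.
Proof.
move=> k0 e0; have k20 : 0 < k / 2 by rewrite divr_gt0.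
have e1 : 0 < expR (k / 2) - 1 by rewrite subr_gt0 expR_gt1.
have [A A0 AP'] := (near_pinftyP _).1 (tail_shift 1 e1).
have AP x : A <= x -> tail F x * expR (- (k / 2)) <= tail F (x + 1).
  move=> Ax; have := AP' (x + 1); rewrite addrK [1 + _]addrC subrK => h.
  rewrite expRN ler_pdivrMr ?expR_gt0// mulrC; apply: h.
  by rewrite (le_trans Ax)// lerDl.
have low n x : A <= x <= A + 1 -> tail F (A + 1) * expR (- (k / 2)) ^+ n <= tail F (x + n%:R).
  elim: n x => [|n IH] x /andP[Ax xA]; first by rewrite expr0 mulr1 addr0 tail_ni.
  rewrite exprSr mulrA; apply: le_trans (ler_wpM2r (expR_ge0 _) (IH x _)) _.
    by rewrite Ax.
  have := AP (x + n%:R); rewrite -addrA natr1; apply.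
  by rewrite (le_trans Ax)// lerDl.
have low' y : A <= y -> tail F (A + 1) * expR (- (k / 2 * (y - A))) <= tail F y.
  move=> Ay; pose n := Num.truncn (y - A).
  have yA : 0 <= y - A by rewrite subr_ge0.
  have [n1 n2] : n%:R <= y - A /\ y - A < n.+1%:R.
    by have /andP[] := truncn_itv yA.
  have := low n (y - n%:R); rewrite subrK => h; apply: le_trans (h _).
    rewrite ler_wpM2l ?tail_ge0// -expRM_natr ler_expR mulNr lerN2 ler_wpM2l// ltW//.
  rewrite lerBrDr -lerBrDl n1/= lerBlDr -addrA -lerBlDl.
  by rewrite addrC natr1 ltW.
have T0 := tail_gt0 (A + 1).
have c0 : 0 < e * (tail F (A + 1) * expR (k / 2 * A)) by rewrite !mulr_gt0 ?expR_gt0.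
near=> x; have Ax : A <= x by near: x; exact: near_ge.
apply: (@le_trans _ _ (e * (tail F (A + 1) * expR (- (k / 2 * (x - A)))))); last first.
  by rewrite ler_pM2l// low'.
rewrite mulrBr opprB expRD [expR _ * _]mulrC mulrCA [X in _ <= X](_ : _ =
   expR (- (k / 2 * x)) * (e * (tail F (A + 1) * expR (k / 2 * A)))); last by ring.
have -> : - (k * x) = - (k / 2 * x) + - (k / 2 * x) by field.
rewrite expRD ler_pM2l ?expR_gt0//.
near: x.
have h : expR (- x) @[x --> +oo] --> (0 : R) by exact: cvgr_expR.
have := near_scale k20 (cvgr_le _ h _ c0); exact.
Unshelve. all: by end_near. Qed.

Let capped (z x : R) : R := Num.max 0 (Num.min x z).

Let capped_ge0 (z x : R) : 0 <= capped z x. Proof. by rewrite le_max lexx. Qed.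

Let measurable_capped z : measurable_fun setT (capped z).
Proof. by apply: measurable_maxr => //; exact: measurable_minr. Qed.

Let capped_diff (a b x : R) : 0 <= a <= b ->
  (b - a) * (b < x)%R%:R <= capped b x - capped a x <= (b - a) * (a < x)%R%:R.
Proof.
move=> /andP[a0 ab]; have b0 := le_trans a0 ab.
have cE z : 0 <= z -> capped z x = if x <= 0 then 0 else if x <= z then x else z.
  move=> z0; rewrite /capped; have [x0|x0] := leP x 0.
    by rewrite max_l// ge_min x0.
  by have [xz|xz] := leP x z; rewrite max_r// ltW.
rewrite !cE//; have [x0|x0] := leP x 0.
  by rewrite !ltNge (le_trans x0 a0) (le_trans x0 b0)/= !mulr0 subrr lexx.
have [xa|xa] := leP x a; have [xb|xb] := leP x b; rewrite ?mulr1 ?mulr0; apply/andP; split; lra.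
Qed.

(** For z >= 0 this is the integral of the tail of F over [0, z], written as the mean of a truncated
    variable; increments are then bounded by [capped_mean_diff] as integrals of a monotone function
    would be. *)
Definition capped_mean z : R := fine (\int[F]_x (capped z x)%:E)%E.

Let capped_meanE z : (capped_mean z)%:E = (\int[F]_x (capped z x)%:E)%E.
Proof.
rewrite fineK// ge0_fin_numE; last by apply: integral_ge0 => x _; rewrite lee_fin.
apply: (@le_lt_trans _ _ (\int[F]_x (`|z|)%:E)%E).
  apply: ge0_le_integral => //.
  - by move=> x _; rewrite lee_fin.
  - by apply/measurable_EFinP.
  - move=> x _; rewrite lee_fin ge_max normr_ge0/=.
    by rewrite (le_trans _ (ler_norm z))// ge_min lexx orbT.
rewrite integral_cst//=; apply: lte_mul_pinfty => //.
by apply: le_lt_trans (probability_le1 F measurableT) (ltry _).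
Qed.

Lemma capped_mean_diff (a b : R) : 0 <= a <= b ->
  (b - a) * tail F b <= capped_mean b - capped_mean a <= (b - a) * tail F a.
Proof.
move=> /[dup] ab /andP[a0 ab']; have ba : 0 <= b - a by rewrite subr_ge0.
have mind (z : R) : measurable_fun setT (fun x : R => (z < x)%R%:R : R).
  exact: measurable_lt_indicator.
have tailE z : (\int[F]_x ((b - a) * (z < x)%R%:R)%:E = ((b - a) * tail F z)%:E)%E.
  under eq_integral do rewrite EFinM.
  rewrite ge0_integralZl_EFin//.
  - rewrite EFinM tail_measure; congr (_ * _)%E.
    transitivity (\int[F]_x (\1_(`]z, +oo[%classic) x : R)%:E)%E; last first.
      by rewrite integral_indic// ?setIT//; exact: measurable_itv.
    apply: eq_integral => x _; rewrite indicE; congr (_%:R%:E).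
    by rewrite mem_setE/= in_itv/= andbT.
  - exact/measurable_EFinP.
have mt (z : R) : measurable_fun setT (fun x : R => ((b - a) * (z < x)%R%:R)%:E).
  by apply/measurable_EFinP; exact: measurable_funM.
apply/andP; split.
  rewrite lerBrDr -lee_fin EFinD !capped_meanE -tailE -ge0_integralD//.
  - apply: ge0_le_integral => //.
    + by move=> x _; rewrite adde_ge0// lee_fin ?mulr_ge0.
    + by apply: emeasurable_funD => //; exact/measurable_EFinP.
    + exact/measurable_EFinP.
    + by move=> x _; rewrite lee_fin -lerBrDr; have /andP[] := capped_diff x ab.
  - by move=> x _; rewrite lee_fin mulr_ge0.
  - by move=> x _; rewrite lee_fin.
  - exact/measurable_EFinP.
rewrite lerBlDr -lee_fin EFinD !capped_meanE -tailE -ge0_integralD//.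
- apply: ge0_le_integral => //.
  + by move=> x _; rewrite lee_fin.
  + exact/measurable_EFinP.
  + by apply: emeasurable_funD => //; exact/measurable_EFinP.
  + by move=> x _; rewrite lee_fin -lerBlDr; have /andP[] := capped_diff x ab.
- by move=> x _; rewrite lee_fin mulr_ge0.
- by move=> x _; rewrite lee_fin.
- exact/measurable_EFinP.
Qed.

Lemma capped_mean_nd : {homo capped_mean : x y / x <= y}.
Proof.
move=> a b ab; rewrite -lee_fin !capped_meanE; apply: ge0_le_integral => //.
- by move=> x _; rewrite lee_fin.
- exact/measurable_EFinP.
- exact/measurable_EFinP.
- move=> x _; rewrite lee_fin /capped ge_max le_max lexx/= le_max.
  apply/orP; right; rewrite le_min ge_min lexx/= ge_min.
  by rewrite ab orbT.
Qed.

Hypothesis F_ge0 : supported_ge0 F.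
Hypothesis F_mean : (\int[F]_x x%:E < +oo)%E.

(* The function [capped_mean] increases to the finite mean of F. *)
Lemma capped_mean_cauchy e : 0 < e ->
  \forall x \near +oo, forall y, capped_mean y - capped_mean x <= e.
Proof.
move=> e0; have := F_mean; rewrite integral_id_abs// => Fabs.
have ub z : capped_mean z <= fine (\int[F]_x `|x|%:E)%E.
  rewrite -lee_fin capped_meanE fineK ?ge0_fin_numE//; last first.
    by apply: integral_ge0 => x _; rewrite lee_fin.
  apply: ge0_le_integral => //.
  - by move=> x _; rewrite lee_fin.
  - exact/measurable_EFinP.
  - by apply/measurable_EFinP; exact: normr_measurable.
  - move=> x _; rewrite lee_fin ge_max normr_ge0/=.
    by rewrite (le_trans _ (ler_norm x))// ge_min lexx.
have hs : has_sup (range capped_mean).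
  split; first by exists (capped_mean 0); exists 0.
  by exists (fine (\int[F]_x `|x|%:E)%E) => _ [z _ <-].
have [_ [x0 _ <-] xs] := sup_adherent e0 hs.
near=> x => y; rewrite lerBlDr.
apply: (@le_trans _ _ (sup (range capped_mean))).
  by apply: sup_upper_bound => //; exists y.
have : capped_mean x0 <= capped_mean x.
  by apply: capped_mean_nd; near: x; exact: near_ge.
lra.
Unshelve. all: by end_near. Qed.

Lemma measurable_capped_mean : measurable_fun setT capped_mean.
Proof. by apply: nondecreasing_measurable => //; exact: capped_mean_nd. Qed.

End tail_of_distribution.

(** * The barrier function *)

Section barrier.
Context {R : realType}.
Variable F : probability R R.
Implicit Types (C N z : R).

(* Near [z] the barrier has slope [- C * tail F z], so that a mean increment    *)
(* [delta] of [z] lowers it by [C * delta * tail F z], which pays for the risk *)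
(* of a large jump.                                                            *)
Definition barrier C N z : R :=
  Num.max 0 (Num.min 1 (C * (capped_mean F N - capped_mean F z))).

Lemma barrier_ge0 C N z : 0 <= barrier C N z.
Proof. by rewrite le_max lexx. Qed.

Lemma barrier_le1 C N z : barrier C N z <= 1.
Proof. by rewrite ge_max ler01 ge_min lexx. Qed.

Lemma barrier_le C N z u : 0 <= u -> C * (capped_mean F N - capped_mean F z) <= u ->
  barrier C N z <= u.
Proof. by move=> u0 h; rewrite ge_max u0 ge_min h orbT. Qed.

Lemma barrier_ge C N z : C * (capped_mean F N - capped_mean F z) <= 1 ->
  C * (capped_mean F N - capped_mean F z) <= barrier C N z.
Proof. by move=> h; rewrite le_max le_min h lexx orbT. Qed.

Lemma barrier_lt1 C N z : barrier C N z < 1 ->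
  C * (capped_mean F N - capped_mean F z) < 1.
Proof. by rewrite gt_max ltr01/= gt_min ltxx. Qed.

Lemma barrier_eq1 C N z : 1 <= C * (capped_mean F N - capped_mean F z) ->
  barrier C N z = 1.
Proof. by move=> h; rewrite /barrier min_l// max_r. Qed.

Lemma barrier_eq0 C N z : 0 <= C -> N <= z -> barrier C N z = 0.
Proof.
move=> C0 Nz; apply/eqP; rewrite eq_le barrier_ge0 andbT; apply: barrier_le => //.
by rewrite mulr_ge0_le0// subr_le0 capped_mean_nd.
Qed.

Lemma measurable_barrier C N : measurable_fun setT (barrier C N).
Proof.
apply: measurable_maxr => //; apply: measurable_minr => //; apply: measurable_funM => //.
by apply: measurable_funB => //; exact: measurable_capped_mean.
Qed.

End barrier.

(** * Integration of pointwise bounds on a jump *)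

Section expectation_bounds.
Context {d : measure_display} {T : measurableType d} {R : realType}.
Variable P : probability T R.

Lemma integral_le1_fin (f : T -> R) : measurable_fun setT f ->
  (forall w, 0 <= f w <= 1) -> (\int[P]_w (f w)%:E)%E \is a fin_num.
Proof.
move=> mf f01; rewrite ge0_fin_numE; last first.
  by apply: integral_ge0 => w _; rewrite lee_fin; have /andP[] := f01 w.
apply: (@le_lt_trans _ _ (\int[P]_w 1)%E); last first.
  rewrite integral_cst//= mul1e.
  exact: le_lt_trans (probability_le1 P measurableT) (ltry _).
apply: ge0_le_integral => //.
- by move=> w _; rewrite lee_fin; have /andP[] := f01 w.
- exact/measurable_EFinP.
- by move=> w _; rewrite lee_fin; have /andP[] := f01 w.
Qed.

Lemma integralZ_real (x : R) (g : T -> R) : 0 <= x -> (forall w, 0 <= g w) ->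
  measurable_fun setT g ->
  (x%:E * \int[P]_w (g w)%:E = \int[P]_w (x * g w)%:E)%E.
Proof.
move=> x0 g0 mg; rewrite -ge0_integralZl_EFin//; first by move=> w _; rewrite lee_fin.
exact/measurable_EFinP.
Qed.

Lemma integralD_real (g h : T -> R) : (forall w, 0 <= g w) -> (forall w, 0 <= h w) ->
  measurable_fun setT g -> measurable_fun setT h ->
  (\int[P]_w (g w)%:E + \int[P]_w (h w)%:E = \int[P]_w (g w + h w)%:E)%E.
Proof.
move=> g0 h0 mg mh; rewrite -ge0_integralD//.
- by move=> w _; rewrite lee_fin.
- exact/measurable_EFinP.
- by move=> w _; rewrite lee_fin.
- exact/measurable_EFinP.
Qed.

Lemma integral_real_cst (x : R) : (\int[P]_w x%:E = x%:E)%E.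
Proof. by rewrite integral_cst//= probability_setT mule1. Qed.

Lemma le_integral_real (g h : T -> R) : (forall w, 0 <= g w) ->
  measurable_fun setT g -> measurable_fun setT h -> (forall w, g w <= h w) ->
  (\int[P]_w (g w)%:E <= \int[P]_w (h w)%:E)%E.
Proof.
move=> g0 mg mh gh; apply: ge0_le_integral => //.
- by move=> w _; rewrite lee_fin.
- exact/measurable_EFinP.
- exact/measurable_EFinP.
- by move=> w _; rewrite lee_fin.
Qed.

Variable xi : T -> R.
Hypotheses (mxi : measurable_fun setT xi) (xi0 : forall w, 0 <= xi w).

Definition exceed (s : R) : R := fine (P [set w | s < xi w]).

Lemma measurable_exceed s : measurable [set w | s < xi w].
Proof.
rewrite (_ : [set w | _] = xi @^-1` `]s, +oo[%classic).
  by rewrite -[X in measurable X]setTI; apply: mxi => //; exact: measurable_itv.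
by apply/seteqP; split => w /=; rewrite in_itv/= andbT.
Qed.

Lemma exceedE s : (exceed s)%:E = P [set w | s < xi w].
Proof. by rewrite fineK// fin_num_measure//; exact: measurable_exceed. Qed.

Lemma exceed_ge0 s : 0 <= exceed s. Proof. exact: fine_ge0. Qed.

Lemma exceed_ni s t : s <= t -> exceed t <= exceed s.
Proof.
move=> st; rewrite -lee_fin !exceedE; apply: le_measure; rewrite ?inE//;
  try exact: measurable_exceed.
by move=> w /=; exact: le_lt_trans.
Qed.

Let ind s w : R := (s < xi w)%R%:R.

Let measurable_ind s : measurable_fun setT (ind s).
Proof.
exact: measurable_lt_indicator.
Qed.

Let integral_ind s : (\int[P]_w (ind s w)%:E = (exceed s)%:E)%E.
Proof. by rewrite integral_bool ?exceedE//; exact: measurable_exceed. Qed.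

Variable m : R.
Hypothesis xi_mean : (\int[P]_w (xi w)%:E = m%:E)%E.

Definition tail_mean a : R := fine (\int[P]_w (xi w * ind a w)%:E)%E.

Let tail_mean_ind a : ((tail_mean a)%:E = \int[P]_w (xi w * ind a w)%:E)%E.
Proof.
rewrite fineK// ge0_fin_numE; last by apply: integral_ge0 => w _; rewrite lee_fin mulr_ge0.
apply: (@le_lt_trans _ _ (\int[P]_w (xi w)%:E)%E); last by rewrite xi_mean ltry.
apply: ge0_le_integral => //.
- by move=> w _; rewrite lee_fin mulr_ge0.
- by apply/measurable_EFinP; exact: measurable_funM.
- exact/measurable_EFinP.
- by move=> w _; rewrite lee_fin ler_piMr// /ind lern1 leq_b1.
Qed.

Lemma tail_meanE a :
  ((tail_mean a)%:E = \int[P]_w (xi w * (a < xi w)%R%:R)%:E)%E.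
Proof. exact: tail_mean_ind. Qed.

(** The means of xi restricted to xi <= n increase to the finite mean m. *)
Lemma tail_mean_small e : 0 < e -> \forall a \near +oo, tail_mean a <= e.
Proof.
move=> e0.
have low_cvg : (\int[P]_w (xi w * (1 - ind n%:R w))%:E @[n --> \oo] --> m%:E)%E.
  rewrite -xi_mean (_ : (fun w => (xi w)%:E) =
      (fun w => limn (fun n : nat => (xi w * (1 - ind n%:R w))%:E))).
    have i1 n w : 0 <= 1 - ind n w by rewrite subr_ge0 /ind lern1 leq_b1.
    apply: cvg_monotone_convergence => //.
    - move=> n; apply/measurable_EFinP; apply: measurable_funM => //.
      exact: measurable_funB.
    - by move=> n w _; rewrite lee_fin mulr_ge0.
    - move=> w _ n n' nn'; rewrite lee_fin ler_wpM2l// lerB// ler_nat.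
      case: ltP => // h; rewrite (le_lt_trans _ h)//.
      by rewrite ler_nat.
  apply/funext => w; apply/esym/cvg_lim => //; apply: cvg_near_cst.
  near=> n; rewrite /ind ltNge (_ : xi w <= n%:R) ?subr0 ?mulr1//.
  by near: n; exact: nbhs_infty_ger.
have [n nP] : exists n : nat, m - e <= fine (\int[P]_w (xi w * (1 - ind n%:R w))%:E)%E.
  have h : m - e < m by rewrite ltrBlDr ltrDl.
  have [n _ nP] := cvgr_ge _ (fine_cvg low_cvg) _ h.
  by exists n; exact: nP (leqnn n).
have i1 w : 0 <= 1 - ind n%:R w by rewrite subr_ge0 /ind lern1 leq_b1.
have mi : measurable_fun setT (fun w => xi w * (1 - ind n%:R w)).
  by apply: measurable_funM => //; exact: measurable_funB.
have split : (\int[P]_w (xi w * (1 - ind n%:R w))%:E + (tail_mean n%:R)%:E = m%:E)%E.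
  rewrite tail_mean_ind -ge0_integralD//.
  - rewrite -xi_mean; apply: eq_integral => w _; rewrite -EFinD; congr EFin; ring.
  - by move=> w _; rewrite lee_fin mulr_ge0.
  - exact/measurable_EFinP.
  - by move=> w _; rewrite lee_fin mulr_ge0.
  - by apply/measurable_EFinP; exact: measurable_funM.
have small : tail_mean n%:R <= e.
  have fin : (\int[P]_w (xi w * (1 - ind n%:R w))%:E)%E \is a fin_num.
    by move: split; case: (\int[P]_w _)%E.
  have : fine (\int[P]_w (xi w * (1 - ind n%:R w))%:E)%E + tail_mean n%:R = m.
    by apply/EFin_inj; rewrite EFinD fineK.
  by move: nP; lra.
apply/near_pinftyP; exists (n%:R + 1) => [|a na]; first by rewrite ltr_wpDl.
apply: le_trans small; rewrite -lee_fin !tail_mean_ind; apply: ge0_le_integral => //.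
- by move=> w _; rewrite lee_fin mulr_ge0.
- by apply/measurable_EFinP; exact: measurable_funM.
- by apply/measurable_EFinP; exact: measurable_funM.
- move=> w _; rewrite lee_fin ler_wpM2l// ler_nat; case: ltP => // aw.
  by rewrite (lt_trans _ aw)// (lt_le_trans _ na)// ltrDl.
Unshelve. all: by end_near. Qed.

(** All terms are nonnegative, and k is kept on the left, so that the pointwise bound is integrated
    without subtracting integrals. *)
Lemma expectation_bound (f : T -> R) (k A B D c a s c' s' : R) :
  measurable_fun setT f -> (forall w, 0 <= f w <= 1) ->
  0 <= k -> 0 <= A -> 0 <= B -> 0 <= D -> 0 <= c -> 0 <= c' ->
  (forall w, f w + k <= A + B * xi w + D * (xi w * (a < xi w)%R%:R) +
    c * (s < xi w)%R%:R + c' * (s' < xi w)%R%:R) ->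
  fine (\int[P]_w (f w)%:E)%E + k <=
    A + B * m + D * tail_mean a + c * exceed s + c' * exceed s'.
Proof.
move=> mf f01 k0 A0 B0 D0 c0 c'0 fle; have f0 w : 0 <= f w by have /andP[] := f01 w.
rewrite -lee_fin !EFinD fineK ?integral_le1_fin// !EFinM -xi_mean tail_mean_ind -!integral_ind.
rewrite -[k%:E](integral_real_cst k) -[A%:E](integral_real_cst A).
have ma : measurable_fun setT (fun w => (xi w * ind a w)%:E).
  by apply/measurable_EFinP; exact: measurable_funM.
have mx : measurable_fun setT (fun w => (xi w)%:E) by exact/measurable_EFinP.
have mfE : measurable_fun setT (fun w => (f w)%:E) by exact/measurable_EFinP.
have Bx0 w : (0 <= (B * xi w)%:E)%E by rewrite lee_fin mulr_ge0.
have Dx0 w : (0 <= (D * (xi w * ind a w))%:E)%E by rewrite lee_fin !mulr_ge0.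
have ci0 w : (0 <= (c * ind s w)%:E)%E by rewrite lee_fin mulr_ge0.
have zE := integralZ_real; have addE := integralD_real.
have mxa : measurable_fun setT (fun w => xi w * ind a w) by exact: measurable_funM.
have x0 w : 0 <= xi w * ind a w by rewrite mulr_ge0.
have Bm : measurable_fun setT (fun w => B * xi w) by exact: measurable_funM.
have Dm : measurable_fun setT (fun w => D * (xi w * ind a w)) by exact: measurable_funM.
have cm : measurable_fun setT (fun w => c * ind s w) by exact: measurable_funM.
have cm' : measurable_fun setT (fun w => c' * ind s' w) by exact: measurable_funM.
rewrite !zE//.
rewrite !addE//; try by [move=> w; rewrite ?addr_ge0 ?mulr_ge0|
  do ?apply: measurable_funD => //].
apply: ge0_le_integral => //.
- by move=> w _; rewrite lee_fin addr_ge0.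
- by apply/measurable_EFinP; exact: measurable_funD.
- by apply/measurable_EFinP; do ?apply: measurable_funD => //.
- by move=> w _; rewrite lee_fin.
Qed.

End expectation_bounds.

(** * Mean change of the barrier in one step of the walk *)

Section drift.
Context {d : measure_display} {T : measurableType d} {R : realType}.
Variables (F : probability R R).
Hypotheses (F_rv : regularly_varying_tail F) (F_ge0 : supported_ge0 F)
  (F_mean : (\int[F]_x x%:E < +oo)%E).
Variables (P : probability T R) (xi : T -> R) (m v delta eta q : R).
Hypotheses (mxi : measurable_fun setT xi) (xi0 : forall w, 0 <= xi w)
  (xi_mean : (\int[P]_w (xi w)%:E = m%:E)%E) (delta0 : 0 < delta) (mv : m + delta <= v)
  (eta0 : 0 < eta) (eta4 : eta <= 4^-1) (q0 : 0 <= q).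
Notation G := (tail F).
Notation g := (capped_mean F).
Hypothesis xi_tail : \forall x \near +oo, exceed P xi ((1 - eta) * x) <= q * G x.

Let m0 : 0 <= m.
Proof. by rewrite -lee_fin -xi_mean; apply: integral_ge0 => w _; rewrite lee_fin. Qed.

Let v0 : 0 <= v. Proof. by apply: le_trans mv; rewrite addr_ge0// ltW. Qed.

(** The assumption [xi_tail] is rescaled from (1 - eta) x to t x, at the price of a constant, by
    regular variation. *)
Lemma exceed_dominated t : 0 < t ->
  exists2 D, 0 < D & \forall x \near +oo, exceed P xi (t * x) <= D * G x.
Proof.
move=> t0; have e1 : 0 < 1 - eta by move: eta4; lra.
have t1 : 0 < t / (1 - eta) by exact: divr_gt0.
have [D D0 DP] := tail_dominated F_rv t1.
exists ((q + 1) * D); first by rewrite mulr_gt0// ltr_wpDl.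
near=> x; rewrite -mulrA.
apply: (@le_trans _ _ (q * G (t / (1 - eta) * x))).
  have -> : t * x = (1 - eta) * (t / (1 - eta) * x) by field; rewrite gt_eqF.
  by near: x; exact: near_scale t1 xi_tail.
apply: (@le_trans _ _ (q * (D * G x))); last first.
  by rewrite ler_wpM2r ?lerDl// mulr_ge0 ?tail_ge0// ltW.
by rewrite ler_wpM2l//; near: x.
Unshelve. all: by end_near. Qed.

(** Here y is the position of the walk and x - y its distance to the level x; a step replaces y by y
    - v + xi. *)
Let step C x y w := barrier F C ((1 - eta) * x) (x - (y - v + xi w)).

Let measurable_step C x y : measurable_fun setT (step C x y).
Proof.
apply: (measurableT_comp (measurable_barrier F C ((1 - eta) * x))).
by apply: measurable_funB => //; exact: measurable_funD.
Qed.

Let step01 C x y w : 0 <= step C x y w <= 1.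
Proof. by rewrite barrier_ge0 barrier_le1. Qed.

(** From a low position, jumps up to eta x / 2 leave the barrier at 0. A jump beyond (1 - eta) x
    costs at most 1, with probability at most q G(x). A jump in between costs at most C e, where e
    bounds an increment of [capped_mean], with probability at most D G(x); e is chosen so that C e D
    <= eta. *)
Let low_drift C : 0 <= C -> \forall x \near +oo, forall y, y <= eta / 2 * x ->
  fine (\int[P]_w (step C x y w)%:E)%E <= (q + eta) * G x.
Proof.
move=> C0; have e2 : 0 < eta / 2 by rewrite divr_gt0.
have [D D0 DP] := exceed_dominated e2.
pose e := eta / ((C + 1) * D).
have C1 : 0 < C + 1 by rewrite ltr_wpDl.
have e0 : 0 < e by rewrite divr_gt0// mulr_gt0.
have cau := near_scale e2 (capped_mean_cauchy F_ge0 F_mean e0).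
near=> x => y yx.
have x0 : 0 <= x by near: x; exact: near_ge.
pose s := C * e; have s0 : 0 <= s by rewrite mulr_ge0// ltW.
have bd w : step C x y w + 0 <= 0 + 0 * xi w + 0 * (xi w * (0 < xi w)%R%:R) +
    1 * ((1 - eta) * x < xi w)%R%:R + s * (eta / 2 * x < xi w)%R%:R.
  rewrite !mul0r !add0r addr0 mul1r.
  have [h1|h1] := ltP ((1 - eta) * x) (xi w).
    by apply: le_trans (barrier_le1 _ _ _ _) _; rewrite lerDl mulr_ge0.
  have [h2|h2] := ltP (eta / 2 * x) (xi w); last first.
    rewrite mulr0 addr0 /step barrier_eq0//.
    by move: yx h2 v0; lra.
  rewrite add0r mulr1; apply: barrier_le => //; rewrite /s ler_wpM2l//.
  have zx : eta / 2 * x <= x - (y - v + xi w) by move: yx h1 v0; lra.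
  apply: le_trans (_ : _ <= g ((1 - eta) * x) - g (eta / 2 * x)) _.
    by rewrite lerB// capped_mean_nd.
  by move: ((1 - eta) * x); near: x.
have := expectation_bound mxi xi0 xi_mean (measurable_step C x y) (step01 C x y)
  (lexx _) (lexx _) (lexx _) (lexx _) ler01 s0 bd.
rewrite !mul0r !add0r !addr0 mul1r => /le_trans; apply.
rewrite [leRHS]mulrDl lerD//; first by near: x.
apply: (@le_trans _ _ (s * (D * G x))); first by rewrite ler_wpM2l//; near: x.
rewrite mulrA ler_wpM2r ?tail_ge0// /s /e.
have -> : C * (eta / ((C + 1) * D)) * D = eta * (C / (C + 1)).
  by field; rewrite !gt_eqF.
by rewrite ler_piMr ?ltW// ltr_pdivrMr// mul1r ltrDl.
Unshelve. all: by end_near. Qed.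

(** Near the edge of the support of the barrier, a jump xi <= x / 4 goes at most xi past that edge,
    where the slope is at most C G(x / 4); a larger jump costs at most 1. *)
Let far_drift C : 0 <= C -> exists2 C2, 0 <= C2 & \forall x \near +oo, forall y,
  (1 - eta) * x - v <= x - y ->
  fine (\int[P]_w (step C x y w)%:E)%E <= C2 * G x.
Proof.
move=> C0; have q4 : 0 < 4^-1 :> R by rewrite invr_gt0.
have [D D0 DP] := exceed_dominated q4.
have [D' D'0 D'P] := tail_dominated F_rv q4.
exists (C * m * D' + D); first by rewrite addr_ge0 ?mulr_ge0// ltW.
near=> x => y yx.
have x0 : 0 <= x by near: x; exact: near_ge.
have CG : 0 <= C * G (4^-1 * x) by rewrite mulr_ge0 ?tail_ge0.
have ex : eta * x <= 4^-1 * x by rewrite ler_wpM2r.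
have bd w : step C x y w + 0 <= 0 + (C * G (4^-1 * x)) * xi w +
    0 * (xi w * (0 < xi w)%R%:R) + 1 * (4^-1 * x < xi w)%R%:R + 0 * (0 < xi w)%R%:R.
  rewrite !mul0r !add0r !addr0 mul1r.
  have [h1|h1] := ltP (4^-1 * x) (xi w).
    by apply: le_trans (barrier_le1 _ _ _ _) _; rewrite lerDr mulr_ge0.
  rewrite addr0; set z := x - (y - v + xi w).
  have z4 : 4^-1 * x <= z by move: yx h1 ex; rewrite /z mulrBl mul1r; lra.
  have zN : (1 - eta) * x - z <= xi w by move: yx; rewrite /z; lra.
  apply: barrier_le; first by rewrite mulr_ge0.
  rewrite -mulrA ler_wpM2l//.
  have [Nz|zltN] := leP ((1 - eta) * x) z.
    apply: (@le_trans _ _ 0); last by rewrite mulr_ge0 ?tail_ge0.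
    by rewrite subr_le0 capped_mean_nd.
  have zz : 0 <= z <= (1 - eta) * x.
    by rewrite (ltW zltN) andbT (le_trans _ z4)// mulr_ge0// ltW.
  have /andP[_ /le_trans] := capped_mean_diff F zz; apply.
  rewrite mulrC ler_pM ?tail_ge0 ?subr_ge0//; first by have /andP[] := zz.
  exact: tail_ni.
have := expectation_bound mxi xi0 xi_mean (measurable_step C x y) (step01 C x y)
  (lexx _) (lexx _) CG (lexx _) ler01 (lexx _) bd.
rewrite !mul0r !add0r !addr0 mul1r => /le_trans; apply.
rewrite [leRHS]mulrDl lerD//; last by near: x.
rewrite mulrAC -!mulrA ler_wpM2l// ler_wpM2l//; near: x.
exact: D'P.
Unshelve. all: by end_near. Qed.

(** Inside the support the barrier does not increase in mean. At distance z its slope is about - C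
    G(z), so the drift - delta lowers it by about C delta G(z), while a jump beyond z / 2 costs at
    most C1 G(z). *)
Let inner_drift : exists2 C0, 0 < C0 & forall C, C0 <= C -> \forall x \near +oo, forall y,
  x - y < (1 - eta) * x - v ->
  fine (\int[P]_w (step C x y w)%:E)%E <= barrier F C ((1 - eta) * x) (x - y).
Proof.
have h2 : 0 < 2^-1 :> R by rewrite invr_gt0.
have [C1 C10 C1P] := exceed_dominated h2.
have [D D0 DP] := tail_dominated F_rv h2.
have vp : 0 < v by apply: lt_le_trans mv; rewrite ltr_wpDl.
pose e := Num.min 1 (delta / (8 * v)).
have e0 : 0 < e by rewrite lt_min ltr01 divr_gt0// mulr_gt0.
have e1 : e <= 1 by rewrite ge_min lexx.
have ev : 8 * (e * v) <= delta.
  by rewrite mulrCA -ler_pdivlMr ?mulr_gt0// ge_min lexx orbT.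
have dD : 0 < delta / (8 * D) by rewrite divr_gt0// mulr_gt0.
have [a av ta] : exists2 a, v <= a & tail_mean P xi a <= delta / (8 * D).
  have [a0 a00 ha] := (near_pinftyP _).1 (tail_mean_small mxi xi0 xi_mean dD).
  exists (Num.max a0 v); first by rewrite le_max lexx orbT.
  by apply: ha; rewrite le_max lexx.
have shift := tail_shift F_rv a e0.
have shift' : \forall z \near +oo, G z <= (1 + e) * G (z + v).
  have [A A0 AP] := (near_pinftyP _).1 (tail_shift F_rv v e0).
  apply/near_pinftyP; exists A => // z Az; have := AP (z + v).
  by rewrite addrK; apply; rewrite (le_trans Az)// lerDl.
have [A A0 AP] : exists2 A, 0 < A & forall z, A <= z -> [/\ 2 * a <= z,
    G (z - a) <= (1 + e) * G z, G z <= (1 + e) * G (z + v),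
    exceed P xi (2^-1 * z) <= C1 * G z & G (2^-1 * z) <= D * G z].
  apply/near_pinftyP; near=> z; split; near: z => //; exact: near_ge.
have GA := tail_gt0 F_rv (A + 1).
exists (Num.max (2 * C1 / delta) (G (A + 1))^-1).
  by rewrite lt_max divr_gt0// mulr_gt0.
move=> C; rewrite ge_max => /andP[Cd CA].
have C0 : 0 <= C by apply: le_trans CA; rewrite invr_ge0 ltW.
near=> x => y yx.
set N := (1 - eta) * x in yx *; set z := x - y in yx *.
have NA : A + 1 <= N.
  have eta1 : 0 < 1 - eta by move: eta4; lra.
  have : (A + 1) / (1 - eta) <= x by near: x; exact: near_ge.
  by rewrite ler_pdivrMr// mulrC.
have [b1|b1] := leP 1 (barrier F C N z).
  apply: le_trans b1.
  have bd1 w : step C x y w + 0 <= 1 + 0 * xi w + 0 * (xi w * (0 < xi w)%R%:R) +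
      0 * (0 < xi w)%R%:R + 0 * (0 < xi w)%R%:R.
    by rewrite !mul0r !addr0 barrier_le1.
  have := expectation_bound mxi xi0 xi_mean (measurable_step C x y) (step01 C x y)
    (lexx _) ler01 (lexx _) (lexx _) (lexx _) (lexx _) bd1.
  by rewrite !mul0r !addr0.
have Az : A <= z.
  rewrite leNgt; apply/negP => zA; have := barrier_lt1 b1; apply/negP; rewrite -leNgt.
  apply: (@le_trans _ _ (C * (g (A + 1) - g A))); last first.
    by rewrite ler_wpM2l// lerB// capped_mean_nd// ltW.
  have AA : 0 <= A <= A + 1 by rewrite ltW//= lerDl.
  have /andP[+ _] := capped_mean_diff F AA.
  rewrite addrAC subrr add0r mul1r => h.
  apply: le_trans (ler_wpM2l C0 h).
  by rewrite -ler_pdivrMr// mul1r.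
have [az Ga Gv Ez G2] := AP z Az.
have z0 : 0 < z := lt_le_trans A0 Az.
have Gz := tail_gt0 F_rv z.
have CG : 0 <= C * G z by rewrite mulr_ge0// ltW.
have bz : barrier F C N z = C * (g N - g z).
  apply/eqP; rewrite eq_le barrier_ge ?andbT; last exact/ltW/barrier_lt1.
  by apply: barrier_le => //; rewrite mulr_ge0// subr_ge0 capped_mean_nd//; move: yx v0; lra.
(* For t < v and for v <= t <= a the tail at the new distance is within a factor 1 - e or 1 + e of
   G(z). For a < t <= z / 2 it is at most D G(z), and the small [tail_mean] of xi beyond a
   compensates for D. Beyond z / 2 the trivial bound 1 on the barrier is used. *)
have bd w : step C x y w + C * G z * v <= (barrier F C N z + C * G z * (e * v)) +
    C * G z * (1 + e) * xi w + C * G z * (2 * D) * (xi w * (a < xi w)%R%:R) +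
    1 * (2^-1 * z < xi w)%R%:R + 0 * (0 < xi w)%R%:R.
  rewrite mul0r addr0 mul1r; have xiw := xi0 w; set t := xi w in xiw *.
  have CGe : 0 <= C * G z * (e * v) by rewrite mulr_ge0// mulr_ge0// ltW.
  have CGD : 0 <= C * G z * (2 * D) by rewrite mulr_ge0// mulr_ge0// ltW.
  have CGt : C * G z * t <= C * G z * (1 + e) * t.
    by rewrite ler_wpM2r// ler_peMr// lerDl ltW.
  have [h1|h1] := ltP (2^-1 * z) t.
    have at_ : a < t by move: az h1; lra.
    have CGv : C * G z * v <= C * G z * t.
      by rewrite ler_wpM2l// (le_trans av)// ltW.
    have := barrier_le1 F C N (x - (y - v + t)); have := barrier_ge0 F C N z.
    have : 0 <= C * G z * (2 * D) * (t * (a < t)%R%:R) by rewrite mulr_ge0// mulr_ge0.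
    by rewrite /step -/N -/t (_ : true%:R = 1 :> R)//; lra.
  set z' := x - (y - v + t); have z'E : z' = z + v - t by rewrite /z' /z; ring.
  have zz' : 2^-1 * z <= z' by rewrite z'E; move: h1 v0; lra.
  have z'N : z' <= N by rewrite z'E; move: yx xiw; lra.
  have z'0 : 0 <= z' by apply: le_trans zz'; rewrite mulr_ge0// ltW.
  have stepE : step C x y w <= C * (g N - g z').
    by apply: barrier_le => //; rewrite mulr_ge0// subr_ge0 capped_mean_nd.
  suff key : g z - g z' <=
      G z * ((1 + e) * t - v + e * v + 2 * D * (t * (a < t)%R%:R)).
    have := ler_wpM2l C0 key; move: stepE; rewrite bz addr0; lra.
  have t1 : 0 <= t * (a < t)%R%:R by rewrite mulr_ge0.
  have [tv|tv] := leP v t.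
    have zz : 0 <= z' <= z by rewrite z'0/= z'E; move: tv; lra.
    have /andP[_ +] := capped_mean_diff F zz.
    have -> : z - z' = t - v by rewrite z'E; ring.
    move=> /le_trans; apply.
    have tv0 : 0 <= t - v by rewrite subr_ge0.
    have [ta'|ta'] := ltP a t.
      apply: (@le_trans _ _ ((t - v) * (D * G z))).
        by rewrite ler_wpM2l//; apply: le_trans G2; exact: tail_ni.
      rewrite mulr1 [_ * (D * _)]mulrA [leRHS]mulrC ler_wpM2r ?ltW//.
      have : 0 <= D * t by rewrite mulr_ge0// ltW.
      have : 0 <= D * v by rewrite mulr_ge0// ltW.
      have : 0 <= e * t by rewrite mulr_ge0// ltW.
      have : 0 <= e * v by rewrite mulr_ge0// ltW.
      by move: tv; nra.
    apply: (@le_trans _ _ ((t - v) * ((1 + e) * G z))).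
      rewrite ler_wpM2l//; apply: le_trans Ga; apply: tail_ni.
      by rewrite z'E; move: ta' v0; lra.
    rewrite mulrA [leRHS]mulrC ler_wpM2r ?ltW// mulr0 mulr0 addr0.
    have : 0 <= e * v by rewrite mulr_ge0// ltW.
    by move=> ?; nra.
  have zz : 0 <= z <= z' by rewrite ltW//= z'E; move: tv; lra.
  have /andP[+ _] := capped_mean_diff F zz.
  have -> : z' - z = v - t by rewrite z'E; ring.
  move=> hz.
  have Gz' : (1 - e) * G z <= G z'.
    apply: (@le_trans _ _ (G (z + v))); last first.
      by apply: tail_ni; rewrite z'E; move: xiw; lra.
    have := ler_wpM2l (_ : 0 <= 1 - e) Gv; rewrite subr_ge0 => /(_ e1).
    have := tail_ge0 F (z + v); have : 0 <= e ^+ 2 by rewrite sqr_ge0.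
    by nra.
  have h3 : (v - t) * ((1 - e) * G z) <= (v - t) * G z'.
    by rewrite ler_wpM2l// subr_ge0 ltW.
  have h4 : 0 <= G z * (e * t) by rewrite mulr_ge0 ?mulr_ge0// ltW.
  have h5 : 0 <= G z * (2 * D * (t * (a < t)%R%:R)) by rewrite !mulr_ge0// ltW.
  by move: hz h3; rewrite !mulrDr; nra.
have b0 := barrier_ge0 F C N z.
have := expectation_bound mxi xi0 xi_mean (measurable_step C x y) (step01 C x y)
  _ _ _ _ ler01 (lexx _) bd.
have CGv : 0 <= C * G z * v by rewrite mulr_ge0.
have A1 : 0 <= barrier F C N z + C * G z * (e * v).
  by rewrite addr_ge0// mulr_ge0// mulr_ge0// ltW.
have B1 : 0 <= C * G z * (1 + e) by rewrite mulr_ge0// addr_ge0// ltW.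
have D1 : 0 <= C * G z * (2 * D) by rewrite mulr_ge0// mulr_ge0// ltW.
move=> /(_ CGv A1 B1 D1); rewrite mul0r addr0 mul1r => /le_trans-h.
set E := fine _ in h *.
have tm : D * tail_mean P xi a <= delta / 8.
  rewrite mulrC -ler_pdivlMr//; apply: le_trans ta _.
  by rewrite invfM mulrA.
have hC : 2 * C1 * G z <= C * delta * G z.
  by rewrite ler_wpM2r ?(ltW Gz)// -ler_pdivrMr.
have i1 : C * G z * (2 * D) * tail_mean P xi a <= C * G z * (delta / 4).
  by rewrite -mulrA ler_wpM2l//; move: tm; lra.
have i2 : C * G z * (e * v) <= C * G z * (delta / 8).
  by rewrite ler_wpM2l//; move: ev; lra.
have i3 : C * G z * (1 + e) * m <= C * G z * (v - delta + delta / 8).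
  rewrite -mulrA ler_wpM2l//; have : e * m <= e * v.
    by rewrite ler_wpM2l ?(ltW e0)//; move: mv delta0; lra.
  by move: ev mv; lra.
have := h _ (_ : _ <= barrier F C N z + C * G z * v); rewrite lerD2r; apply.
by move: i1 i2 i3 hC Ez; rewrite !mulrDr; nra.
Unshelve. all: by end_near. Qed.

(** From a low position only the sharp constant q matters, as it enters d_i. Elsewhere any constant
    C2 will do, since few individuals are met there. *)
Lemma drift : exists2 C0, 0 < C0 & forall C, C0 <= C ->
  exists2 C2, 0 <= C2 & \forall x \near +oo, forall y,
    fine (\int[P]_w (barrier F C ((1 - eta) * x) (x - (y - v + xi w)))%:E)%E <=
    if y <= eta / 2 * x then (q + eta) * G x
    else barrier F C ((1 - eta) * x) (x - y) + C2 * G x.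
Proof.
have [C0 C00 inner] := inner_drift; exists C0 => // C CC.
have CC0 : 0 <= C by apply: le_trans CC; exact: ltW.
have [C2 C20 far] := far_drift CC0; exists C2 => //.
near=> x => y; case: ifPn => [yx|_]; first by move: y yx; near: x; exact: low_drift.
have [h|h] := leP ((1 - eta) * x - v) (x - y).
  apply: (@le_trans _ _ (C2 * G x)); last by rewrite lerDr barrier_ge0.
  by move: y h; near: x.
apply: (@le_trans _ _ (barrier F C ((1 - eta) * x) (x - y))).
  by move: y h; near: x; exact: inner.
by rewrite lerDl mulr_ge0// tail_ge0.
Unshelve. all: by end_near. Qed.

End drift.

(** * Exponential moments of one step *)

(** From exp(- y) >= 1 - y, that is, exp(y) <= 1 / (1 - y). *)
Lemma expR_sub1_le (R : realType) (y e : R) : 0 < e -> 0 <= y <= e / (1 + e) ->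
  expR y - 1 <= y * (1 + e).
Proof.
move=> e0 /andP[y0 ye]; have e1 : 0 < 1 + e by rewrite addr_gt0.
have ye1 : y * (1 + e) <= e by rewrite -ler_pdivlMr.
have y1 : 0 < 1 - y by rewrite subr_gt0; move: ye1; nra.
have h : expR y <= (1 - y)^-1.
  have -> : expR y = (expR (- y))^-1 by rewrite expRN invrK.
  by rewrite lef_pV2 ?posrE ?expR_gt0// expR_ge1Dx.
have : (1 - y)^-1 <= 1 + y * (1 + e).
  by rewrite -[leLHS]mul1r ler_pdivrMr//; nra.
by move: h; lra.
Qed.

Lemma sub1_expRN_ge (R : realType) (y e : R) : 0 <= y <= e ->
  y / (1 + e) <= 1 - expR (- y).
Proof.
move=> /andP[y0 ye]; have y1 : 0 < 1 + y by rewrite ltr_pwDl.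
have e1 : 0 < 1 + e by rewrite ltr_pwDl// (le_trans y0).
have h : expR (- y) <= (1 + y)^-1.
  by rewrite expRN lef_pV2 ?posrE ?expR_gt0// expR_ge1Dx.
apply: (@le_trans _ _ (y / (1 + y))); first by rewrite ler_wpM2l// lef_pV2 ?posrE// lerD2l.
have -> : y / (1 + y) = 1 - (1 + y)^-1 by field; rewrite gt_eqF.
by rewrite lerB.
Qed.

Section jump_tails.
Context {K : nat} {d : measure_display} {T : measurableType d} {R : realType}.
Context {P : probability T R} {F : 'I_K -> probability R R}.
Context {lambda : 'I_K -> 'I_K -> R} {i : 'I_K}.
Hypothesis lambda_ge0 : forall k j, 0 <= lambda k j.
Variable X : branching_process P F lambda i.
Notation lab := (seq ('I_K * nat)).
Implicit Types (u : lab).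

Lemma measurable_ltr_lifetime u (y : R) :
  measurable_fun setT (fun w => (y < lifetime X u w)%R%:R : R).
Proof.
exact: measurable_lt_indicator.
Qed.

Lemma lifetime_exceed u (y : R) :
  (\int[P]_w (y < lifetime X u w)%R%:R%:E = (tail (F (label_type i u)) y)%:E)%E.
Proof.
rewrite tail_measure; have m1 : measurable (`]y, +oo[%classic : set R).
  exact: measurable_itv.
rewrite -(lifetime_law X u m1) integral_bool.
  congr (P _); apply/seteqP; split => w /=; by rewrite in_itv/= andbT.
rewrite (_ : [set w | _] = lifetime X u @^-1` `]y, +oo[).
  by rewrite -[X in measurable X]setTI; apply: measurable_lifetime.
by apply/seteqP; split => w /=; rewrite in_itv/= andbT.
Qed.

(** Given the lifetime s, a Poisson number of mean lambda_j s contributes the factor exp(- s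
    lambda_j (1 - exp(- h_j))). *)
Lemma integral_discount u (theta : R) (h : 'I_K -> R) (f : R -> R) :
  measurable_fun setT f -> (forall s, 0 <= f s) ->
  (\int[P]_w (f (lifetime X u w) * expR (- jump X theta h u w))%:E =
   \int[P]_w (f (lifetime X u w) * expR (- (lifetime X u w *
     (theta + \sum_j lambda (label_type i u) j * (1 - expR (- h j))))))%:E)%E.
Proof.
move=> mf f0; pose f' s := f s * expR (- (theta * s)).
have mf' : measurable_fun setT f'.
  apply: measurable_funM => //; apply: measurableT_comp => //.
  by apply: measurableT_comp => //; exact: measurable_funM.
have f'0 s : 0 <= f' s by rewrite mulr_ge0// expR_ge0.
transitivity (\int[P]_w (f' (lifetime X u w) *
    expR (\sum_j (- h j) * (children X u j w)%:R))%:E)%E.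
  apply: eq_integral => w _; rewrite /f' /jump opprD expRD mulrA; congr (_ * expR _)%:E.
  by rewrite -sumrN; apply: eq_bigr => j _; rewrite mulNr.
rewrite laplace_offspring//; apply: eq_integral => w _.
rewrite /f' -mulrA -expRD; congr (_ * expR _)%:E.
have -> : \sum_j lambda (label_type i u) j * (expR (- h j) - 1) =
    - \sum_j lambda (label_type i u) j * (1 - expR (- h j)).
  by rewrite -sumrN; apply: eq_bigr => j _; rewrite -mulrN opprB.
by rewrite -/f'; ring.
Qed.

(** If the lifetime is at most y = (1 - e) x / W, the conditional mean of the jump is at most (1 -
    e) x, and Chernoff's bound for the Poisson offspring makes an excess over x exponentially
    unlikely. *)
Lemma jump_exceed u (v : 'I_K -> R) (e : R) : 0 < e < 1 -> (forall j, 0 <= v j) ->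
  exists2 k, 0 < k & forall x, 0 <= x ->
    exceed P (jump X 1 v u) x <= tail (F (label_type i u))
      ((1 - e) * x / (1 + \sum_j lambda (label_type i u) j * v j)) + expR (- (k * x)).
Proof.
move=> /andP[e0 e1] v0; set W := 1 + \sum_j _.
have W1 : 1 <= W by rewrite lerDl sumr_ge0// => j _; rewrite mulr_ge0.
have W0 : 0 < W by apply: lt_le_trans W1.
have e20 : 0 < e / 2 by rewrite divr_gt0.
(* With theta v_j <= y0, [expR_sub1_le] gives exp(theta v_j) - 1 <= (1 + e / 2) theta v_j; the rate
   of the bound is then positive as (1 - e) (1 + e / 2) <= 1 - e / 2. *)
pose y0 := (e / 2) / (1 + e / 2).
have y00 : 0 < y0 by rewrite divr_gt0// addr_gt0.
have sv : 0 < 1 + \sum_j v j by rewrite ltr_wpDr// sumr_ge0.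
pose theta := y0 / (1 + \sum_j v j); have t0 : 0 < theta by rewrite divr_gt0.
have tv j : 0 <= theta * v j <= y0.
  rewrite mulr_ge0 ?(ltW t0)//= /theta mulrAC ler_pdivrMr// ler_wpM2l ?(ltW y00)//.
  by rewrite (bigD1 j)//= addrCA lerDl addr_ge0// sumr_ge0.
exists (theta * (e / 2)) => [|x x0]; first exact: mulr_gt0.
pose y := (1 - e) * x / W.
pose f s : R := (s <= y)%R%:R * expR (theta * s).
have mf : measurable_fun setT f.
  apply: measurable_funM.
    have mb : measurable_fun setT (fun b : bool => b%:R : R) by [].
    by apply: (measurableT_comp mb); exact: measurable_fun_ler.
  by apply: measurableT_comp => //; exact: measurable_funM.
have f0 s : 0 <= f s by rewrite mulr_ge0// expR_ge0.
pose S := lifetime X u.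
have mS := @measurable_lifetime _ _ _ _ _ _ _ _ X u.
pose D w := f (S w) * expR (\sum_j theta * v j * (children X u j w)%:R).
have mD : measurable_fun setT D.
  apply: measurable_funM; first exact: measurableT_comp.
  apply: measurableT_comp => //; apply: measurable_sum => j; apply: measurable_funM => //.
  exact: measurable_children_real.
have D0 w : 0 <= D w by rewrite mulr_ge0// expR_ge0.
have Dint : (\int[P]_w (D w)%:E <= (expR (theta * x - theta * (e / 2) * x))%:E)%E.
  rewrite laplace_offspring//.
  apply: (@le_trans _ _ (\int[P]_w (expR (theta * x - theta * (e / 2) * x))%:E)%E).
    apply: ge0_le_integral => //.
    - by move=> w _; rewrite lee_fin mulr_ge0// expR_ge0.
    - apply/measurable_EFinP; apply: measurable_funM; first exact: measurableT_comp.
      by apply: measurableT_comp => //; exact: measurable_funM.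
    move=> w _; rewrite lee_fin /f; have S0 := lifetime_ge0 X u w.
    have [Sy|_] := leP (lifetime X u w) y; last by rewrite !mul0r expR_ge0.
    rewrite mul1r -expRD ler_expR.
    have : \sum_j lambda (label_type i u) j * (expR (theta * v j) - 1) <=
        theta * (1 + e / 2) * (W - 1).
      rewrite /W addrAC subrr add0r mulr_sumr; apply: ler_sum => j _.
      rewrite [leRHS]mulrCA ler_wpM2l// [leRHS]mulrAC.
      exact: expR_sub1_le.
    set Z := \sum_j _ => hZ.
    have hS : lifetime X u w * (theta + Z) <= y * (theta * (1 + e / 2) * W).
      have tZ : 0 <= theta + Z.
        rewrite addr_ge0 ?(ltW t0)// sumr_ge0// => j _; rewrite mulr_ge0//.
        rewrite subr_ge0 -expR0 ler_expR; have /andP[] := tv j; lra.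
      have yy : 0 <= y by apply: le_trans Sy.
      apply: (@le_trans _ _ (y * (theta + Z))); first by rewrite ler_wpM2r.
      rewrite ler_wpM2l//; have : 0 <= theta * (e / 2) by rewrite mulr_ge0// ltW.
      by move: hZ; lra.
    apply: (@le_trans _ _ (lifetime X u w * (theta + Z))).
      by rewrite le_eqVlt; apply/orP; left; apply/eqP; ring.
    apply: (le_trans hS); rewrite /y.
    have -> : (1 - e) * x / W * (theta * (1 + e / 2) * W) =
        theta * x * ((1 - e) * (1 + e / 2)) by field; rewrite gt_eqF.
    have tx : 0 <= theta * x by rewrite mulr_ge0// ltW.
    have -> : theta * x - theta * (e / 2) * x = theta * x * (1 - e / 2) by ring.
    by rewrite ler_wpM2l//; nra.
  by rewrite integral_cst//= probability_setT mule1.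
have mind z : measurable_fun setT (fun w => (z < jump X 1 v u w)%R%:R : R).
  by apply: measurable_lt_indicator => //; exact: measurable_jump.
have ex0 : 0 <= expR (- (theta * x)) by exact: expR_ge0.
rewrite -lee_fin exceedE; last exact: measurable_jump.
have -> : P [set w | x < jump X 1 v u w] = (\int[P]_w (x < jump X 1 v u w)%R%:R%:E)%E.
  by rewrite integral_bool//; exact/measurable_exceed/measurable_jump.
apply: (@le_trans _ _ (\int[P]_w ((y < S w)%R%:R%:E +
    (expR (- (theta * x)) * D w)%:E))%E).
  apply: ge0_le_integral => //.
  - exact/measurable_EFinP.
  - apply: emeasurable_funD; apply/measurable_EFinP; first exact: measurable_ltr_lifetime.
    exact: measurable_funM.
  move=> w _; rewrite -EFinD lee_fin; have [xj|_] := ltP x (jump X 1 v u w); last first.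
    by rewrite addr_ge0 ?mulr_ge0.
  rewrite /D /f -/S; have [Sy|Sy] := leP (S w) y; last first.
    by rewrite lerDl mul0r mul0r mulr0.
  rewrite add0r mul1r -!expRD -[leLHS]expR0 ler_expR.
  have -> : \sum_j theta * v j * (children X u j w)%:R =
      theta * \sum_j v j * (children X u j w)%:R.
    by rewrite mulr_sumr; apply: eq_bigr => j _; rewrite mulrA.
  rewrite -mulrDr -mulrN -mulrDr mulr_ge0 ?(ltW t0)//.
  by move: xj; rewrite /jump mul1r -/S; lra.
rewrite ge0_integralD//.
- rewrite lifetime_exceed EFinD leeD2l//.
  under eq_integral do rewrite EFinM.
  rewrite ge0_integralZl_EFin//.
  + apply: (@le_trans _ _ ((expR (- (theta * x)))%:E *
      (expR (theta * x - theta * (e / 2) * x))%:E)%E).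
      by rewrite lee_wpmul2l// lee_fin.
    by rewrite -EFinM -expRD addrA addNr add0r.
  + by move=> w _; rewrite lee_fin.
  + exact/measurable_EFinP.
- by apply/measurable_EFinP; exact: measurable_ltr_lifetime.
- by move=> w _; rewrite lee_fin mulr_ge0.
- by apply/measurable_EFinP; exact: measurable_funM.
Qed.

End jump_tails.

(** * Discounting by the walk with positive drift *)

Section discount.
Context {K : nat} {d : measure_display} {T : measurableType d} {R : realType}.
Context {P : probability T R} {F : 'I_K -> probability R R}.
Context {lambda : 'I_K -> 'I_K -> R} {mu : 'I_K -> R} {i : 'I_K}.
Hypothesis F_ge0 : forall k, supported_ge0 (F k).
Hypothesis lambda_ge0 : forall k j, 0 <= lambda k j.
Hypothesis mu_gt0 : forall k, 0 < mu k.
Hypothesis F_mean : forall k, (\int[F k]_s s%:E)%E = (mu k)^-1%:E.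
Variable X : branching_process P F lambda i.
Notation lab := (seq ('I_K * nat)).
Implicit Types (u : lab).

(** With c = t / (1 + e), exp(- t xi) <= 1 - c xi + c xi 1(xi > a) pointwise: for xi <= a by
    [sub1_expRN_ge], and beyond trivially. Taking means leaves at most 1 - c (m - e) <= 1 - h <=
    exp(- h). *)
Lemma integral_expRN_le (xi : T -> R) (m t a e h : R) : measurable_fun setT xi ->
  (forall w, 0 <= xi w) -> (\int[P]_w (xi w)%:E = m%:E)%E -> 0 < e -> 0 <= t ->
  t * a <= e -> tail_mean P xi a <= e -> h * (1 + e) <= t * (m - e) ->
  (\int[P]_w (expR (- (t * xi w)))%:E <= (expR (- h))%:E)%E.
Proof.
move=> mxi xi0 xim e0 t0 ta tma hle.
have e1 : 0 < 1 + e by rewrite addr_gt0.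
pose c := t / (1 + e); have c0 : 0 <= c by rewrite divr_ge0// ltW.
have mexp : measurable_fun setT (fun w => expR (- (t * xi w))).
  apply: measurableT_comp => //; apply: measurableT_comp => //; exact: measurable_funM.
have exp01 w : 0 <= expR (- (t * xi w)) <= 1.
  by rewrite expR_ge0/= -expR0 ler_expR oppr_le0 mulr_ge0.
have pw w : expR (- (t * xi w)) + c * xi w <= 1 + c * (xi w * (a < xi w)%R%:R).
  have [ax|xa] := ltP a (xi w).
    by rewrite mulr1 lerD2r; have /andP[] := exp01 w.
  rewrite !mulr0 addr0.
  have := @sub1_expRN_ge _ (t * xi w) e; rewrite mulr_ge0//= => /(_ _)-h1.
  have : t * xi w / (1 + e) <= 1 - expR (- (t * xi w)).
    by apply: h1; apply: le_trans ta; rewrite ler_wpM2l.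
  by rewrite /c mulrAC; lra.
have mind : measurable_fun setT (fun w => (a < xi w)%R%:R : R).
  exact: measurable_lt_indicator.
have mxa : measurable_fun setT (fun w => xi w * (a < xi w)%R%:R).
  exact: measurable_funM.
have : (\int[P]_w (expR (- (t * xi w)))%:E + (c * m)%:E <= (1 + c * tail_mean P xi a)%:E)%E.
  rewrite (EFinM c m) -xim EFinD (EFinM c (tail_mean P xi a)) (tail_meanE mxi xi0 xim).
  have xa0 w : 0 <= xi w * (a < xi w)%R%:R by rewrite mulr_ge0.
  have mcx : measurable_fun setT (fun w => c * xi w) by exact: measurable_funM.
  have mcxa : measurable_fun setT (fun w => c * (xi w * (a < xi w)%R%:R)).
    exact: measurable_funM.
  have exp0 w : 0 <= expR (- (t * xi w)) by exact: expR_ge0.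
  rewrite !integralZ_real// -[X in (_ <= X + _)%E](integral_real_cst P 1).
  rewrite !integralD_real//; try by move=> w; rewrite mulr_ge0.
  apply: le_integral_real => //.
  - by move=> w; rewrite addr_ge0// mulr_ge0.
  - exact: measurable_funD.
  - exact: measurable_funD.
have fin : (\int[P]_w (expR (- (t * xi w)))%:E)%E \is a fin_num by exact: integral_le1_fin.
rewrite -(fineK fin) -EFinD !lee_fin => h1.
apply: le_trans (expR_ge1Dx (- h)).
have : h <= c * (m - e) by rewrite /c mulrAC ler_pdivlMr.
have : c * tail_mean P xi a <= c * e by rewrite ler_wpM2l.
by move: h1; rewrite mulrBr; lra.
Qed.

(** Given a lifetime s of type k, the mean of the exponential of minus the jump, with weights theta
    and theta v, is exp(- s times this rate). *)
Definition discount_rate (theta : R) (v : 'I_K -> R) (k : 'I_K) : R :=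
  theta + \sum_j lambda k j * (1 - expR (- (theta * v j))).

(** The strict inequality says that with the weights v the walk has a positive drift for every type.
    As theta tends to 0 the discount is linear in theta to first order, so a small theta turns the
    drift into a contraction. *)
Lemma discount_weights (v : 'I_K -> R) (e : R) : 0 < e < 1 ->
  (forall k, 0 <= v k) ->
  (forall k, v k < (mu k)^-1 * (1 + \sum_j lambda k j * v j)) ->
  exists2 theta, 0 < theta & forall k,
    (1 - e) * (theta * (1 + \sum_j lambda k j * v j)) <= discount_rate theta v k /\
    forall u, label_type i u = k ->
      (\int[P]_w (expR (- jump X theta (fun j => theta * v j) u w))%:E <=
       (expR (- (theta * v k)))%:E)%E.
Proof.
move=> /andP[e0 e1] v0 vlt.
pose W k := 1 + \sum_j lambda k j * v j.
have sW k : 0 <= \sum_j lambda k j * v j by apply: sumr_ge0 => j _; rewrite mulr_ge0.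
have W1 k : 1 <= W k by rewrite lerDl.
have W0 k : 0 < W k by apply: lt_le_trans (W1 k).
pose m k := (mu k)^-1; have mW k : v k < m k * W k by exact: vlt.
(* The slack b pays for all errors: one factor 1 + b comes from the discount rate, another one and
   the loss b in the mean from [integral_expRN_le]. *)
have [b /andP[b0 be] bP] : exists2 b, 0 < b <= e & forall k, v k * (1 + b) ^+ 2 <= W k * (m k - b).
  have : \forall b \near 0^'+, forall k, b <= (m k * W k - v k) / (3 * v k + W k).
    apply: filter_forall => k; apply: nbhs_right_le.
    by rewrite divr_gt0 ?subr_gt0// ltr_wpDl// mulr_ge0.
  move=> bk; near (0 : R)^'+ => b.
  exists b.
    apply/andP; split; first by near: b; exact: nbhs_right_gt.
    by near: b; exact: nbhs_right_le.
  move=> k; have b0 : 0 < b by near: b; exact: nbhs_right_gt.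
  have be : b <= 1 by near: b; apply: nbhs_right_le.
  have : b <= (m k * W k - v k) / (3 * v k + W k) by move: k; near: b.
  rewrite ler_pdivlMr; last by rewrite ltr_wpDl// mulr_ge0.
  have : b ^+ 2 * v k <= b * v k by rewrite ler_wpM2r// expr2 ler_piMl// ltW.
  by nra.
pose u k : lab := [:: (k, 0%N)].
have b1 : 0 < 1 + b by rewrite addr_gt0.
have Smean k : (\int[P]_w (lifetime X (u k) w)%:E = (m k)%:E)%E.
  by rewrite (mean_lifetime F_ge0 F_mean).
have mS k := @measurable_lifetime _ _ _ _ _ _ _ _ X (u k).
have S0 k w := lifetime_ge0 X (u k) w.
have [a a0 aP] : exists2 a, 0 < a & forall k, tail_mean P (lifetime X (u k)) a <= b.
  have : \forall a \near +oo, forall k, tail_mean P (lifetime X (u k)) a <= b.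
    by apply: filter_forall => k; exact: (tail_mean_small (mS k) (S0 k) (Smean k) b0).
  by move=> /near_pinftyP[a a0 aP]; exists a => //; exact: aP.
have [theta t0 tP] : exists2 theta, 0 < theta & forall k, theta * v k <= b /\ theta * W k * a <= b.
  have : \forall t \near 0^'+, forall k, t <= b / (v k + 1) /\ t <= b / (W k * a).
    apply: filter_forall => k; near=> t; split; near: t; apply: nbhs_right_le.
      by rewrite divr_gt0// ltr_wpDl.
    by rewrite divr_gt0// mulr_gt0.
  move=> tk; near (0 : R)^'+ => t; exists t; first by near: t; exact: nbhs_right_gt.
  move=> k; have [t1 t2] : t <= b / (v k + 1) /\ t <= b / (W k * a) by move: k; near: t.
  have tp : 0 < t by near: t; exact: nbhs_right_gt.
  split; last by rewrite -mulrA -ler_pdivlMr// mulr_gt0.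
  move: t1; rewrite ler_pdivlMr; last by rewrite ltr_wpDl.
  by apply: le_trans; rewrite ler_pM2l// lerDl.
exists theta => // k.
have rate_ge : theta * W k / (1 + b) <= discount_rate theta v k.
  rewrite /discount_rate mulrDr mulr1 mulrDl lerD//.
    by rewrite ler_pdivrMr// ler_peMr ?(ltW t0)// lerDl ltW.
  rewrite mulr_sumr mulr_suml; apply: ler_sum => j _.
  rewrite mulrCA -mulrA ler_wpM2l//; apply: sub1_expRN_ge.
  by rewrite mulr_ge0 ?(ltW t0)//; have [] := tP j.
have rate_le : discount_rate theta v k <= theta * W k.
  rewrite /discount_rate mulrDr mulr1 lerD2l mulr_sumr; apply: ler_sum => j _.
  rewrite mulrCA ler_wpM2l//.
  by have := expR_ge1Dx (- (theta * v j)); lra.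
split.
  have tW : 0 <= theta * W k by rewrite mulr_ge0// ltW.
  apply: le_trans rate_ge; rewrite [leLHS]mulrC ler_wpM2l//.
  by rewrite -[leRHS]mul1r ler_pdivlMr//; nra.
move=> x xk.
have mexp : measurable_fun setT (fun s : R => (expR (- s))%:E).
  by apply/measurable_EFinP; exact: measurableT_comp.
have exp0 (s : R) : (0 <= (expR (- s))%:E)%E by rewrite lee_fin expR_ge0.
rewrite (@integral_jump _ _ _ _ _ _ _ _ lambda_ge0 X theta (fun j => theta * v j) x (u k)
  _ mexp exp0 xk).
have := @integral_discount _ _ _ _ _ _ _ _ lambda_ge0 X (u k) theta (fun j => theta * v j)
  (cst 1) (@measurable_cst _ _ _ _ _ _) (fun=> ler01).
under eq_integral do rewrite mul1r.
move=> ->.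
under eq_integral do rewrite mul1r mulrC.
rewrite -/(discount_rate theta v k).
have [_ tP2] := tP k.
have mb : 0 <= m k - b.
  have : 0 <= W k * (m k - b) by apply: le_trans (bP k); rewrite mulr_ge0// sqr_ge0.
  by rewrite pmulr_rge0.
have h1 : 0 <= discount_rate theta v k.
  by apply: le_trans rate_ge; rewrite divr_ge0 ?mulr_ge0// ltW.
have h2 : discount_rate theta v k * a <= b.
  by apply: le_trans tP2; rewrite ler_wpM2r// ltW.
apply: (integral_expRN_le (mS k) (S0 k) (Smean k) b0 h1 h2 (aP k)).
apply: le_trans (ler_wpM2r mb rate_ge).
by rewrite [leRHS]mulrAC ler_pdivlMr// -!mulrA ler_pM2l// -expr2; exact: bP.
Unshelve. all: by end_near. Qed.

End discount.

(** * Upper and lower bounds for the busy period *)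

Lemma measurable_integral_shift {d : measure_display} {T : measurableType d}
    {R : realType} (P : probability T R) (xi : T -> R) (phi : R -> R) :
  measurable_fun setT xi -> measurable_fun setT phi -> (forall y, 0 <= phi y) ->
  measurable_fun setT (fun y : R => \int[P]_w (phi (y + xi w))%:E)%E.
Proof.
move=> mxi mphi phi0.
pose f (z : (R * T)%type) := (phi (z.1 + xi z.2))%:E.
have mf : measurable_fun setT f.
  apply/measurable_EFinP; apply: measurableT_comp => //.
  by apply: measurable_funD => //; exact: measurableT_comp.
exact: (@measurable_fun_fubini_tonelli_F _ _ _ _ _ P f mf (fun z => phi0 _)).
Qed.

Lemma exceed_small {d : measure_display} {T : measurableType d} {R : realType}
    (P : probability T R) (xi : T -> R) (e : R) : measurable_fun setT xi -> 0 < e ->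
  \forall y \near +oo, exceed P xi y <= e.
Proof.
move=> mxi e0.
have mE n : measurable [set w | n%:R < xi w] := measurable_exceed mxi n%:R.
have cv : P [set w | n%:R < xi w] @[n --> \oo] --> P (\bigcap_n [set w | n%:R < xi w]).
  apply: nonincreasing_cvg_mu => //.
  - by rewrite -ge0_fin_numE ?fin_num_measure.
  - exact: bigcapT_measurable.
  - move=> m n mn; apply/subsetPset => w /=; apply: le_lt_trans.
    by rewrite ler_nat.
have cap0 : \bigcap_n [set w | n%:R < xi w] = set0.
  apply/seteqP; split => // w /(_ (Num.truncn (`|xi w|)).+1 I) /=.
  have /andP[_ h1] := truncn_itv (normr_ge0 (xi w)).
  move=> h2; have := lt_trans h1 h2; rewrite ltNge ler_norm.
  by [].
rewrite cap0 measure0 in cv.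
have [n _ nP] := cvgr_le _ (fine_cvg cv) _ e0.
apply/near_pinftyP; exists (n%:R + 1) => [|y ny]; first by rewrite ltr_wpDl.
apply: le_trans (nP n (leqnn n)); apply: (exceed_ni P mxi).
by apply: le_trans ny; rewrite lerDl.
Qed.

Section exploration_bound.
Context {K : nat} {d : measure_display} {T : measurableType d} {R : realType}.
Context {P : probability T R} {F : 'I_K -> probability R R}.
Context {lambda : 'I_K -> 'I_K -> R} {mu : 'I_K -> R} {i : 'I_K}.
Hypothesis F_ge0 : forall k, supported_ge0 (F k).
Hypothesis lambda_ge0 : forall k j, 0 <= lambda k j.
Hypothesis mu_gt0 : forall k, 0 < mu k.
Hypothesis F_mean : forall k, (\int[F k]_s s%:E)%E = (mu k)^-1%:E.
Notation M := (mean_offspring lambda mu).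
Hypothesis M_rho : spectral_radius M < 1.
Variable X : branching_process P F lambda i.
Notation lab := (seq ('I_K * nat)).
Implicit Types (u : lab).

Lemma measurable_walk a b n : measurable_fun setT (walk X a b n).
Proof. exact: measurable_past (@walk_past _ _ _ _ _ _ _ _ X a b n). Qed.

Lemma busy_exceedE (x : R) :
  [set w | (x%:E < busy_period X w)%E] = \bigcup_n [set w | x < work X n w].
Proof.
apply/seteqP; split => w /=.
  move=> xB; apply: contrapT => h; move: xB; apply/negP; rewrite -leNgt.
  have cv := busy_period_cvg (w := w) (X := X); rewrite -(cvg_lim _ cv)//.
  apply: lime_le; first exact: cvgP cv.
  apply: nearW => n; rewrite lee_fin leNgt; apply/negP => xn.
  by apply: h; exists n.
move=> [n _ /= xn]; apply: (@lt_le_trans _ _ (work X n w)%:E); first by rewrite lte_fin.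
have cv := busy_period_cvg (w := w) (X := X); rewrite -(cvg_lim _ cv)//.
apply: lime_ge; first exact: cvgP cv.
by exists n => // k /= nk; rewrite lee_fin; exact: work_nd.
Qed.

Let measurable_work_exceed (x : R) n : measurable [set w | x < work X n w].
Proof. exact/measurable_exceed/measurable_work. Qed.

Lemma busy_tailE (x : R) :
  ((busy_tail X x)%:E = P (\bigcup_n [set w | (x < work X n w)%R]))%E.
Proof.
rewrite /busy_tail busy_exceedE fineK// fin_num_measure//.
exact: bigcupT_measurable.
Qed.

Lemma exceed_work_le (x : R) n : exceed P (work X n) x <= busy_tail X x.
Proof.
rewrite -lee_fin busy_tailE exceedE; last exact: measurable_work.
apply: le_measure; rewrite ?inE//; first exact: bigcupT_measurable.
by move=> w wn; exists n.
Qed.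

Lemma busy_tail_le (x s : R) :
  (forall n, exceed P (work X n) x <= s) -> busy_tail X x <= s.
Proof.
move=> ns; have s0 : 0 <= s by apply: le_trans (ns 0%N); exact: exceed_ge0.
have mU : measurable (\bigcup_n [set w | x < work X n w]) by exact: bigcupT_measurable.
rewrite -lee_fin busy_tailE.
have cv : P [set w | x < work X n w] @[n --> \oo] --> P (\bigcup_n [set w | x < work X n w]).
  apply: nondecreasing_cvg_mu => // m n mn; apply/subsetPset => w /= /lt_le_trans; apply.
  exact: work_nd.
rewrite -(cvg_lim _ cv)//; apply: lime_le; first exact: cvgP cv.
by apply: nearW => n; rewrite -exceedE ?lee_fin//; exact: measurable_work.
Qed.

Let E (f : T -> R) : R := fine (\int[P]_w (f w)%:E)%E.

Let mean01 (f : T -> R) : measurable_fun setT f -> (forall w, 0 <= f w <= 1) ->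
  ((E f)%:E = \int[P]_w (f w)%:E)%E.
Proof. by move=> mf f01; rewrite fineK// integral_le1_fin. Qed.

Let alive01 u w : 0 <= alive X u w <= 1.
Proof. by rewrite /alive ler0n lern1 leq_b1. Qed.

(** * The potential argument for the upper bound *)

Section potential.
Variable v : 'I_K -> R.
Hypothesis v0 : forall j, 0 <= v j.

(* Expected number of individuals met among the first n while the walk exceeds y. *)
Definition late (y : R) (n : nat) : R := \sum_(j < n)
  if pickle_inv j is Some u
  then E (fun w => alive X u w * (y < walk X 1 v j w)%R%:R) else 0.

Variables (phi : R -> R) (A : 'I_K -> R) (B y0 : R).
Hypotheses (mphi : measurable_fun setT phi) (phi01 : forall y, 0 <= phi y <= 1).
Hypotheses (A0 : forall k, 0 <= A k) (B0 : 0 <= B).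
Hypothesis phi_drift : forall k y,
  E (fun w => phi (y - v k + jump X 1 v [:: (k, 0%N)] w)) <=
  phi y + A k + B * (y0 < y)%R%:R.

Let phi0 y : 0 <= phi y. Proof. by have /andP[] := phi01 y. Qed.

Let mjump u := @measurable_jump _ _ _ _ _ _ _ _ X 1 v u.

Let drift_label u y :
  (\int[P]_w (phi (y - v (label_type i u) + jump X 1 v u w))%:E <=
   (phi y + A (label_type i u) + B * (y0 < y)%R%:R)%:E)%E.
Proof.
set k := label_type i u.
have mq : measurable_fun setT (fun s => (phi (y - v k + s))%:E).
  by apply/measurable_EFinP; apply: measurableT_comp => //; exact: measurable_funD.
have q0 s : (0 <= (phi (y - v k + s))%:E)%E by rewrite lee_fin.
rewrite (@integral_jump _ _ _ _ _ _ _ _ lambda_ge0 X 1 v u [:: (k, 0%N)] _ mq q0 erefl).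
rewrite -mean01 ?lee_fin//; apply: measurableT_comp => //; exact: measurable_funD.
Qed.

(** If the label is not born, or the stage is void, the walk stands still. Otherwise the jump is
    independent of the past and distributed as that of [:: (k, 0)], and [phi_drift] applies at the
    current position. *)
Lemma potential_step n :
  E (fun w => phi (walk X 1 v n.+1 w)) <= E (fun w => phi (walk X 1 v n w)) +
  if pickle_inv n is Some u then A (label_type i u) * birth_prob X u +
    B * E (fun w => alive X u w * (y0 < walk X 1 v n w)%R%:R) else 0.
Proof.
case nu : (pickle_inv n) => [u|]; last first.
  rewrite addr0 le_eqVlt; apply/orP; left; apply/eqP; congr fine.
  by apply: eq_integral => w _; rewrite walkS nu addr0.
have un : choice.pickle u = n := pickle_inv_pickle nu.
set k := label_type i u.
have mW m := @measurable_walk 1 v m.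
have mphiW m : measurable_fun setT (fun w => phi (walk X 1 v m w)).
  exact: measurableT_comp.
have mal : measurable_fun setT (alive X u) by exact: measurable_alive.
have mpj : measurable_fun setT (fun w => phi (walk X 1 v n w - v k + jump X 1 v u w)).
  apply: measurableT_comp => //; apply: measurable_funD; last exact: mjump.
  by apply: measurable_funB => //; exact: mW.
have ml : measurable_fun setT (fun w => (y0 < walk X 1 v n w)%R%:R : R).
  exact: measurable_lt_indicator.
have al0 w : 0 <= alive X u w by have /andP[] := alive01 u w.
have al1 w : 0 <= 1 - alive X u w by rewrite subr_ge0; have /andP[] := alive01 u w.
have m1 : measurable_fun setT (fun w => (1 - alive X u w) * phi (walk X 1 v n w)).
  by apply: measurable_funM => //; exact: measurable_funB.
have m2 : measurable_fun setT (fun w => alive X u w *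
    phi (walk X 1 v n w - v k + jump X 1 v u w)) by exact: measurable_funM.
have m3 : measurable_fun setT (fun w => alive X u w *
    (phi (walk X 1 v n w) + A k + B * (y0 < walk X 1 v n w)%R%:R)).
  apply: measurable_funM => //; apply: measurable_funD; last exact: measurable_funM.
  exact: measurable_funD.
have m4 : measurable_fun setT (fun w => alive X u w * (y0 < walk X 1 v n w)%R%:R).
  exact: measurable_funM.
have ind0 w : 0 <= alive X u w * (y0 < walk X 1 v n w)%R%:R by rewrite mulr_ge0.
have ind1 w : 0 <= alive X u w * (y0 < walk X 1 v n w)%R%:R <= 1.
  by rewrite ind0/= mulr_ile1//; [have /andP[] := alive01 u w|rewrite lern1 leq_b1].
rewrite -lee_fin mean01//.
have -> : (\int[P]_w (phi (walk X 1 v n.+1 w))%:E = \int[P]_w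
    ((1 - alive X u w) * phi (walk X 1 v n w) +
     alive X u w * phi (walk X 1 v n w - v k + jump X 1 v u w))%:E)%E.
  apply: eq_integral => w _; rewrite walkS nu /alive; congr EFin.
  case: (born X u w); last by rewrite subr0 !mul0r mul1r !addr0.
  by rewrite subrr !mul1r mul0r add0r -/k; congr phi; ring.
rewrite -integralD_real//; last 2 first.
- by move=> w; rewrite mulr_ge0.
- by move=> w; rewrite mulr_ge0.
have mYv : measurable_fun (setT : set (g_sigma_algebraType (past_gen X n)))
    (fun w => walk X 1 v n w - v k).
  by apply: measurable_funB => //; exact: walk_past.
have un' : (n <= choice.pickle u)%N by rewrite un.
have mal' : measurable_fun (setT : set (g_sigma_algebraType (past_gen X n))) (alive X u).
  by apply: alive_past; rewrite un.
have mxi := @jump_data _ _ _ _ _ _ _ _ X 1 v u.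
rewrite (integral_step un' mal' al0 mYv mxi mphi phi0).
apply: (@le_trans _ _ (\int[P]_w ((1 - alive X u w) * phi (walk X 1 v n w))%:E +
  \int[P]_w (alive X u w *
    (phi (walk X 1 v n w) + A k + B * (y0 < walk X 1 v n w)%R%:R))%:E)%E).
  rewrite leeD2l//; apply: ge0_le_integral => //.
  - move=> w _; rewrite mule_ge0 ?lee_fin//; apply: integral_ge0 => w' _.
    by rewrite lee_fin.
  - apply: emeasurable_funM; first exact/measurable_EFinP.
    have mWv : measurable_fun setT (fun w => walk X 1 v n w - v k).
      exact: measurable_past mYv.
    exact: (measurableT_comp (measurable_integral_shift P (mjump u) mphi phi0) mWv).
  - exact/measurable_EFinP.
  - by move=> w _; rewrite EFinM lee_wpmul2l ?lee_fin//; exact: drift_label.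
have mAal : measurable_fun setT (fun w => A k * alive X u w) by exact: measurable_funM.
have mBl : measurable_fun setT (fun w => B * (alive X u w * (y0 < walk X 1 v n w)%R%:R)).
  exact: measurable_funM.
rewrite EFinD EFinD (EFinM (A k)) (EFinM B) -integral_alive !mean01//.
have q1 w : 0 <= (1 - alive X u w) * phi (walk X 1 v n w) by rewrite mulr_ge0.
have q2 w : 0 <= alive X u w *
    (phi (walk X 1 v n w) + A k + B * (y0 < walk X 1 v n w)%R%:R).
  by rewrite mulr_ge0// !addr_ge0// mulr_ge0.
have q3 w : 0 <= A k * alive X u w by rewrite mulr_ge0.
have q4 w : 0 <= B * (alive X u w * (y0 < walk X 1 v n w)%R%:R) by rewrite mulr_ge0.
have q5 w : 0 <= A k * alive X u w + B * (alive X u w * (y0 < walk X 1 v n w)%R%:R).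
  by rewrite addr_ge0.
have m5 : measurable_fun setT (fun w =>
    A k * alive X u w + B * (alive X u w * (y0 < walk X 1 v n w)%R%:R)).
  exact: measurable_funD.
rewrite !integralZ_real// !integralD_real//.
rewrite le_eqVlt; apply/orP; left; apply/eqP; apply: eq_integral => w _.
by congr EFin; ring.
Qed.

Lemma potential_bound n : E (fun w => phi (walk X 1 v n w)) <=
  phi (v i) + births X A n + B * late y0 n.
Proof.
elim: n => [|n IH].
  rewrite /births /explored big_nil /late big_ord0 mulr0 !addr0.
  rewrite -lee_fin mean01.
  - rewrite -[leRHS](integral_real_cst P); apply: le_integral_real => //.
      by apply: measurableT_comp => //; exact: measurable_walk.
    by move=> w; rewrite walk0.
  - by apply: measurableT_comp => //; exact: measurable_walk.
  - by move=> w.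
apply: le_trans (potential_step n) _.
rewrite /late big_ord_recr/= -/(late y0 n) /births exploredS big_cat/= -/(births X A n).
move: IH; case: (pickle_inv n) => [u|].
  by rewrite big_seq1 mulrDr mulrC; lra.
by rewrite big_nil !addr0.
Qed.

End potential.

(** The expected total number of individuals is finite, so those met from some stage n0 on
    contribute at most e / 2 for every y. The n0 earlier terms are probabilities that a fixed
    variable exceeds y, and are small for large y. *)
Lemma late_small (v : 'I_K -> R) (e : R) : (forall j, 0 <= v j) -> 0 < e ->
  \forall y \near +oo, forall n, late v y n <= e.
Proof.
move=> v0 e0; have e2 : 0 < e / 2 by rewrite divr_gt0.
have aux (a b c p q r : R) : a - b <= p - q -> c <= r - p -> a + c - b <= r - q by lra.
have aux' (a b p q r : R) : r - e / 2 <= q -> p <= r -> a - b <= p - q -> b <= e / 2 -> a <= e.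
  by lra.
have one0 (k : 'I_K) : 0 <= (1 : R) by [].
have cv := @births_cvg _ _ _ _ _ _ _ mu _ F_ge0 lambda_ge0 mu_gt0 F_mean M_rho X (fun=> 1).
have ble n := @births_le _ _ _ _ _ _ _ mu _ F_ge0 lambda_ge0 mu_gt0 F_mean M_rho X (fun=> 1) n one0.
have [n0 n0P] : exists n0, solve M (fun=> 1) i - e / 2 <= births X (fun=> 1) n0.
  have h : solve M (fun=> 1) i - e / 2 < solve M (fun=> 1) i by rewrite ltrBlDr ltrDl.
  have [n0 _ n0P] := cvgr_ge _ cv _ h.
  by exists n0; exact: n0P (leqnn n0).
pose term y j := if pickle_inv j is Some u
  then E (fun w => alive X u w * (y < walk X 1 v j w)%R%:R) else 0.
have mt y j u : measurable_fun setT (fun w => alive X u w * (y < walk X 1 v j w)%R%:R).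
  apply: measurable_funM; first exact: measurable_alive.
  by apply: measurable_lt_indicator => //; exact: measurable_walk.
have t01 y j u w : 0 <= alive X u w * (y < walk X 1 v j w)%R%:R <= 1.
  have /andP[a0 a1] := alive01 u w.
  by rewrite mulr_ge0//= mulr_ile1// lern1 leq_b1.
have term_birth y j :
    0 <= term y j <= births X (fun=> 1) j.+1 - births X (fun=> 1) j.
  rewrite /term /births exploredS big_cat/= addrAC subrr add0r.
  case: (pickle_inv j) => [u|]; last by rewrite big_nil lexx.
  rewrite big_seq1 mulr1 -!lee_fin mean01// integral_ge0/=; last first.
    by move=> w _; rewrite lee_fin; have /andP[] := t01 y j u w.
  rewrite -integral_alive; apply: le_integral_real => //.
  - by move=> w; have /andP[] := t01 y j u w.
  - exact: measurable_alive.
  - move=> w; have /andP[a0 a1] := alive01 u w.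
    by rewrite ler_piMr// lern1 leq_b1.
have term_small j : \forall y \near +oo, term y j <= e / 2 / n0.+1%:R.
  have en : 0 < e / 2 / n0.+1%:R by rewrite divr_gt0.
  rewrite /term; case: (pickle_inv j) => [u|]; last by apply: nearW => y; exact: ltW.
  have mW := @measurable_walk 1 v j.
  have small := exceed_small P mW en; near=> y.
  apply: (@le_trans _ _ (exceed P (walk X 1 v j) y)); last by near: y.
  rewrite -lee_fin mean01// exceedE// -integral_bool; last exact: measurable_exceed.
  apply: le_integral_real => //.
  - by move=> w; have /andP[] := t01 y j u w.
  - exact: measurable_lt_indicator.
  - by move=> w; have /andP[a0 a1] := alive01 u w; rewrite ler_piMl.
have all_small : \forall y \near +oo, forall j : 'I_n0, term y j <= e / 2 / n0.+1%:R.
  by apply: filter_forall => j; exact: term_small.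
near=> y => n.
have lateE m : late v y m = \sum_(j < m) term y j by [].
have late_nd m : late v y m <= late v y (maxn m n0).
  rewrite !lateE (big_ord_widen _ (term y) (leq_maxl m n0)) [leRHS](bigID (fun j : 'I__ => (j < m)%N))/=.
  by rewrite lerDl sumr_ge0// => j _; have /andP[] := term_birth y j.
have tail_le m : (n0 <= m)%N -> late v y m - late v y n0 <=
    births X (fun=> 1) m - births X (fun=> 1) n0.
  elim: m => [|m IH]; first by rewrite leqn0 => /eqP ->; rewrite !subrr.
  rewrite leq_eqVlt => /predU1P[->|]; first by rewrite !subrr.
  rewrite ltnS => /IH h; rewrite [X in X - _]lateE big_ord_recr/= -lateE.
  by have /andP[_ h2] := term_birth y m; exact: aux h h2.
apply: (le_trans (late_nd n)).
apply: aux' n0P (ble (maxn n n0)) (tail_le _ (leq_maxr n n0)) _.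
rewrite lateE; apply: (@le_trans _ _ (\sum_(j < n0) e / 2 / n0.+1%:R)).
  by apply: ler_sum => j _; move: j; near: y.
rewrite sumr_const card_ord -[leLHS]mulr_natr -mulrA ler_piMr ?(ltW e2)//.
by rewrite mulrC ler_pdivrMr// mul1r ler_nat.
Unshelve. all: by end_near. Qed.

Notation past n := (g_sigma_algebraType (past_gen X n)).

Let measurable_lt_data u (y : R) :
  measurable_fun (setT : set (g_sigma_algebraType (data_gen X u)))
    (fun w => (y < lifetime X u w)%R%:R : R).
Proof.
by apply: measurable_lt_indicator => //; exact: lifetime_data.
Qed.

Let alive0 u w : 0 <= alive X u w. Proof. by have /andP[] := alive01 u w. Qed.

(** * The first long lifetime and the lower bound *)

Section thresholds.
Variable y : 'I_K -> R.

Let big u w : R := (y (label_type i u) < lifetime X u w)%R%:R.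

Let big01 u w : 0 <= big u w <= 1. Proof. by rewrite /big ler0n lern1 leq_b1. Qed.

(** The product runs over all explored labels, born or not, so that it depends only on lifetimes. *)
Definition quiet (n : nat) (w : T) : R := \prod_(u <- explored n) (1 - big u w).

Let cbig01 u w : 0 <= 1 - big u w <= 1.
Proof. by have := big01 u w; lra. Qed.

Let quiet01 n w : 0 <= quiet n w <= 1.
Proof.
by rewrite /quiet; elim/big_ind: _ => [|a b|u _] //;
  [rewrite ler01 lexx|move=> /andP[a0 a1] /andP[b0 b1]; rewrite mulr_ge0// mulr_ile1].
Qed.

Lemma quiet_past n : measurable_fun (setT : set (past n)) (quiet n).
Proof.
have : forall s : seq lab, {subset s <= explored n} -> measurable_fun (setT : set (past n))
    (fun w => \prod_(u <- s) (1 - big u w)).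
  elim=> [|u s IH] su.
    by under eq_fun do rewrite big_nil; exact: measurable_cst.
  under eq_fun do rewrite big_cons.
  have un : (choice.pickle u < n)%N by rewrite -mem_explored su// mem_head.
  apply: measurable_funM; last by apply: IH => v vs; rewrite su// inE vs orbT.
  apply: measurable_funB => //; apply: (data_past un); exact: measurable_lt_data.
exact.
Qed.

Lemma quiet_ge n w : 1 - \sum_(u <- explored n) big u w <= quiet n w.
Proof.
rewrite /quiet; elim: (explored n) => [|u s IH]; first by rewrite !big_nil subr0.
rewrite !big_cons; have /andP[b0 b1] := big01 u w.
have s0 : 0 <= \sum_(v <- s) big v w by apply: sumr_ge0 => v _; have /andP[] := big01 v w.
apply: (@le_trans _ _ ((1 - big u w) * (1 - \sum_(v <- s) big v w))).
  by have := mulr_ge0 b0 s0; rewrite mulrBl mul1r mulrBr mulr1; lra.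
by rewrite ler_wpM2l// subr_ge0.
Qed.

(* These events are disjoint for distinct u, cf. [first_large_sum]. *)
Definition first_large u (w : T) : R :=
  alive X u w * quiet (choice.pickle u) w * big u w.

Let first01 u w : 0 <= first_large u w <= 1.
Proof.
have /andP[a0 a1] := alive01 u w; have /andP[b0 b1] := big01 u w.
have /andP[q0 q1] := quiet01 (choice.pickle u) w.
by rewrite !mulr_ge0//= !mulr_ile1// mulr_ge0.
Qed.

Lemma first_large_sum n w : \sum_(u <- explored n) first_large u w <= 1.
Proof.
suff : \sum_(u <- explored n) first_large u w + quiet n w <= 1.
  by have /andP[] := quiet01 n w; lra.
elim: n => [|n IH]; first by rewrite /quiet /explored !big_nil add0r.
rewrite /quiet exploredS !big_cat/= -/(quiet n w).
case nu : (pickle_inv n) => [u|]; last by rewrite !big_nil addr0 mulr1.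
have un : choice.pickle u = n := pickle_inv_pickle nu.
rewrite !big_seq1 /first_large un; apply: le_trans IH.
rewrite -addrA lerD2l mulrBr mulr1 -mulrA.
have /andP[a0 a1] := alive01 u w; have /andP[b0 b1] := big01 u w.
have /andP[q0 q1] := quiet01 n w.
have : alive X u w * (quiet n w * big u w) <= quiet n w * big u w.
  by rewrite ler_piMl// mulr_ge0.
lra.
Qed.

Lemma alive_quiet_past u : measurable_fun (setT : set (past (choice.pickle u)))
  (fun w => alive X u w * quiet (choice.pickle u) w).
Proof. by apply: measurable_funM; [exact: alive_past|exact: quiet_past]. Qed.

Let aq01 u w : 0 <= alive X u w * quiet (choice.pickle u) w <= 1.
Proof.
have /andP[a0 a1] := alive01 u w; have /andP[q0 q1] := quiet01 (choice.pickle u) w.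
by rewrite mulr_ge0//= mulr_ile1.
Qed.

Lemma first_large_past u : measurable_fun (setT : set (past (choice.pickle u).+1))
  (first_large u).
Proof.
apply: measurable_funM; first by apply: (past_mono (leqnSn _)); exact: alive_quiet_past.
by apply: (data_past (leqnn _)); exact: measurable_lt_data.
Qed.

Lemma integral_first_large u : (\int[P]_w (first_large u w)%:E =
  (E (fun w => alive X u w * quiet (choice.pickle u) w) *
   tail (F (label_type i u)) (y (label_type i u)))%:E)%E.
Proof.
rewrite (integral_past_data (leqnn _) (@alive_quiet_past u) _ (@measurable_lt_data u _)).
- rewrite lifetime_exceed EFinM mean01//.
  exact: measurable_past (@alive_quiet_past u).
- by move=> w; have /andP[] := aq01 u w.
- by move=> w.
Qed.

(** Union bound over the fewer than n + 1 lifetimes involved, each of which is long with probability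
    at most r. *)
Lemma alive_quiet_ge u (r : R) n : (choice.pickle u <= n)%N ->
  (forall k, tail (F k) (y k) <= r) ->
  birth_prob X u - n%:R * r <= E (fun w => alive X u w * quiet (choice.pickle u) w).
Proof.
move=> un hr; set m := choice.pickle u in un *.
have mal := @measurable_alive _ _ _ _ _ _ _ _ X u.
have mbig v : measurable_fun setT (big v) by exact: measurable_ltr_lifetime.
have maq : measurable_fun setT (fun w => alive X u w * quiet m w).
  exact: measurable_past (@alive_quiet_past u).
have sb0 w : 0 <= \sum_(v <- explored m) big v w.
  by apply: sumr_ge0 => v _; have /andP[] := big01 v w.
rewrite lerBlDr -lee_fin -integral_alive EFinD mean01//.
apply: (@le_trans _ _ (\int[P]_w (alive X u w * quiet m w)%:E +
    \int[P]_w (\sum_(v <- explored m) big v w)%:E)%E).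
  rewrite integralD_real//; last 2 first.
  - by move=> w; have /andP[] := aq01 u w.
  - by apply: measurable_sum.
  - apply: le_integral_real => //.
      by apply: measurable_funD => //; exact: measurable_sum.
    move=> w; have := quiet_ge m w; have /andP[a0 a1] := alive01 u w.
    have := sb0 w; have /andP[q0 q1] := quiet01 m w; nra.
rewrite leeD2l//; under eq_integral do rewrite -sumEFin.
rewrite ge0_integral_sum//.
- apply: (@le_trans _ _ (\sum_(v <- explored m) r%:E)%E).
    by apply: lee_sum => v _; rewrite lifetime_exceed lee_fin.
  rewrite sumEFin lee_fin big_const_seq count_predT iter_addr_0 -[leLHS]mulr_natl.
  have r0 : 0 <= r by apply: le_trans (hr i); exact: tail_ge0.
  rewrite ler_wpM2r// ler_nat; apply: leq_trans un.
  by rewrite size_pmap (leq_trans (count_size _ _))// size_iota.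
- by move=> v; apply/measurable_EFinP.
- by move=> v w _; rewrite lee_fin; have /andP[] := big01 v w.
Qed.

Section discounted.
Variables (theta : R) (v t : 'I_K -> R).
Hypotheses (theta0 : 0 < theta) (v0 : forall k, 0 <= v k).
Let h k := theta * v k.
Let h0 k : 0 <= h k. Proof. by rewrite mulr_ge0// ltW. Qed.
Hypothesis rate_le : forall k, t k <= discount_rate (lambda := lambda) theta v k.
Hypothesis t0 : forall k, 0 <= t k.
Hypothesis jump_discount : forall u,
  (\int[P]_w (expR (- jump X theta h u w))%:E <= (expR (- h (label_type i u)))%:E)%E.

Let Z n w := expR (- walk X theta h n w).

Let Z_past n : measurable_fun (setT : set (past n)) (Z n).
Proof.
apply: measurableT_comp => //; apply: measurableT_comp => //; exact: walk_past.
Qed.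

(** When the label is born, the discounted walk is multiplied by exp(h_k - jump), whose mean is at
    most 1 and which is independent of the past. The factor q allows restriction to an event already
    decided. *)
Lemma discounted_supermartingale n (q : T -> R) :
  measurable_fun (setT : set (past n)) q -> (forall w, 0 <= q w) ->
  (\int[P]_w (q w * expR (- walk X theta h n.+1 w))%:E <=
   \int[P]_w (q w * expR (- walk X theta h n w))%:E)%E.
Proof.
move=> mq q0; case nu : (@pickle_inv lab n) => [u|]; last first.
  rewrite le_eqVlt; apply/orP; left; apply/eqP; apply: eq_integral => w _.
  by rewrite walkS nu addr0.
have un : choice.pickle u = n := pickle_inv_pickle nu.
set k := label_type i u.
have un' : (n <= choice.pickle u)%N by rewrite un.
have mal : measurable_fun (setT : set (past n)) (alive X u) by apply: alive_past; rewrite un.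
have mqa : measurable_fun (setT : set (past n)) (fun w => q w * alive X u w * Z n w).
  by apply: measurable_funM; [exact: measurable_funM|exact: Z_past].
have mqd : measurable_fun (setT : set (past n)) (fun w => q w * (1 - alive X u w) * Z n w).
  apply: measurable_funM; last exact: Z_past.
  by apply: measurable_funM => //; exact: measurable_funB.
have mqe : measurable_fun (setT : set (past n))
    (fun w => q w * alive X u w * Z n w * expR (h k)) by exact: measurable_funM.
have mxi : measurable_fun (setT : set (g_sigma_algebraType (data_gen X u)))
    (fun w => expR (- jump X theta h u w)).
  apply: measurableT_comp => //; apply: measurableT_comp => //; exact: jump_data.
have z0 w : 0 <= Z n w by exact: expR_ge0.
have g1 w : 0 <= q w * alive X u w * Z n w by rewrite !mulr_ge0.
have g2 w : 0 <= q w * (1 - alive X u w) * Z n w.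
  by rewrite !mulr_ge0// subr_ge0; have /andP[] := alive01 u w.
have g3 w : 0 <= q w * alive X u w * Z n w * expR (h k) by rewrite mulr_ge0 ?expR_ge0.
have g4 w : 0 <= expR (- jump X theta h u w) by exact: expR_ge0.
rewrite (_ : (\int[P]_w (q w * expR (- walk X theta h n.+1 w))%:E)%E =
  (\int[P]_w (q w * (1 - alive X u w) * Z n w + q w * alive X u w * Z n w * expR (h k) *
     expR (- jump X theta h u w))%:E)%E); last first.
  apply: eq_integral => w _; congr EFin; rewrite walkS nu /alive -/k /Z.
  case: (born X u w); last by rewrite subr0 mulr0 !mul0r !mulr1 !addr0.
  rewrite subrr mulr0 mul0r add0r mul1r mulr1 -!mulrA -!expRD; congr (_ * expR _).
  by ring.
rewrite (_ : (\int[P]_w (q w * expR (- walk X theta h n w))%:E)%E =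
  (\int[P]_w (q w * (1 - alive X u w) * Z n w + q w * alive X u w * Z n w)%:E)%E); last first.
  by apply: eq_integral => w _; congr EFin; rewrite -mulrDl -mulrDr subrK mulr1.
have Mqd := measurable_past mqd; have Mqe := measurable_past mqe.
have Mqa := measurable_past mqa; have Mxi := measurable_data mxi.
rewrite -!integralD_real//; last 2 first.
- by move=> w; rewrite mulr_ge0.
- exact: measurable_funM.
rewrite leeD2l// (integral_past_data un' mqe g3 mxi g4).
apply: (@le_trans _ _ (\int[P]_w (q w * alive X u w * Z n w * expR (h k))%:E *
    (expR (- h k))%:E)%E).
  apply: lee_wpmul2l; last exact: jump_discount.
  by apply: integral_ge0 => w _; rewrite lee_fin.
rewrite muleC integralZ_real ?expR_ge0//.
rewrite le_eqVlt; apply/orP; left; apply/eqP; apply: eq_integral => w _.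
by rewrite mulrCA -expRD addNr expR0 mulr1.
Qed.

Lemma discounted_nonincreasing n m (q : T -> R) : (n <= m)%N ->
  measurable_fun (setT : set (past n)) q -> (forall w, 0 <= q w) ->
  (\int[P]_w (q w * expR (- walk X theta h m w))%:E <=
   \int[P]_w (q w * expR (- walk X theta h n w))%:E)%E.
Proof.
move=> + mq q0; elim: m => [|m IH]; first by rewrite leqn0 => /eqP ->.
rewrite leq_eqVlt => /predU1P[->//|]; rewrite ltnS => nm; apply: le_trans (IH nm).
by apply: discounted_supermartingale => //; exact: past_mono mq.
Qed.

(** Just after the long lifetime of u the walk is at least the jump of u, whose discount given a
    lifetime above y_k is at most exp(- t_k y_k); the supermartingale property carries the bound to
    stage m. *)
Lemma discounted_first_large u m : (choice.pickle u < m)%N ->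
  (\int[P]_w (first_large u w * expR (- walk X theta h m w))%:E <=
   (E (fun w => alive X u w * quiet (choice.pickle u) w) *
    (tail (F (label_type i u)) (y (label_type i u)) *
     expR (- (t (label_type i u) * y (label_type i u)))))%:E)%E.
Proof.
move=> um; set k := label_type i u; set n := choice.pickle u in um *.
have f0 w : 0 <= first_large u w by have /andP[] := first01 u w.
apply: le_trans (discounted_nonincreasing um (@first_large_past u) f0) _.
have mxi : measurable_fun (setT : set (g_sigma_algebraType (data_gen X u)))
    (fun w => big u w * expR (- jump X theta h u w)).
  apply: measurable_funM; first exact: measurable_lt_data.
  apply: measurableT_comp => //; apply: measurableT_comp => //; exact: jump_data.
have aq0 w : 0 <= alive X u w * quiet n w by have /andP[] := aq01 u w.
have xi0 w : 0 <= big u w * expR (- jump X theta h u w).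
  by rewrite mulr_ge0 ?expR_ge0//; have /andP[] := big01 u w.
apply: (@le_trans _ _ (\int[P]_w (alive X u w * quiet n w *
    (big u w * expR (- jump X theta h u w)))%:E)%E).
  apply: le_integral_real => //.
  - by move=> w; rewrite mulr_ge0// expR_ge0.
  - apply: measurable_funM; first exact: measurable_past (@first_large_past u).
    exact: measurable_past (@Z_past _).
  - apply: measurable_funM; last exact: measurable_data mxi.
    exact: measurable_past (@alive_quiet_past u).
  move=> w; rewrite /first_large -mulrA; have := aq0 w.
  rewrite /alive; case bu : (born X u w); last by rewrite !mul0r.
  rewrite mul1r => q0; rewrite !ler_wpM2l//.
  have nu : pickle_inv n = Some u by exact: pickleK_inv.
  rewrite ler_expR lerN2 walkS nu /alive bu mul1r.
  (* As u is born, the walk before its exploration is at least its weight h_k, which cancels the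
     weight subtracted in the step. *)
  have := walk_ge X theta w h0 n; rewrite nu /alive bu mul1r.
  have := mulr_ge0 (ltW theta0) (work_ge0 X n w); rewrite -/k; lra.
rewrite (integral_past_data (leqnn _) (@alive_quiet_past u) aq0 mxi xi0).
rewrite EFinM mean01//; last first.
  exact: measurable_past (@alive_quiet_past u).
apply: lee_wpmul2l; first by apply: integral_ge0 => w _; rewrite lee_fin.
pose f s : R := (y k < s)%R%:R.
have mf : measurable_fun setT f.
  exact: measurable_lt_indicator.
have fp s : 0 <= f s by rewrite ler0n.
rewrite (integral_discount lambda_ge0 X u theta h mf fp) -/k.
have mbig : measurable_fun setT (big u) by exact: measurable_ltr_lifetime.
rewrite EFinM -(lifetime_exceed X u (y k)) muleC integralZ_real ?expR_ge0//.
apply: le_integral_real.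
- by move=> w; rewrite mulr_ge0// expR_ge0.
- apply: measurable_funM => //; apply: measurableT_comp => //; apply: measurableT_comp => //.
  by apply: measurable_funM => //; exact: measurable_lifetime.
- exact: measurable_funM.
- move=> w; rewrite mulrC /big /f -/k; have [yS|] := ltP (y k) (lifetime X u w); last first.
    by rewrite !mulr0.
  rewrite !mulr1 ler_expR lerN2 mulrC; have := rate_le k; rewrite /discount_rate -/k => rk.
  apply: (@le_trans _ _ (lifetime X u w * t k)).
    by rewrite ler_wpM2r// ltW.
  by rewrite ler_wpM2l// lifetime_ge0.
Qed.

Let stack m w := walk X theta h m w - theta * work X m w.

Let stack0 m w : 0 <= stack m w.
Proof.
rewrite subr_ge0; apply: le_trans (walk_ge X theta w h0 m); rewrite lerDl.
by case: (pickle_inv m) => // u; rewrite mulr_ge0.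
Qed.

Let measurable_stack m : measurable_fun setT (stack m).
Proof.
apply: measurable_funB; first exact: measurable_walk.
by apply: measurable_funM => //; exact: measurable_work.
Qed.

(** The difference is the weight of the individuals that are born and still waiting. Its mean is h_i
    plus the mean weight of the offspring, minus that of the explored individuals; the first two
    together are at most ((I - M)^-1 h)_i by [births_ge_offspring]. The bound tends to 0 as m
    grows. *)
Lemma mean_stack m :
  (\int[P]_w (walk X theta h m w - theta * work X m w)%:E <=
   (solve M h i - births X h m)%:E)%E.
Proof.
have al w : 0 <= \sum_(u <- explored m) alive X u w * h (label_type i u).
  by apply: sumr_ge0 => u _; rewrite mulr_ge0.
have mal : measurable_fun setT
    (fun w => \sum_(u <- explored m) alive X u w * h (label_type i u)).
  by apply: measurable_sum => u; apply: measurable_funM => //; exact: measurable_alive.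
have : (\int[P]_w (stack m w)%:E + (births X h m)%:E <= (solve M h i)%:E)%E.
  rewrite -(integral_births X m h0) integralD_real//.
  have -> : (\int[P]_w (stack m w + \sum_(u <- explored m) alive X u w * h (label_type i u))%:E =
      \int[P]_w (h i + \sum_(u <- explored m) alive X u w * jump X 0 h u w)%:E)%E.
    apply: eq_integral => w _; congr EFin; rewrite /stack /walk /work mulr_sumr.
    rewrite -!addrA; congr (_ + _); rewrite addrA -sumrB -big_split/=.
    by apply: eq_bigr => u _; rewrite /jump; ring.
  have j0 w : 0 <= \sum_(u <- explored m) alive X u w * jump X 0 h u w.
    by apply: sumr_ge0 => u _; rewrite mulr_ge0 ?jump_ge0.
  have mj : measurable_fun setT (fun w => \sum_(u <- explored m) alive X u w * jump X 0 h u w).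
    apply: measurable_sum => u; apply: measurable_funM; first exact: measurable_alive.
    exact: measurable_jump.
  rewrite -integralD_real// integral_real_cst.
  rewrite (integral_sum_alive _ (c := fun u => birth_prob X u *
      \sum_j M (label_type i u) j * h j))//.
  - rewrite -EFinD lee_fin.
    apply: births_ge_offspring => // n.
    exact: (births_le F_ge0 lambda_ge0 mu_gt0 F_mean M_rho X n h0).
  - by move=> u w; exact: jump_ge0.
  - by move=> u; exact: measurable_jump.
  - move=> u; rewrite (integral_alive_jump F_ge0 lambda_ge0 F_mean)//.
    by rewrite mul0r add0r.
by rewrite -leeBrDr// EFinB.
Qed.

(** The events [first_large u] are disjoint. On such an event the work exceeds x unless the walk is
    small, which costs a relative error exp(- eps), or the waiting individuals weigh much, which
    becomes negligible as m grows with n fixed. The term n r bounds the probability of an earlier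
    long lifetime. *)
Lemma busy_tail_ge (x r eps : R) n : (forall k, tail (F k) (y k) <= r) ->
  (forall k, theta * x - t k * y k <= - eps) ->
  \sum_(u <- explored n) (birth_prob X u - n%:R * r - expR (- eps)) *
    tail (F (label_type i u)) (y (label_type i u)) <= busy_tail X x.
Proof.
move=> tail_r rate_x.
have cv : solve M h i - births X h m @[m --> \oo] --> (0 : R).
  rewrite -[X in _ --> X](subrr (solve M h i)); apply: cvgB; first exact: cvg_cst.
  exact: (@births_cvg _ _ _ _ _ _ _ mu _ F_ge0 lambda_ge0 mu_gt0 F_mean M_rho X h).
apply/ler_addgt0Pr => e e0.
have [N _ NP] := cvgr_le _ cv _ e0.
pose m := maxn n N.
have sm : (\int[P]_w (stack m w)%:E <= e%:E)%E.
  apply: le_trans (mean_stack m) _; rewrite lee_fin; exact: NP (leq_maxr n N).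
have nm : (n <= m)%N := leq_maxl n N.
pose c := expR (theta * x).
have c0 : 0 <= c by exact: expR_ge0.
pose W w : R := (x < work X m w)%R%:R.
have mwork : measurable_fun setT (work X m) by exact: measurable_work.
have mW : measurable_fun setT W.
  exact: measurable_lt_indicator.
have mfirst u : measurable_fun setT (first_large u).
  exact: measurable_past (@first_large_past u).
have mZ : measurable_fun setT (Z m) by exact: measurable_past (@Z_past m).
have f0 u w : 0 <= first_large u w by have /andP[] := first01 u w.
have fZ0 u w : 0 <= first_large u w * Z m w by rewrite mulr_ge0 ?expR_ge0.
have mfZ u : measurable_fun setT (fun w => first_large u w * Z m w).
  exact: measurable_funM.
pose Sf w := \sum_(u <- explored n) first_large u w.
pose SfZ w := \sum_(u <- explored n) first_large u w * Z m w.
have Sf0 w : 0 <= Sf w by exact: sumr_ge0.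
have SfZ0 w : 0 <= SfZ w by exact: sumr_ge0.
have mSf : measurable_fun setT Sf by exact: measurable_sum.
have mSfZ : measurable_fun setT SfZ by exact: measurable_sum.
(* If the work is at most x, then 1 - stack <= exp(theta (x - work) - stack) = c * Z, and Sf <= 1
   multiplies this inequality. *)
have pw w : Sf w <= W w + (c * SfZ w + stack m w).
  have S1 := first_large_sum n w; rewrite -/(Sf w) in S1.
  have s0 := stack0 m w; have z0 : 0 <= c * SfZ w by rewrite mulr_ge0.
  rewrite /W; have [_|wx] := ltP x (work X m w).
    by rewrite mulr1n; apply: (le_trans S1); rewrite lerDl addr_ge0.
  rewrite mulr0n add0r.
  have -> : SfZ w = Sf w * Z m w by rewrite /SfZ mulr_suml.
  have cz : 1 - stack m w <= c * Z m w.
    rewrite /c /Z -expRD; apply: le_trans (expR_ge1Dx _).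
    have : theta * work X m w <= theta * x by rewrite ler_wpM2l// ltW.
    by rewrite /stack; lra.
  have S0 := Sf0 w; have := ler_wpM2l S0 cz.
  have : Sf w * stack m w <= stack m w by rewrite ler_piMl.
  by rewrite [_ * (1 - _)]mulrBr mulr1 (mulrCA (Sf w)); lra.
have intSf : (\int[P]_w (Sf w)%:E =
    \sum_(u <- explored n) \int[P]_w (first_large u w)%:E)%E.
  under eq_integral do rewrite -sumEFin; rewrite ge0_integral_sum//.
  - by move=> u; exact/measurable_EFinP.
  - by move=> u w _; rewrite lee_fin.
have intSfZ : (\int[P]_w (SfZ w)%:E =
    \sum_(u <- explored n) \int[P]_w (first_large u w * Z m w)%:E)%E.
  under eq_integral do rewrite -sumEFin; rewrite ge0_integral_sum//.
  - by move=> u; exact/measurable_EFinP.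
  - by move=> u w _; rewrite lee_fin.
pose aq u := E (fun w => alive X u w * quiet (choice.pickle u) w).
pose tl u := tail (F (label_type i u)) (y (label_type i u)).
pose ds u := expR (- (t (label_type i u) * y (label_type i u))).
have intW : (\int[P]_w (W w)%:E <= (busy_tail X x)%:E)%E.
  rewrite integral_bool; last exact: measurable_exceed.
  by rewrite -exceedE// lee_fin; exact: exceed_work_le.
have main : \sum_(u <- explored n) aq u * tl u <=
    busy_tail X x + (c * (\sum_(u <- explored n) aq u * (tl u * ds u)) + e).
  rewrite -lee_fin !EFinD.
  have -> : (\sum_(u <- explored n) aq u * tl u)%:E = (\int[P]_w (Sf w)%:E)%E.
    by rewrite intSf -sumEFin; apply: eq_bigr => u _; rewrite integral_first_large.
  apply: (@le_trans _ _ (\int[P]_w (W w)%:E +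
      (\int[P]_w (c * SfZ w)%:E + \int[P]_w (stack m w)%:E))%E).
    have mcS : measurable_fun setT (fun w => c * SfZ w) by exact: measurable_funM.
    have cS0 w : 0 <= c * SfZ w by rewrite mulr_ge0.
    rewrite !integralD_real//.
    - apply: le_integral_real => //; apply: measurable_funD => //; exact: measurable_funD.
    - by move=> w; rewrite addr_ge0.
    - exact: measurable_funD.
  rewrite leeD// leeD// -integralZ_real// EFinM lee_wpmul2l ?lee_fin//.
  rewrite intSfZ -sumEFin big_seq [leRHS]big_seq; apply: lee_sum => u.
  rewrite mem_explored => un.
  exact: discounted_first_large (leq_trans un nm).
have : \sum_(u <- explored n) (birth_prob X u - n%:R * r - expR (- eps)) * tl u <=
    \sum_(u <- explored n) aq u * tl u - c * (\sum_(u <- explored n) aq u * (tl u * ds u)).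
  rewrite mulr_sumr -sumrB big_seq [leRHS]big_seq; apply: ler_sum => u.
  rewrite mem_explored => un.
  have -> : aq u * tl u - c * (aq u * (tl u * ds u)) = (aq u - aq u * (c * ds u)) * tl u.
    by ring.
  rewrite ler_wpM2r ?tail_ge0//.
  have aqge := alive_quiet_ge (ltnW un) tail_r; rewrite -/(aq u) in aqge.
  have [q0 q1] : 0 <= aq u /\ aq u <= 1.
    have mq : measurable_fun setT (fun w => alive X u w * quiet (choice.pickle u) w).
      exact: measurable_past (@alive_quiet_past u).
    rewrite -!lee_fin mean01//; split.
      by apply: integral_ge0 => w _; rewrite lee_fin; have /andP[] := aq01 u w.
    rewrite -[leRHS](integral_real_cst P); apply: le_integral_real => //.
    - by move=> w; have /andP[] := aq01 u w.
    - by move=> w; have /andP[] := aq01 u w.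
  have cd : c * ds u <= expR (- eps).
    by rewrite /c /ds -expRD ler_expR; exact: rate_x.
  have : aq u * (c * ds u) <= expR (- eps).
    by apply: le_trans cd; rewrite ler_piMl// mulr_ge0// expR_ge0.
  by lra.
by rewrite -/tl; move: main; lra.
Qed.
End discounted.
End thresholds.
End exploration_bound.

(** * Asymptotics of the tail of the busy period *)

Section busy_tail.
Context {K : nat} {d : measure_display} {T : measurableType d} {R : realType}.
Context {P : probability T R} {Fs : 'I_K -> probability R R}.
Context {lambda : 'I_K -> 'I_K -> R} {mu : 'I_K -> R} {i : 'I_K}.
Hypothesis Fs_ge0 : forall k, supported_ge0 (Fs k).
Hypothesis lambda_ge0 : forall k j, 0 <= lambda k j.
Hypothesis mu_gt0 : forall k, 0 < mu k.
Hypothesis Fs_mean : forall k, (\int[Fs k]_s s%:E)%E = (mu k)^-1%:E.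
Notation M := (mean_offspring lambda mu).
Hypothesis M_rho : spectral_radius M < 1.
Variable X : branching_process P Fs lambda i.
Variable F : probability R R.
Hypotheses (F_rv : regularly_varying_tail F) (F_ge0 : supported_ge0 F)
  (F_mean : (\int[F]_x x%:E < +oo)%E).
Variable c : 'I_K -> R.
Hypothesis c_ge0 : forall k, 0 <= c k.
Notation G := (tail F).

Let m k := (mu k)^-1.
Let b := solve M m.
Let beta k := \sum_j lambda k j * b j.

Hypothesis Fs_tail : forall k,
  sim_at_infty (fun x => tail (Fs k) (x / (1 + beta k))) (c k) G.

Let M_ge0 := @mean_offspring_ge0 _ _ _ _ lambda_ge0 mu_gt0.
Let m_gt0 k : 0 < m k. Proof. by rewrite invr_gt0. Qed.
Let b_ge0 k : 0 <= b k. Proof. by apply: (solve_ge0 M_ge0 M_rho) => j; exact: ltW. Qed.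
Let beta_ge0 k : 0 <= beta k.
Proof. by apply: sumr_ge0 => j _; rewrite mulr_ge0. Qed.

(** Expected total numbers of individuals. As s1 - M s1 = 1, adding delta * s1 to the weights
    changes the drift of the walk by - delta for all types at once. *)
Let s1 := solve M (fun=> 1).
Let s1_ge0 k : 0 <= s1 k. Proof. by apply: (solve_ge0 M_ge0 M_rho) => j. Qed.

Lemma offspring_sum k (v : 'I_K -> R) : \sum_j M k j * v j = m k * \sum_j lambda k j * v j.
Proof. by rewrite mulr_sumr; apply: eq_bigr => j _; rewrite mxE /m; ring. Qed.

Let bE k : b k = m k * (1 + beta k).
Proof. by rewrite /b (solveE M_rho) offspring_sum mulrDr mulr1. Qed.

Let s1E k : s1 k = 1 + m k * \sum_j lambda k j * s1 j.
Proof. by rewrite {1}/s1 (solveE M_rho) offspring_sum. Qed.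

Let class_tail_upper e : 0 < e -> exists2 t, 0 < t < 1 &
  \forall x \near +oo, forall k, tail (Fs k) (t * x / (1 + beta k)) <= (c k + e) * G x.
Proof.
move=> e0; pose Cs := \sum_k c k.
have Cs0 : 0 <= Cs by apply: sumr_ge0.
have e2 : 0 < e / 2 by rewrite divr_gt0.
pose e' := (e / 2) / (Cs + e); have e'0 : 0 < e' by rewrite divr_gt0// ltr_wpDl.
have [t /andP[t0 t1] tP] := tail_near1 F_rv e'0.
exists t; first by rewrite t0.
apply: filter_forall => k.
have lim : \forall x \near +oo, tail (Fs k) (x / (1 + beta k)) <= (c k + e / 2) * G x.
  have := @Fs_tail k; rewrite /sim_at_infty => ft.
  near=> x; rewrite -ler_pdivrMr ?tail_gt0//; near: x.
  by apply: (cvgr_le _ ft); rewrite ltrDl.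
have limt := near_scale t0 lim.
near=> x; have h1 : tail (Fs k) (t * x / (1 + beta k)) <= (c k + e / 2) * G (t * x) by near: x.
apply: (le_trans h1); have h2 : G (t * x) <= (1 + e') * G x by near: x.
apply: (@le_trans _ _ ((c k + e / 2) * ((1 + e') * G x))).
  by rewrite ler_wpM2l// addr_ge0// ltW.
rewrite mulrA ler_wpM2r ?tail_ge0//.
have ck : c k <= Cs by rewrite /Cs (bigD1 k)//= lerDl sumr_ge0.
have : (c k + e / 2) * e' <= e / 2.
  rewrite /e' mulrCA -[leRHS]mulr1 ler_wpM2l ?(ltW e2)//.
  by rewrite ler_pdivrMr ?ltr_wpDl// mul1r; lra.
by rewrite mulrDr mulr1; lra.
Unshelve. all: by end_near. Qed.

(** For small delta and eta, the factor 1 + sum of lambda_kj v_j by which a lifetime is magnified is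
    close to 1 + beta_k. The change of scale is absorbed by the t of [class_tail_upper], and the
    exponential error of [jump_exceed] by [expR_tail]. *)
Let upper_weights e : 0 < e -> exists (v : 'I_K -> R) (delta eta : R),
  [/\ forall k, 0 <= v k, 0 < delta,
    forall k, m k + \sum_j M k j * v j + delta <= v k,
    [/\ 0 < eta, eta <= 4^-1 & eta <= e] &
    \forall x \near +oo, forall k,
      exceed P (jump X 1 v [:: (k, 0%N)]) ((1 - eta) * x) <= (c k + e) * G x].
Proof.
move=> e0; have e2 : 0 < e / 2 by rewrite divr_gt0.
have [t /andP[t0 t1] tP] := class_tail_upper e2.
(* This leaves room for one factor 1 + s from the weights and two factors 1 - eta with eta <= s: t
   (1 + s) <= 1 - 2 s <= (1 - eta)^2. *)
pose s := (1 - t) / 4; have s0 : 0 < s by rewrite divr_gt0// subr_gt0.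
pose L k := \sum_j lambda k j * s1 j.
have L0 k : 0 <= L k by apply: sumr_ge0 => j _; rewrite mulr_ge0.
have SL : 0 <= \sum_k L k by exact: sumr_ge0.
pose delta := s / (1 + \sum_k L k).
have d0 : 0 < delta by rewrite divr_gt0// ltr_wpDr.
have dL k : delta * L k <= s.
  rewrite /delta mulrAC ler_pdivrMr ?ltr_wpDr// ler_wpM2l ?(ltW s0)//.
  by rewrite (bigD1 k)//= addrCA lerDl addr_ge0// sumr_ge0.
pose eta := Num.min s (Num.min 4^-1 e).
have eta0 : 0 < eta by rewrite !lt_min s0 invr_gt0 e0 ltr0n.
have etas : eta <= s by rewrite ge_min lexx.
have eta4 : eta <= 4^-1 by rewrite !ge_min lexx !orbT.
have etae : eta <= e by rewrite !ge_min lexx !orbT.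
pose v k := b k + delta * s1 k.
have v0 k : 0 <= v k by rewrite addr_ge0// mulr_ge0// ltW.
exists v, delta, eta; split => // [k|].
  rewrite offspring_sum /v bE s1E.
  under eq_bigr do rewrite mulrDr; rewrite big_split/= -/(beta k).
  have -> : \sum_j lambda k j * (delta * s1 j) = delta * L k.
    by rewrite mulr_sumr; apply: eq_bigr => j _; rewrite mulrCA.
  by rewrite le_eqVlt; apply/orP; left; apply/eqP; rewrite -/(L k); ring.
apply: filter_forall => k.
have eta01 : 0 < eta < 1 by rewrite eta0/=; move: eta4; lra.
have [kap kap0 kapP] := jump_exceed lambda_ge0 X [:: (k, 0%N)] eta01 v0.
have eta1 : 0 < 1 - eta by rewrite subr_gt0; have /andP[] := eta01.
have kap1 : 0 < kap * (1 - eta) by rewrite mulr_gt0.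
have et := expR_tail F_rv kap1 e2.
near=> x; have x0 : 0 <= x by near: x; exact: near_ge.
have := kapP ((1 - eta) * x) (mulr_ge0 (ltW eta1) x0); rewrite /= (mulrA kap) => /le_trans; apply.
have -> : (c k + e) * G x = (c k + e / 2) * G x + e / 2 * G x by field.
apply: lerD; last by near: x.
have tPx : forall k, tail (Fs k) (t * x / (1 + beta k)) <= (c k + e / 2) * G x.
  by near: x.
apply: (@le_trans _ _ (tail (Fs k) (t * x / (1 + beta k)))); last exact: tPx.
apply: tail_ni; set W := (X in _ <= _ / X).
have WE : W = 1 + beta k + delta * L k.
  rewrite /W /v; under eq_bigr do rewrite mulrDr; rewrite big_split/= -/(beta k) addrA.
  by congr (_ + _); rewrite mulr_sumr; apply: eq_bigr => j _; rewrite mulrCA.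
have b1 : 0 < 1 + beta k by rewrite ltr_wpDr.
have W0 : 0 < W by rewrite WE ltr_wpDr// mulr_ge0// ltW.
rewrite ler_pdivrMr// [leRHS]mulrAC ler_pdivlMr//.
have -> : t * x * W = t * W * x by ring.
have -> : (1 - eta) * ((1 - eta) * x) * (1 + beta k) =
  (1 - eta) * (1 - eta) * (1 + beta k) * x by ring.
rewrite ler_wpM2r//.
have Ws : W <= (1 + beta k) * (1 + s).
  by rewrite WE; have := dL k; have := mulr_ge0 (beta_ge0 k) (ltW s0); lra.
apply: (@le_trans _ _ (t * ((1 + beta k) * (1 + s)))); first by rewrite ler_wpM2l// ltW.
have -> : t * ((1 + beta k) * (1 + s)) = t * (1 + s) * (1 + beta k) by ring.
rewrite ler_wpM2r ?(ltW b1)//.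
have tE : t = 1 - 4 * s by rewrite /s; field.
apply: (@le_trans _ _ (1 - 2 * s)); first by rewrite tE; nra.
apply: (@le_trans _ _ (1 - 2 * eta)); first by lra.
by nra.
Unshelve. all: by end_near. Qed.

Lemma birthsZ (a : 'I_K -> R) z n : births X (fun k => a k * z) n = births X a n * z.
Proof. by rewrite /births mulr_suml; apply: eq_bigr => u _; rewrite mulrA. Qed.

Lemma birthsD (a a' : 'I_K -> R) n :
  births X (fun k => a k + a' k) n = births X a n + births X a' n.
Proof. by rewrite /births -big_split; apply: eq_bigr => u _; rewrite /= mulrDr. Qed.

Lemma busy_tail_upper e : 0 < e ->
  \forall x \near +oo, busy_tail X x <= (solve M c i + e) * G x.
Proof.
(* The error per individual will be e1 + eta <= 2 e1, and the expected number of individuals is at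
   most s1 i, for a total of at most e / 2. *)
move=> e0; pose e1 := e / (4 * (s1 i + 1)).
have s11 : 0 < s1 i + 1 by rewrite ltr_wpDl.
have e10 : 0 < e1 by rewrite divr_gt0// mulr_gt0.
have [v [delta [eta [v0 d0 vdrift [eta0 eta4 etae] xi_tail]]]] := upper_weights e10.
pose xi k := jump X 1 v [:: (k, 0%N)].
have mxi k : measurable_fun setT (xi k) by exact: measurable_jump.
have xi0 k w : 0 <= xi k w by exact: jump_ge0.
have xim k : (\int[P]_w (xi k w)%:E = (m k + \sum_j M k j * v j)%:E)%E.
  by rewrite (mean_jump Fs_ge0 lambda_ge0 Fs_mean)//= mul1r.
have ce0 k : 0 <= c k + e1 by rewrite addr_ge0// ltW.
have xit k : \forall x \near +oo, exceed P (xi k) ((1 - eta) * x) <= (c k + e1) * G x.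
  by apply: filterS xi_tail => x; exact.
have drift_k k := drift F_rv F_ge0 F_mean (mxi k) (xi0 k) (xim k) d0 (vdrift k) eta0 eta4
  (ce0 k) (xit k).
have [C0 C00 C0P] := fin_all_exists2 drift_k.
have G1 := tail_gt0 F_rv 1.
(* One C serves all types. The last term makes the barrier equal to 1 at every distance z <= 0,
   since g(1) - g(0) >= G 1 for g = [capped_mean F]. *)
pose C := \sum_k C0 k + (G 1)^-1.
have C0C k : C0 k <= C.
  rewrite /C (bigD1 k)//= -addrA lerDl addr_ge0 ?invr_ge0 ?tail_ge0//.
  by apply: sumr_ge0 => j _; exact: ltW.
have Cge : (G 1)^-1 <= C.
  by rewrite /C lerDr; apply: sumr_ge0 => j _; exact: ltW.
have Cp : 0 <= C by apply: le_trans Cge; rewrite invr_ge0 tail_ge0.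
have [C2 C20 C2P] := fin_all_exists2 (fun k => C0P k C (C0C k)).
pose D := \sum_k C2 k; have D0 : 0 <= D by apply: sumr_ge0 => k _; exact: C20.
pose e2 := e / (2 * (D + 1)); have e20 : 0 < e2 by rewrite divr_gt0// mulr_gt0// ltr_wpDl.
have eta2 : 0 < eta / 2 by rewrite divr_gt0.
have lat := near_scale eta2 (late_small Fs_ge0 lambda_ge0 mu_gt0 Fs_mean M_rho X v0 e20).
have dr : \forall x \near +oo, forall k y,
    fine (\int[P]_w (barrier F C ((1 - eta) * x) (x - (y - v k + xi k w)))%:E)%E <=
    if y <= eta / 2 * x then (c k + e1 + eta) * G x
    else barrier F C ((1 - eta) * x) (x - y) + C2 k * G x.
  by apply: filter_forall => k; exact: C2P.
near=> x.
have x0 : 0 <= x by near: x; exact: near_ge.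
have N1 : 1 <= (1 - eta) * x.
  have eta1 : 0 < 1 - eta by move: eta4; lra.
  by rewrite mulrC -ler_pdivrMr//; near: x; exact: near_ge.
have vx : (1 - eta) * x <= x - v i.
  have : v i / eta <= x by near: x; exact: near_ge.
  by rewrite ler_pdivrMr//; lra.
pose phi y := barrier F C ((1 - eta) * x) (x - y).
have mphi : measurable_fun setT phi.
  by apply: (measurableT_comp (measurable_barrier F C _)); exact: measurable_funB.
have phi01 y : 0 <= phi y <= 1 by rewrite barrier_ge0 barrier_le1.
pose A k := (c k + (e1 + eta)) * G x.
have A0 k : 0 <= A k by rewrite mulr_ge0 ?tail_ge0// !addr_ge0// ltW.
have B0 : 0 <= D * G x by rewrite mulr_ge0// tail_ge0.
have phi_drift k y :
    fine (\int[P]_w (phi (y - v k + jump X 1 v [:: (k, 0%N)] w))%:E)%E <=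
    phi y + A k + D * G x * (eta / 2 * x < y)%R%:R.
  have C2D : C2 k * G x <= D * G x.
    rewrite ler_wpM2r ?tail_ge0// /D (bigD1 k)//= lerDl.
    by apply: sumr_ge0 => j _; exact: C20.
  have := A0 k; have /andP[p0 _] := phi01 y.
  have : fine (\int[P]_w (phi (y - v k + jump X 1 v [:: (k, 0%N)] w))%:E)%E <=
      if y <= eta / 2 * x then (c k + e1 + eta) * G x else phi y + C2 k * G x.
    have drx : forall k y,
        fine (\int[P]_w (barrier F C ((1 - eta) * x) (x - (y - v k + xi k w)))%:E)%E <=
        if y <= eta / 2 * x then (c k + e1 + eta) * G x
        else barrier F C ((1 - eta) * x) (x - y) + C2 k * G x by near: x.
    exact: drx.
  case: (leP y (eta / 2 * x)) => _; rewrite ?mulr1 ?mulr0 /A addrA; lra.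
apply: busy_tail_le => n.
have pot := potential_bound lambda_ge0 mphi phi01 A0 B0 phi_drift n.
have mphiW : measurable_fun setT (fun w => phi (walk X 1 v n w)).
  by apply: measurableT_comp => //; exact: measurable_walk.
apply: (@le_trans _ _ (fine (\int[P]_w (phi (walk X 1 v n w))%:E)%E)).
  have mw : measurable_fun setT (work X n) by exact: measurable_work.
  rewrite -lee_fin exceedE// fineK; last by apply: integral_le1_fin.
  rewrite -integral_bool; last exact: measurable_exceed.
  apply: le_integral_real => //.
    exact: measurable_lt_indicator.
  move=> w; have [xw|_] := ltP x (work X n w); last exact: barrier_ge0.
  rewrite /phi barrier_eq1//.
  have Wx : x - walk X 1 v n w <= 0.
    have := walk_ge X 1 w v0 n; rewrite mul1r => h; rewrite subr_le0.
    apply: le_trans h; rewrite (le_trans (ltW xw))// lerDl.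
    by case: (pickle_inv n) => // u; rewrite mulr_ge0.
  have g1 : capped_mean F 1 <= capped_mean F ((1 - eta) * x) by exact: capped_mean_nd.
  have g0 : capped_mean F (x - walk X 1 v n w) <= capped_mean F 0 by exact: capped_mean_nd.
  have zz1 : 0 <= (0 : R) <= 1 by rewrite lexx ler01.
  have /andP[+ _] := capped_mean_diff F zz1; rewrite subr0 mul1r => h.
  apply: (@le_trans _ _ (C * G 1)); first by rewrite -ler_pdivrMr// mul1r.
  by rewrite ler_wpM2l//; lra.
apply: (le_trans pot).
(* The walk starts at v_i, and x - v_i is already beyond the support of the barrier. *)
have -> : phi (v i) = 0 by rewrite /phi barrier_eq0.
have -> : births X A n = (births X c n + (e1 + eta) * births X (fun=> 1) n) * G x.
  rewrite birthsZ birthsD; congr ((_ + _) * _).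
  by rewrite -[RHS]mulrC -birthsZ; congr (births X _ n); apply/funext => k; rewrite mul1r.
have bc := births_le Fs_ge0 lambda_ge0 mu_gt0 Fs_mean M_rho X n c_ge0.
have b1 := births_le Fs_ge0 lambda_ge0 mu_gt0 Fs_mean M_rho X n
  (fun _ : 'I_K => ler01 : 0 <= (1 : R)).
rewrite -/s1 in b1.
have lt : late X v (eta / 2 * x) n <= e2.
  have latx : forall n, late X v (eta / 2 * x) n <= e2 by near: x.
  exact: latx.
rewrite add0r (mulrAC D) -mulrDl ler_wpM2r ?tail_ge0//.
have h1 : D * late X v (eta / 2 * x) n <= e / 2.
  apply: (@le_trans _ _ (D * e2)); first by rewrite ler_wpM2l.
  have -> : D * e2 = e / 2 * (D / (D + 1)).
    by rewrite /e2; field; rewrite gt_eqF// ltr_wpDl.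
  have D1 : 0 < D + 1 by rewrite ltr_wpDl.
  rewrite -[leRHS]mulr1 ler_wpM2l ?divr_ge0 ?(ltW e0)//.
  by rewrite ler_pdivrMr// mul1r lerDl.
have h2 : (e1 + eta) * births X (fun=> 1) n <= e / 2.
  apply: (@le_trans _ _ ((e1 + e1) * s1 i)).
    apply: (@le_trans _ _ ((e1 + eta) * s1 i)).
      by rewrite ler_wpM2l// addr_ge0// ltW.
    by rewrite ler_wpM2r// lerD2l.
  have -> : (e1 + e1) * s1 i = e / 2 * (s1 i / (s1 i + 1)).
    by rewrite /e1; field; rewrite gt_eqF.
  rewrite -[leRHS]mulr1 ler_wpM2l ?divr_ge0 ?(ltW e0)//.
  by rewrite ler_pdivrMr// mul1r lerDl.
by move: h1 h2 bc; lra.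
Unshelve. all: by end_near. Qed.

Let class_tail_lower e : 0 < e -> exists2 t, 0 < t < 1 &
  \forall x \near +oo, forall k, (c k - e) * G x <= tail (Fs k) (x / t / (1 + beta k)).
Proof.
move=> e0; pose Cs := \sum_k c k.
have Cs0 : 0 <= Cs by apply: sumr_ge0.
have e2 : 0 < e / 2 by rewrite divr_gt0.
pose e' := (e / 2) / (Cs + e); have e'0 : 0 < e' by rewrite divr_gt0// ltr_wpDl.
have [t /andP[t0 t1] tP] := tail_near1 F_rv e'0.
exists t; first by rewrite t0.
have ti : 0 < t^-1 by rewrite invr_gt0.
apply: filter_forall => k.
have lim : \forall x \near +oo, (c k - e / 2) * G x <= tail (Fs k) (x / (1 + beta k)).
  have := @Fs_tail k; rewrite /sim_at_infty => ft.
  near=> x; rewrite -ler_pdivlMr ?tail_gt0//; near: x.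
  by apply: (cvgr_ge _ ft); rewrite ltrBlDr ltrDl.
have [ce|ce] := leP (c k) e.
  by near=> x; apply: (@le_trans _ _ 0); rewrite ?tail_ge0// mulr_le0_ge0 ?subr_le0 ?tail_ge0.
have limt := near_scale ti lim; have tPt := near_scale ti tP.
near=> x; rewrite [x / t]mulrC.
apply: (@le_trans _ _ ((c k - e / 2) * G (t^-1 * x))); last by near: x.
have h2 : G (t * (t^-1 * x)) <= (1 + e') * G (t^-1 * x) by near: x.
rewrite mulrA mulfV ?gt_eqF// mul1r in h2.
have ck : c k <= Cs by rewrite /Cs (bigD1 k)//= lerDl sumr_ge0.
apply: (@le_trans _ _ ((c k - e) * ((1 + e') * G (t^-1 * x)))).
  by rewrite ler_wpM2l// subr_ge0 ltW.
rewrite mulrA ler_wpM2r ?tail_ge0//.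
have : (c k - e) * e' <= e / 2.
  rewrite /e' mulrCA -[leRHS]mulr1 ler_wpM2l ?(ltW e2)//.
  by rewrite ler_pdivrMr ?ltr_wpDl// mul1r; lra.
by rewrite mulrDr mulr1; lra.
Unshelve. all: by end_near. Qed.

Let class_tail_small e : 0 < e -> \forall x \near +oo, forall k, tail (Fs k) (x / (1 + beta k)) <= e.
Proof.
move=> e0; apply: filter_forall => k.
have b1 : 0 < (1 + beta k)^-1 by rewrite invr_gt0 ltr_wpDr.
pose u : seq ('I_K * nat) := [:: (k, 0%N)].
have mS := @measurable_lifetime _ _ _ _ _ _ _ _ X u.
have tE z : exceed P (lifetime X u) z = tail (Fs k) z.
  by rewrite /exceed -integral_bool ?lifetime_exceed//; exact: measurable_exceed.
have small := exceed_small P mS e0.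
have h := near_scale b1 small; near=> x.
by rewrite -tE mulrC; near: x.
Unshelve. all: by end_near. Qed.

(** The weights b - delta * s1 give the walk the drift + delta, and lifetimes above y_k, slightly
    more than x / (1 + beta_k), carry the work beyond x. The stage n is fixed before x, so that the
    n first labels account for nearly all of d_i and the errors they cause vanish as x grows. *)
Lemma busy_tail_lower e : 0 < e ->
  \forall x \near +oo, (solve M c i - e) * G x <= busy_tail X x.
Proof.
move=> e0.
have aux (p q a a' : R) : p - e / 4 <= q -> a <= e / 4 -> a' <= e / 4 -> p - e <= q - a - a'.
  by lra.
have s11 : 0 < s1 i + 1 by rewrite ltr_wpDl.
pose e1 := e / (4 * (s1 i + 1)).
have e10 : 0 < e1 by rewrite divr_gt0// mulr_gt0.
have [tau /andP[tau0 tau1] tauP] := class_tail_lower e10.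
pose s := (1 - tau) / 4; have s0 : 0 < s by rewrite divr_gt0// subr_gt0.
have tauE : tau = 1 - 4 * s by rewrite /s; field.
pose L k := \sum_j lambda k j * s1 j.
have L0 k : 0 <= L k by apply: sumr_ge0 => j _; rewrite mulr_ge0.
have b0 k : 0 < b k by rewrite bE mulr_gt0// ltr_wpDr.
have [delta d0 dP] : exists2 delta, 0 < delta &
    forall k, delta * L k <= s /\ delta * s1 k <= b k.
  have : \forall z \near 0^'+, forall k, z <= s / (L k + 1) /\ z <= b k / (s1 k + 1).
    apply: filter_forall => k; near=> z; split; near: z; apply: nbhs_right_le.
      by rewrite divr_gt0// ltr_wpDl.
    by rewrite divr_gt0// ltr_wpDl.
  move=> zk; near (0 : R)^'+ => z; have z0 : 0 < z by near: z; exact: nbhs_right_gt.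
  exists z => // k.
  have [z1 z2] : z <= s / (L k + 1) /\ z <= b k / (s1 k + 1) by move: k; near: z.
  move: z1 z2; rewrite !ler_pdivlMr ?ltr_wpDl// !mulrDr mulr1; lra.
pose v k := b k - delta * s1 k.
have v0 k : 0 <= v k by rewrite subr_ge0; have [] := dP k.
pose W k := 1 + \sum_j lambda k j * v j.
have WE k : W k = 1 + beta k - delta * L k.
  rewrite /W /v; under eq_bigr do rewrite mulrBr; rewrite sumrB -/(beta k) addrA.
  by congr (_ - _); rewrite mulr_sumr; apply: eq_bigr => j _; rewrite mulrCA.
have vlt k : v k < m k * W k.
  rewrite WE mulrBr -bE /v ltrD2l ltrN2 s1E -/(L k) mulrDr mulr1 mulrCA.
  by rewrite ltrDr.
have s01 : 0 < s < 1 by rewrite s0/= /s; move: tau0; lra.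
have s1' : 0 < 1 - s by have /andP[] := s01; lra.
have [theta t0 tP] := discount_weights Fs_ge0 lambda_ge0 Fs_mean X s01 v0 vlt.
pose t k := (1 - s) * (theta * W k).
have Wge k : (1 - s) * (1 + beta k) <= W k.
  by rewrite WE; have [h _] := dP k; have := mulr_ge0 (ltW s0) (beta_ge0 k); lra.
have W0 k : 0 <= W k by apply: le_trans (Wge k); rewrite mulr_ge0 ?(ltW s1')// addr_ge0.
have tt0 k : 0 <= t k by rewrite mulr_ge0 ?(ltW s1')// mulr_ge0// ltW.
pose y x k := x / tau / (1 + beta k).
have ti : 0 < tau^-1 by rewrite invr_gt0.
have lower n x r eps := @busy_tail_ge _ _ _ _ _ _ _ mu _ Fs_ge0 lambda_ge0 mu_gt0 Fs_mean M_rho X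
  (y x) theta v t t0 v0 (fun k => (tP k).1) tt0 (fun u => (tP _).2 u erefl) x r eps n.
have cv := @births_cvg _ _ _ _ _ _ _ mu _ Fs_ge0 lambda_ge0 mu_gt0 Fs_mean M_rho X c.
have e4 : 0 < e / 4 by rewrite divr_gt0.
have [n nP] : exists n, solve M c i - e / 4 <= births X c n.
  have h : solve M c i - e / 4 < solve M c i by rewrite ltrBlDr ltrDl.
  by have [n _ nP] := cvgr_ge _ cv _ h; exists n; exact: nP (leqnn n).
pose C := \sum_k c k + 1; have C0 : 0 < C by rewrite ltr_wpDl// sumr_ge0.
have cC k : c k + 1 <= C by rewrite lerD2r (bigD1 k)//= lerDl sumr_ge0.
have [t1 /andP[t10 t11] t1P] := class_tail_upper (ltr01 : 0 < (1 : R)).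
(* At most n labels each lose (n r + r) C G(x), because r will bound both the tails at y_k and exp(-
   theta s x); the sum is at most (e / 4) G(x). *)
pose r := e / 4 / (C * (n%:R + 1) ^+ 2).
have n1 : 0 < n%:R + 1 :> R by rewrite ltr_wpDl.
have r0 : 0 < r by rewrite divr_gt0// mulr_gt0// exprn_gt0.
have small := near_scale ti (class_tail_small r0).
have ts : 0 < theta * s by rewrite mulr_gt0.
have esmall := expR_tail F_rv ts r0.
near=> x.
have x0 : 0 <= x by near: x; exact: near_ge.
have tr k : tail (Fs k) (y x k) <= r.
  have h : forall k, tail (Fs k) (tau^-1 * x / (1 + beta k)) <= r by near: x.
  by rewrite /y [x / tau]mulrC; exact: h.
(* It amounts to (1 - s) W_k >= (1 + s) tau (1 + beta_k), which holds as W_k >= (1 - s) (1 + beta_k)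
   and tau = 1 - 4 s. *)
have rate k : theta * x - t k * y x k <= - (theta * s * x).
  have b1 : 0 < 1 + beta k by rewrite ltr_wpDr.
  rewrite lerBlDr -lerBlDl opprK.
  have -> : t k * y x k = theta * x * ((1 - s) * W k / (tau * (1 + beta k))).
    by rewrite /t /y; field; rewrite !gt_eqF.
  have -> : theta * x + theta * s * x = theta * x * (1 + s) by ring.
  rewrite ler_wpM2l ?mulr_ge0 ?(ltW t0)// ler_pdivlMr ?mulr_gt0//.
  apply: (@le_trans _ _ ((1 - s) * ((1 - s) * (1 + beta k)))).
    by rewrite !mulrA ler_wpM2r ?(ltW b1)// tauE; nra.
  by rewrite ler_wpM2l// ltW.
have := lower n x r _ tr rate; apply: le_trans.
have ex : expR (- (theta * s * x)) <= r.
  have h : expR (- (theta * s * x)) <= r * G x by near: x.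
  by apply: (le_trans h); rewrite ler_piMr ?tail_le1// ltW.
have up k : tail (Fs k) (y x k) <= C * G x.
  have h : forall k, tail (Fs k) (t1 * x / (1 + beta k)) <= (c k + 1) * G x by near: x.
  have b1 : 0 < 1 + beta k by rewrite ltr_wpDr.
  apply: le_trans (le_trans (tail_ni _ _) (h k)) _.
    rewrite /y ler_wpM2r ?invr_ge0 ?(ltW b1)//.
    rewrite [x / tau]mulrC ler_wpM2r// (@le_trans _ _ 1)// ?(ltW t11)//.
    by rewrite invf_ge1// ltW.
  by rewrite ler_wpM2r ?tail_ge0.
have lo k : (c k - e1) * G x <= tail (Fs k) (y x k) by move: k; near: x.
apply: (@le_trans _ _ (\sum_(u <- explored n)
    (birth_prob X u * c (label_type i u) - birth_prob X u * e1 - (n%:R + 1) * r * C) * G x)).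
  rewrite -mulr_suml ler_wpM2r ?tail_ge0// !sumrB -mulr_suml -/(births X c n).
  have -> : \sum_(u <- explored n) birth_prob X u = births X (fun=> 1) n.
    by apply: eq_bigr => u _; rewrite mulr1.
  have h1 : births X (fun=> 1) n * e1 <= e / 4.
    have b1 := births_le Fs_ge0 lambda_ge0 mu_gt0 Fs_mean M_rho X n
      (fun _ : 'I_K => ler01 : 0 <= (1 : R)).
    rewrite -/s1 in b1; apply: (@le_trans _ _ (s1 i * e1)); first by rewrite ler_wpM2r// ltW.
    have -> : s1 i * e1 = e / 4 * (s1 i / (s1 i + 1)) by rewrite /e1; field; rewrite gt_eqF.
    rewrite -[leRHS]mulr1 ler_wpM2l ?(ltW e4)//.
    by rewrite ler_pdivrMr// mul1r lerDl.
  have h2 : \sum_(u <- (explored n : seq (seq ('I_K * nat)))) (n%:R + 1) * r * C <= e / 4.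
    rewrite big_const_seq count_predT iter_addr_0 -[leLHS]mulr_natl.
    have -> : e / 4 = (n%:R + 1) * ((n%:R + 1) * r * C).
      by rewrite /r; field; rewrite !gt_eqF.
    have rC : 0 <= (n%:R + 1) * r * C.
      exact: mulr_ge0 (mulr_ge0 (ltW n1) (ltW r0)) (ltW C0).
    rewrite ler_wpM2r// (@le_trans _ _ n%:R) ?lerDl// ler_nat.
    by rewrite size_pmap (leq_trans (count_size _ _))// size_iota.
  exact: aux nP h1 h2.
apply: ler_sum => u _.
have bp0 := birth_prob_ge0 X u; set k := label_type i u.
have := ler_wpM2l bp0 (lo k); have := up k.
have : (n%:R * r + expR (- (theta * s * x))) * tail (Fs k) (y x k) <=
  (n%:R + 1) * r * (C * G x).
  apply: ler_pM; rewrite ?tail_ge0//; first by rewrite addr_ge0 ?expR_ge0// mulr_ge0// ltW.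
  by rewrite mulrDl mul1r lerD2l.
move=> h3 _ h4.
have -> : (birth_prob X u - n%:R * r - expR (- (theta * s * x))) * tail (Fs k) (y x k) =
  birth_prob X u * tail (Fs k) (y x k) -
  (n%:R * r + expR (- (theta * s * x))) * tail (Fs k) (y x k) by ring.
apply: le_trans (lerB h4 h3).
by rewrite le_eqVlt; apply/orP; left; apply/eqP; ring.
Unshelve. all: by end_near. Qed.

End busy_tail.

Theorem theorem15 (R : realType) (K : nat)
    (Fs : 'I_K -> probability R R)
    (lambda : 'I_K -> 'I_K -> R) (mu : 'I_K -> R)
    (Fs_ge0 : forall i, supported_ge0 (Fs i))
    (mu_gt0 : forall i, 0 < mu i)
    (Fs_mean : forall i, (\int[Fs i]_s s%:E)%E = (mu i)^-1%:E)
    (lambda_ge0 : forall i j, 0 <= lambda i j)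
    (M_irr : irreducible_mx (mean_offspring lambda mu))
    (M_rho : spectral_radius (mean_offspring lambda mu) < 1)
    (d : measure_display) (T : measurableType d) (P : probability T R)
    (B : forall i, branching_process P Fs lambda i)
    (F : probability R R)
    (F_subexp : subexponential F)
    (F_mean : (\int[F]_x x%:E < +oo)%E)
    (F_rv : regularly_varying_tail F)
    (c : 'I_K -> R)
    (c_ge0 : forall i, 0 <= c i)
    (c_gt0 : exists k, 0 < c k)
    (Fs_tail : forall i,
       sim_at_infty (fun x => tail (Fs i) (x / (1 + mean_busy_input B i)))
         (c i) (tail F)) :
  forall i, sim_at_infty (busy_tail (B i))
    (\sum_j invmx (1%:M - mean_offspring lambda mu) i j * c j) (tail F).
Proof.
have F_ge0 := F_subexp.1.
have betaE k : mean_busy_input B k =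
    \sum_j lambda k j * solve (mean_offspring lambda mu) (fun k => (mu k)^-1) j.
  by apply: eq_bigr => j _; rewrite (mean_busy_period Fs_ge0 lambda_ge0 mu_gt0 Fs_mean M_rho).
have class_tail k : sim_at_infty (fun x => tail (Fs k) (x / (1 +
    \sum_j lambda k j * solve (mean_offspring lambda mu) (fun k => (mu k)^-1) j)))
    (c k) (tail F).
  by rewrite -betaE.
move=> i; apply/cvgrPdist_le => e e0.
have up := busy_tail_upper Fs_ge0 lambda_ge0 mu_gt0 Fs_mean M_rho (B i) F_rv F_ge0 F_mean
  c_ge0 class_tail e0.
have lo := busy_tail_lower Fs_ge0 lambda_ge0 mu_gt0 Fs_mean M_rho (B i) F_rv
  c_ge0 class_tail e0.
near=> x; rewrite distrC ler_distl ler_pdivlMr ?tail_gt0// ler_pdivrMr ?tail_gt0//.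
by apply/andP; split; near: x.
Unshelve. all: by end_near. Qed.
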